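(* Let $\lambda_{1,S}(\sigma)$, for $\sigma\in(0,1)$, be the first (smallest) eigenvalue of the Stokes operator with vanishing Dirichlet traces on the annulus $\Omega^*_\sigma$, and let $\lambda_{1,S}(o)$ be the first eigenvalue of the Stokes operator with vanishing Dirichlet traces on the open unit ball $\Omega^*$. Then $$\lim_{\sigma\to 0}\lambda_{1,S}(\sigma)=\lambda_{1,S}(o).$$
   Context: $\Omega^*:=\{\underline{x}\in\mathbb{R}^3:\ \|\underline{x}\|<1\}$ and, for $\sigma\in(0,1)$, $\Omega^*_\sigma:=\{\underline{x}\in\mathbb{R}^3:\ \sigma<\|\underline{x}\|<1\}$, where $\|\cdot\|$ is the Euclidean norm; the limit is the right-hand limit at $0$. For $\Omega\in\{\Omega^*,\Omega^*_\sigma\}$ let $\underline{\mathcal{V}}(\Omega)$ be the set of all divergence-free (solenoidal) vector fields in $C_0^\infty(\Omega)^3$, let $\underline{\mathbb{H}}(\Omega)$ be its closure in $L_2(\Omega)^3$ and $\underline{\mathbb{V}}(\Omega)$ its closure in $W_2^1(\Omega)^3$, where $W_2^k(\Omega)$ is the usual Sobolev space of order $k$ based on $L_2$. Let $\Upsilon:L_2(\Omega)^3\to\underline{\mathbb{H}}(\Omega)$ be the Leray–Helmholtz (orthogonal) projection. The Stokes operator on $\Omega$ is the Friedrichs extension in $\underline{\mathbb{H}}(\Omega)$ of the operator $\underline{v}\mapsto-\Delta\underline{v}$ defined on $\underline{\mathcal{V}}(\Omega)$; it has domain $W_2^2(\Omega)^3\cap\underline{\mathbb{V}}(\Omega)$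 and is given there by $-\Upsilon\Delta$. It is a positive self-adjoint operator with compact inverse and hence with pure point spectrum. *)

(* Defs.v *)
From HB Require Import structures.
From mathcomp Require Import all_boot all_order all_algebra.
From mathcomp Require Import all_classical all_reals all_analysis.

Set Implicit Arguments.
Unset Strict Implicit.
Unset Printing Implicit Defensive.

Import Order.TTheory GRing.Theory Num.Theory.
Import numFieldNormedType.Exports.

Local Open Scope classical_set_scope.
Local Open Scope ring_scope.

(* [R * R * R] carries a normed space structure, used for derivatives and
   topology.  Its norm is the max norm, hence the explicit Euclidean [enorm]. *)
Notation space R := (R * R * R)%type.

(* A vector field [u] is given by its components: [u i x].  Fields on a domain
   are represented by total functions; everything below depends only on their
   values in the domain. *)
Notation field R := ('I_3 -> space R -> R).

Definition enorm (R : realType) (x : space R) : R :=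
  Num.sqrt (x.1.1 ^+ 2 + x.1.2 ^+ 2 + x.2 ^+ 2).

Definition unit_ball (R : realType) : set (space R) := [set x | enorm x < 1].

Definition annulus (R : realType) (sigma : R) : set (space R) :=
  [set x | sigma < enorm x < 1].

Definition unit_vec (R : realType) (i : 'I_3) : space R :=
  tnth [tuple (1, 0, 0); (0, 1, 0); (0, 0, 1)] i.

Definition pderiv (R : realType) (i : 'I_3) (f : space R -> R) : space R -> R :=
  fun x => 'D_(unit_vec R i) f x.

Definition pderivs (R : realType) (s : seq 'I_3) (f : space R -> R) :
    space R -> R :=
  foldr (@pderiv R) f s.

(* C^oo: all iterated partial derivatives exist and are continuous. *)
Definition smooth (R : realType) (f : space R -> R) : Prop :=
  forall s : seq 'I_3, continuous (pderivs s f) /\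
    forall (i : 'I_3) (x : space R), derivable (pderivs s f) x (unit_vec R i).

Definition supp (R : realType) (f : space R -> R) : set (space R) :=
  closure [set x | f x != 0].

(* C_0^oo(Omega), each function being extended by zero to R^3. *)
Definition test_function (R : realType) (Omega : set (space R))
    (f : space R -> R) : Prop :=
  [/\ smooth f, compact (supp f) & supp f `<=` Omega].

Definition divergence (R : realType) (v : field R) : space R -> R :=
  fun x => \sum_(i < 3) pderiv i (v i) x.

Definition laplacian (R : realType) (v : field R) : field R :=
  fun i x => \sum_(j < 3) pderivs [:: j; j] (v i) x.

Definition solenoidal_test (R : realType) (Omega : set (space R)) :
    set (field R) :=
  [set v : field R |
     (forall i : 'I_3, test_function Omega (v i)) /\ forall x, divergence v x = 0].

(* [space R] with the product of the Borel structures on which the library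
   defines Lebesgue measure. *)
Notation mspace R :=
  (measurableTypeR R * measurableTypeR R * measurableTypeR R)%type.

Definition leb3 (R : realType) : {measure set (mspace R) -> \bar R} :=
  ((@lebesgue_measure R \x @lebesgue_measure R) \x @lebesgue_measure R)%E.

Definition L2 (R : realType) (Omega : set (space R)) : set (field R) :=
  [set u : field R | forall i : 'I_3,
     measurable_fun (Omega : set (mspace R)) (u i : mspace R -> R) /\
     (leb3 R).-integrable Omega (fun x : mspace R => (u i x ^+ 2)%:E)].

Definition ip (R : realType) (Omega : set (space R)) (u v : field R) : R :=
  (\int[leb3 R]_(x in (Omega : set (mspace R)))
     (\sum_(i < 3) u i x * v i x))%R.

Definition solenoidal_L2 (R : realType) (Omega : set (space R)) : set (field R) :=
  [set u : field R | L2 Omega u /\ forall e : R, 0 < e ->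
     exists2 v : field R, solenoidal_test Omega v & ip Omega (u - v) (u - v) < e].

(* Friedrichs extension of a nonnegative symmetric operator [S] with domain [D],
   dense in a Hilbert space [Hs] with inner product [b] (elements of [Hs] are
   identified when their difference is [b]-null).  It is the restriction of the
   adjoint of [S] to the closure of [D] in the norm of the form
   b(u, u) + b(S u, u); [friedrichs b Hs D S u f] says that [u] is in its domain
   and is mapped to [f]. *)
Definition form_domain (R : realType) (E : lmodType R) (b : E -> E -> R)
    (Hs D : set E) (S : E -> E) : set E :=
  [set u | Hs u /\ exists v : nat -> E,
    [/\ forall n, D (v n),
        b (v n - u) (v n - u) @[n --> \oo] --> (0 : R)
      & forall e : R, 0 < e -> exists N : nat, forall m n : nat,
          (N <= m)%N -> (N <= n)%N -> b (S (v m - v n)) (v m - v n) < e]].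

Definition adjoint (R : realType) (E : lmodType R) (b : E -> E -> R)
    (Hs D : set E) (S : E -> E) (u f : E) : Prop :=
  [/\ Hs u, Hs f & forall v, D v -> b u (S v) = b f v].

Definition friedrichs (R : realType) (E : lmodType R) (b : E -> E -> R)
    (Hs D : set E) (S : E -> E) (u f : E) : Prop :=
  form_domain b Hs D S u /\ adjoint b Hs D S u f.

(* For v in the domain below, b(- Delta v, v) is the squared L_2 norm of the
   gradient of v, so that the norm of the form is the norm of W_2^1(Omega)^3 and
   the form domain is the closure of the solenoidal test fields in that space. *)
Definition stokes (R : realType) (Omega : set (space R)) :
    field R -> field R -> Prop :=
  friedrichs (ip Omega) (solenoidal_L2 Omega) (solenoidal_test Omega)
    (fun v => - laplacian v).

Definition stokes_eigenvalue (R : realType) (Omega : set (space R)) : set R :=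
  [set l | exists2 u : field R, ip Omega u u != 0 & stokes Omega u (l *: u)].

Definition first_stokes_eigenvalue (R : realType) (Omega : set (space R))
    (l : R) : Prop :=
  stokes_eigenvalue Omega l /\ lbound (stokes_eigenvalue Omega) l.

(* Main.v *)
Require Import Defs.
From HB Require Import structures.
From mathcomp Require Import all_boot all_order all_algebra.
From mathcomp Require Import all_classical all_reals all_analysis.
From mathcomp Require Import measurable_realfun.
From mathcomp Require Import ring lra.
Import Order.TTheory GRing.Theory Num.Theory.
Import numFieldNormedType.Exports.
Set Implicit Arguments.
Unset Strict Implicit.
Unset Printing Implicit Defensive.
Local Open Scope classical_set_scope.
Local Open Scope ring_scope.
Import Defs.

(** The first eigenvalue of the Stokes operator is the minimum of the Rayleigh
    quotient [ip (- laplacian v) v / ip v v] over the solenoidal test fields.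
    That no eigenvalue lies below a lower bound of the quotient is
    [friedrichs_ge]; that the infimum is an eigenvalue is [friedrichs_min], which
    needs the completeness of the space of square-integrable fields
    ([L2_complete]) and the compactness of sets bounded for the Dirichlet form
    ([rellich]).  The theorem thus becomes a comparison of test fields.

    A test field of the annulus is a test field of the ball, with the same Rayleigh
    quotient; hence [lambda_o <= lambda sigma].

    Conversely, a point of three-dimensional space has no capacity, and this
    remains so under the constraint of zero divergence ([punctured_approx]).  A
    solenoidal test field [v] coincides in the ball with the curl of a smooth
    potential [A], obtained by integration in the third variable, and [A] can be chosen to vanish
    at the origin.  If [eta] is a cut-off function that is 1 near the ball of
    radius [sigma] and vanishes at distance of order [sigma], then
    [v - curl (eta A)] is a solenoidal test field of the annulus.  Since
    [A = O(sigma)] on the support of [eta], the gradient of [curl (eta A)] is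
    [O(1 / sigma)] on a set of volume [O(sigma ^ 3)], and the Rayleigh quotient
    changes by a quantity that tends to 0 with [sigma].  Taking for [v] a field
    whose quotient is close to [lambda_o] gives [lambda sigma < lambda_o + e] for
    small [sigma].

    Test fields vanish outside the cube [-1, 1]^3, so their integrals are iterated
    integrals of continuous functions over segments; the calculus needed for the
    Dirichlet form, for Friedrichs' inequality on small cells and for the potential
    is developed in that form. *)

(** * Positive semidefinite forms *)

Section PsdForm.
Context {R : realType} {E : lmodType R}.
Implicit Types (V : set E) (q : E -> E -> R) (u v w : E).

Definition lin_closed V := forall k u v, V u -> V v -> V (k *: u + v).

(** The form is bilinear on [V] only: the integral defining [ip] is additive on
    square-integrable fields, not on all fields, and the Dirichlet form is
    symmetric on test fields. *)
Record psd_form V q : Prop := PsdForm {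
  psd_lin : forall k u v w, V u -> V v -> V w ->
    q (k *: u + v) w = k * q u w + q v w;
  psd_sym : forall u v, V u -> V v -> q u v = q v u;
  psd_ge0 : forall u, V u -> 0 <= q u u }.

Context {V : set E} {q : E -> E -> R}.
Hypotheses (linV : lin_closed V) (psdq : psd_form V q).

Lemma lin_closedD u v : V u -> V v -> V (u + v).
Proof. by move=> Vu Vv; rewrite -(scale1r u); exact: linV. Qed.

Lemma lin_closedB u v : V u -> V v -> V (u - v).
Proof. by move=> Vu Vv; rewrite addrC -scaleN1r; exact: linV. Qed.

Lemma lin_closedZ k u : V u -> V (k *: u).
Proof.
move=> Vu; have := linV (k - 1) Vu Vu.
by rewrite scalerBl scale1r subrK.
Qed.

Lemma psdDl u v w : V u -> V v -> V w -> q (u + v) w = q u w + q v w.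
Proof. by move=> *; rewrite -{1}(scale1r u) (psd_lin psdq)// mul1r. Qed.

Lemma psdBl u v w : V u -> V v -> V w -> q (u - v) w = q u w - q v w.
Proof. by move=> *; rewrite addrC -scaleN1r (psd_lin psdq)// mulN1r addrC. Qed.

Lemma psdZl k u w : V u -> V w -> q (k *: u) w = k * q u w.
Proof.
move=> Vu Vw; have := psd_lin psdq (k - 1) Vu Vu Vw.
by rewrite scalerBl scale1r subrK => ->; ring.
Qed.

Lemma psdDr u v w : V u -> V v -> V w -> q w (u + v) = q w u + q w v.
Proof.
move=> Vu Vv Vw; rewrite (psd_sym psdq) ?psdDl//; last exact: lin_closedD.
by rewrite (psd_sym psdq Vu)// (psd_sym psdq Vv).
Qed.

Lemma psdBr u v w : V u -> V v -> V w -> q w (u - v) = q w u - q w v.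
Proof.
move=> Vu Vv Vw; rewrite (psd_sym psdq) ?psdBl//; last exact: lin_closedB.
by rewrite (psd_sym psdq Vu)// (psd_sym psdq Vv).
Qed.

Lemma psdZr k u w : V u -> V w -> q w (k *: u) = k * q w u.
Proof.
move=> Vu Vw; rewrite (psd_sym psdq) ?psdZl//; last exact: lin_closedZ.
by rewrite (psd_sym psdq Vu).
Qed.

Lemma psd_sqrD u v : V u -> V v -> q (u + v) (u + v) = q u u + 2 * q u v + q v v.
Proof.
move=> Vu Vv; have Vuv := lin_closedD Vu Vv.
by rewrite psdDl// !psdDr// (psd_sym psdq Vv Vu); ring.
Qed.

Lemma psd_sqrB u v : V u -> V v -> q (u - v) (u - v) = q u u - 2 * q u v + q v v.
Proof.
move=> Vu Vv; have Vuv := lin_closedB Vu Vv.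
by rewrite psdBl// !psdBr// (psd_sym psdq Vv Vu); ring.
Qed.

(** [q (t u - v) (t u - v)] is a nonnegative polynomial in [t]; if [q u u = 0],
    it is affine, hence constant. *)
Lemma psd_CS u v : V u -> V v -> q u v ^+ 2 <= q u u * q v v.
Proof.
move=> Vu Vv.
have quu := psd_ge0 psdq Vu; have qvv := psd_ge0 psdq Vv.
have P t : 0 <= t ^+ 2 * q u u - 2 * t * q u v + q v v.
  have := psd_ge0 psdq (lin_closedB (lin_closedZ t Vu) Vv).
  rewrite psd_sqrB//; last exact: lin_closedZ.
  rewrite psdZl//; last exact: lin_closedZ.
  by rewrite psdZr// psdZl//; set a := q u u; set b := q u v; nra.
have [u0|u0] := eqVneq (q u u) 0.
  have {}P t : 2 * t * q u v <= q v v by have := P t; rewrite u0; lra.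
  have [->|uv0] := eqVneq (q u v) 0; first by rewrite u0; lra.
  have := P ((q v v + 1) / q u v); rewrite u0.
  rewrite mulrA mulfVK//; lra.
have := P (q u v / q u u).
have -> : (q u v / q u u) ^+ 2 * q u u - 2 * (q u v / q u u) * q u v + q v v =
  (q u u * q v v - q u v ^+ 2) / q u u by field.
by rewrite pmulr_lge0 ?subr_ge0// invr_gt0 lt_neqAle eq_sym u0.
Qed.

Lemma psd_cvgl (v : nat -> E) u w : (forall n, V (v n)) -> V u -> V w ->
  q (v n - u) (v n - u) @[n --> \oo] --> (0 : R) ->
  q (v n) w @[n --> \oo] --> q u w.
Proof.
move=> Vv Vu Vw vu; rewrite -(subr0 (q u w)).
apply/cvgrPdist_lt => e e0.
have c0 : 0 < q w w + 1 by rewrite ltr_wpDl// (psd_ge0 psdq).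
have e20 : 0 < e ^+ 2 / (q w w + 1) by rewrite divr_gt0// exprn_gt0.
move/cvgrPdist_lt : vu => /(_ _ e20); apply: filterS => n.
rewrite subr0 sub0r normrN ger0_norm; last exact: (psd_ge0 psdq (lin_closedB (Vv n) Vu)).
rewrite ltr_pdivlMr// => h.
rewrite distrC -psdBl//.
have /= CS := psd_CS (lin_closedB (Vv n) Vu) Vw.
rewrite -(ltr_pXn2r (n:=2))// ?nnegrE ?(ltW e0)//.
rewrite real_normK ?num_real//; apply: le_lt_trans CS _.
apply: le_lt_trans h; apply: ler_wpM2l; last by rewrite lerDl.
exact: (psd_ge0 psdq (lin_closedB (Vv n) Vu)).
Qed.

Lemma psd_cvg_sqr (v : nat -> E) u : (forall n, V (v n)) -> V u ->
  q (v n - u) (v n - u) @[n --> \oo] --> (0 : R) ->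
  q (v n) (v n) @[n --> \oo] --> q u u.
Proof.
move=> Vv Vu vu.
have -> : (fun n => q (v n) (v n)) =
    (fun n => q (v n - u) (v n - u) + (2 * q (v n) u - q u u)).
  by apply/funext => n; rewrite psd_sqrB//; ring.
rewrite [X in _ --> X](_ : q u u = 0 + (2 * q u u - q u u)); last by ring.
apply: cvgD; first exact: vu.
apply: cvgB; last exact: cvg_cst.
by apply: cvgM; [exact: cvg_cst|exact: psd_cvgl].
Qed.

End PsdForm.

(** * The Rayleigh quotient of a Friedrichs extension *)

Section Friedrichs.
Context {R : realType} {E : lmodType R}.
Variables (b : E -> E -> R) (L D : set E) (S : E -> E).
Hypotheses (linL : lin_closed L) (psdb : psd_form L b).
Hypotheses (linD : lin_closed D) (DL : D `<=` L) (SL : forall v, D v -> L (S v)).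
Hypothesis psda : psd_form D (fun v w => b (S v) w).

Definition form_closure : set E :=
  [set u | L u /\ forall e : R, 0 < e -> exists2 v, D v & b (u - v) (u - v) < e].

Definition form_cauchy (v : nat -> E) := forall e : R, 0 < e -> exists N : nat,
  forall m n, (N <= m)%N -> (N <= n)%N -> b (v m - v n) (v m - v n) < e.

Let a v w := b (S v) w.

(** The eigenvector [u] lies in the closure of [D] only, so the lower bound on
    [D] has to be transported along a form-Cauchy sequence [v n] tending to [u].
    For large [n] and [k] the form of [v n - v k] is at most [e], that is,
    [2 a (v k) (v n) >= a (v n) (v n) + a (v k) (v k) - e], and the right-hand
    side is bounded below by [m].  The mixed term survives the passage to the
    limit, since [a (v k) (v n) = b (v k) (S (v n))] tends to
    [b u (S (v n)) = l * b u (v n)] and then to [l * b u u]. *)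
Lemma friedrichs_ge (m l : R) u :
  (forall v, D v -> m * b v v <= b (S v) v) ->
  b u u != 0 -> friedrichs b form_closure D S u (l *: u) -> m <= l.
Proof.
move=> mP u0 [[[Lu _] [v [Dv vu vC]]] [_ _ adj]].
have Lv n : L (v n) by exact: DL.
have bu : 0 < b u u by rewrite lt_neqAle eq_sym u0/= (psd_ge0 psdb).
rewrite -(ler_pM2r bu); apply/ler_addgt0Pr => e e0.
have [N vN] := vC _ e0.
have av n k : (N <= n)%N -> (N <= k)%N ->
    m * b (v n) (v n) + m * b (v k) (v k) - e <= 2 * a (v k) (v n).
  move=> Nn Nk; have := vN _ _ Nn Nk => /ltW.
  rewrite (psd_sqrB linD psda)// (psd_sym psda (Dv n) (Dv k)) -/(a _ _) => h.
  have := mP _ (Dv n); have := mP _ (Dv k); rewrite -!/(a _ _) in h *; lra.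
have vv := psd_cvg_sqr linL psdb Lv Lu vu.
have lb n : (N <= n)%N -> m * b (v n) (v n) + m * b u u - e <= 2 * (l * b u (v n)).
  move=> Nn; have -> : l * b u (v n) = b u (S (v n)).
    by rewrite adj// (psdZl psdb).
  have c1 : m * b (v n) (v n) + m * b (v k) (v k) - e @[k --> \oo] -->
      m * b (v n) (v n) + m * b u u - e.
    apply: cvgB; last exact: cvg_cst.
    apply: cvgD; first exact: cvg_cst.
    by apply: cvgM => //; exact: cvg_cst.
  have c2 : 2 * b (v k) (S (v n)) @[k --> \oo] --> 2 * b u (S (v n)).
    apply: cvgM; first exact: cvg_cst.
    by apply: (psd_cvgl linL psdb) => //; exact: SL.
  apply: (ler_cvg_to c1 c2); exists N => // k /= Nk.
  rewrite (psd_sym psdb (Lv k))//; last exact: SL.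
  by rewrite (psd_sym psda (Dv n) (Dv k)); exact: av.
have c1 : m * b (v n) (v n) + m * b u u - e @[n --> \oo] -->
    m * b u u + m * b u u - e.
  apply: cvgB; last exact: cvg_cst.
  apply: cvgD; last exact: cvg_cst.
  by apply: cvgM => //; exact: cvg_cst.
have c2 : 2 * (l * b u (v n)) @[n --> \oo] --> 2 * (l * b u u).
  do 2 (apply: cvgM; first exact: cvg_cst).
  rewrite (_ : (fun n => _) = fun n => b (v n) u).
    exact: (psd_cvgl linL psdb).
  by apply/funext => n; rewrite (psd_sym psdb).
have : m * b u u + m * b u u - e <= 2 * (l * b u u).
  by apply: (ler_cvg_to c1 c2); exists N => // n /= Nn; exact: lb.
lra.
Qed.

Hypothesis completeL : forall v : nat -> E, (forall n, L (v n)) -> form_cauchy v ->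
  exists2 u, L u & b (v n - u) (v n - u) @[n --> \oo] --> (0 : R).

Hypothesis compactD : forall (v : nat -> E) (C : R), (forall n, D (v n)) ->
  (forall n, b (v n) (v n) + b (S (v n)) (v n) <= C) ->
  exists2 f : nat -> nat, (forall n, (n <= f n)%N) & form_cauchy (v \o f).

(** The infimum [m] of the Rayleigh quotient on [D] is an eigenvalue.  A
    normalised minimising sequence has, by compactness and completeness, a
    subsequence with a [b]-limit [u].  As [b (v + w) (v + w)] is close to 4 for
    late terms [v], [w], the parallelogram law and [m * b <= a] make the sequence
    Cauchy for [a] as well, so that [u] is in the form domain; Cauchy-Schwarz for
    the form [a - m * b] turns [a v v - m * b v v --> 0] into
    [b u (S w) = m * b u w]. *)
Lemma friedrichs_min : (exists2 v, D v & b v v != 0) ->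
  exists m : R, (exists2 u, b u u != 0 & friedrichs b form_closure D S u (m *: u)) /\
    (forall v, D v -> m * b v v <= b (S v) v).
Proof.
move=> [v0 Dv0 bv0].
pose Q : set R := [set b (S v) v / b v v | v in [set v | D v /\ b v v != 0]].
have bpos v : D v -> b v v != 0 -> 0 < b v v.
  by move=> Dv h; rewrite lt_neqAle eq_sym h/= (psd_ge0 psdb)//; exact: DL.
have Qlb : lbound Q 0.
  move=> _ [v [Dv bv] <-].
  by rewrite divr_ge0 ?(psd_ge0 psda Dv)// (psd_ge0 psdb)//; exact: DL.
have hQ : has_inf Q.
  by split; [exists (b (S v0) v0 / b v0 v0), v0|exists 0].
pose m := inf Q.
have m0 : 0 <= m by apply: lb_le_inf => //; case: hQ.
have mP v : D v -> m * b v v <= b (S v) v.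
  move=> Dv; have [->|bv] := eqVneq (b v v) 0.
    by rewrite mulr0 (psd_ge0 psda).
  rewrite -ler_pdivlMr; last exact: bpos.
  by apply: ge_inf; [exists 0|exists v].
have /choice[v vP] : forall n : nat, exists v, [/\ D v, b v v = 1 &
    b (S v) v <= m + n.+1%:R^-1].
  move=> n; have n0 : 0 < (n.+1%:R^-1 : R) by [].
  have [_ [v [Dv bv] <-] lt] := inf_adherent n0 hQ.
  have bv' := bpos _ Dv bv.
  pose s := Num.sqrt (b v v).
  have s0 : 0 < s by rewrite sqrtr_gt0.
  have ss : b v v = s ^+ 2 by rewrite sqr_sqrtr// ltW.
  have Dsv : D (s^-1 *: v) by exact: (lin_closedZ linD).
  exists (s^-1 *: v); split => //.
    rewrite (psdZl psdb) ?(psdZr linL psdb)//; do ?exact: DL.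
    by rewrite ss; field; exact: lt0r_neq0.
  rewrite (psdZl psda)// (psdZr linD psda)//.
  rewrite mulrA -invfM -expr2 -ss mulrC; exact: ltW.
have Lv n : L (v n) by apply: DL; case: (vP n).
have [f fn fC] : exists2 f : nat -> nat, (forall n, (n <= f n)%N) & form_cauchy (v \o f).
  apply: (compactD (C := m + 2)) => n; first by case: (vP n).
  have [_ -> h] := vP n.
  have : (n.+1%:R^-1 : R) <= 1 by rewrite invf_le1// ler1n.
  by move: h; set x := _^-1; set y := b _ _; lra.
have [u Lu vu] := completeL (fun n => Lv (f n)) fC.
have Dv n : D (v (f n)) by case: (vP (f n)).
have bv n : b (v (f n)) (v (f n)) = 1 by case: (vP (f n)).
have av n : b (S (v (f n))) (v (f n)) <= m + n.+1%:R^-1.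
  have [_ _ h] := vP (f n); apply: (le_trans h).
  by rewrite lerD2l lef_pV2 ?posrE// ler_nat ltnS.
have bu : b u u = 1.
  have := psd_cvg_sqr linL psdb (v := v \o f) (fun n => Lv (f n)) Lu vu.
  under eq_fun do rewrite /= bv.
  by move=> h; apply: (cvg_unique _ h (cvg_cst _)); exact: norm_hausdorff.
have Hu : form_closure u.
  split=> // e e0; move/cvgrPdist_lt : vu => /(_ _ e0)[N _ /(_ N (leqnn _))].
  have LvN : L (v (f N) - u) by exact: (lin_closedB linL).
  rewrite /= sub0r normrN ger0_norm ?(psd_ge0 psdb)// => h.
  exists (v (f N)) => //; rewrite -(opprB _ u) -scaleN1r.
  by rewrite (psdZl psdb) ?(psdZr linL psdb) ?mulN1r ?opprK//; exact: (lin_closedZ linL).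
exists m; split=> //; exists u; first by rewrite bu oner_neq0.
split.
- split=> //; exists (v \o f); split=> // e e0.
  have e80 : 0 < e / 8 by lra.
  have m10 : 0 < m + 1 by lra.
  have [N1 h1] := fC _ (divr_gt0 e80 m10).
  have [N2 _ h2] : \forall n \near \oo, n.+1%:R^-1 < e / 8.
    exact: (near_infty_natSinv_lt (PosNum e80)).
  exists (maxn N1 N2) => k n /=; rewrite !geq_max => /andP[k1 k2] /andP[n1 n2].
  have Dkn := lin_closedD linD (Dv k) (Dv n).
  have := mP _ Dkn.
  have := h1 _ _ k1 n1; rewrite /= (psd_sqrB linL psdb)// ltr_pdivlMr//.
  rewrite (psd_sqrD linD psda)// (psd_sqrB linD psda)// (psd_sqrD linL psdb)// !bv.
  move: (h2 _ k2) (h2 _ n2) (av k) (av n) => /=.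
  set x := b (v (f k)) (v (f n)); set y := b (S (v (f k))) (v (f n)).
  have : b (v (f k) - v (f n)) (v (f k) - v (f n)) >= 0.
    exact: (psd_ge0 psdb (lin_closedB linL (Lv _) (Lv _))).
  rewrite (psd_sqrB linL psdb)// !bv -/x.
  move: k.+1%:R^-1 n.+1%:R^-1 (b (S (v (f k))) _) (b (S (v (f n))) _) => r1 r2 a1 a2.
  have : 0 <= m * 1 by rewrite mulr1.
  nra.
- split=> //.
    have [_ Hu2] := Hu; split=> [|e e0]; first exact: (lin_closedZ linL).
    have m20 : 0 < m ^+ 2 + 1 by rewrite ltr_wpDl// sqr_ge0.
    have [w Dw h] := Hu2 _ (divr_gt0 e0 m20).
    exists (m *: w); first exact: (lin_closedZ linD).
    have Luw : L (u - w) by apply: (lin_closedB linL) => //; exact: DL.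
    rewrite -scalerBr (psdZl psdb)//; last exact: (lin_closedZ linL).
    rewrite (psdZr linL psdb)// mulrA -expr2.
    rewrite ltr_pdivlMr// in h; have := psd_ge0 psdb Luw; nra.
move=> w Dw; have Lw := DL Dw.
rewrite (psdZl psdb)//.
have psdc : psd_form D (fun x y => b (S x) y - m * b x y).
  split=> [k x y z Dx Dy Dz|x y Dx Dy|x Dx].
  - rewrite (psd_lin psdb k (DL Dx) (DL Dy) (DL Dz)).
    by have /= -> := psd_lin psda k Dx Dy Dz; ring.
  - by rewrite (psd_sym psdb (DL Dx) (DL Dy)) (psd_sym psda Dx Dy).
  - by rewrite subr_ge0 mP.
have c1 : b (v (f n)) (S w) @[n --> \oo] --> b u (S w).
  by apply: (psd_cvgl linL psdb) => //; exact: SL.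
have c2 : m * b (v (f n)) w @[n --> \oo] --> m * b u w.
  by apply: cvgM; [exact: cvg_cst|exact: (psd_cvgl linL psdb)].
apply/eqP; rewrite -subr_eq0; apply/eqP.
have c3 : b (v (f n)) (S w) - m * b (v (f n)) w @[n --> \oo] -->
    b u (S w) - m * b u w by exact: cvgB.
suff c4 : b (v (f n)) (S w) - m * b (v (f n)) w @[n --> \oo] --> (0 : R).
  by apply: (cvg_unique _ c3 c4); exact: norm_hausdorff.
apply/cvgrPdist_le => e e0.
have c0 : 0 < b (S w) w - m * b w w + 1.
  by rewrite ltr_wpDl// subr_ge0 mP.
have d0 := divr_gt0 (exprn_gt0 2 e0) c0.
have := near_infty_natSinv_lt (PosNum d0); apply: filterS => n /=.
rewrite ltr_pdivlMr// => h.
rewrite sub0r normrN -(ler_pXn2r (n:=2))// ?nnegrE ?(ltW e0)//.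
rewrite real_normK ?num_real//.
have -> : b (v (f n)) (S w) = b (S (v (f n))) w.
  by rewrite (psd_sym psdb (Lv _) (SL Dw)); exact: (psd_sym psda Dw (Dv n)).
have /= := psd_CS linD psdc (Dv n) Dw; rewrite bv mulr1.
have := av n; have := mP _ (Dv n); rewrite bv mulr1; have := mP _ Dw; move: h.
have : (0 : R) < n.+1%:R^-1 by [].
move: n.+1%:R^-1 (b (S (v (f n))) (v (f n))) (_ ^+ 2) (b (S w) w) (m * b w w).
move=> r1 a1 s a2 m2 r10 h h1 h2 h3 CS; apply: (le_trans CS); apply/ltW.
apply: le_lt_trans h.
apply: ler_pM; rewrite ?subr_ge0//; lra.
Qed.

End Friedrichs.

(** * Integrals over a segment *)

Notation Int a b g := (Rintegral lebesgue_measure `[a, b]%classic g).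

Section Continuity.
Context {R : realType} {T : topologicalType}.
Implicit Types f g : T -> R.

Lemma cont_cst (U : topologicalType) (u : U) : continuous (fun _ : T => u).
Proof. by move=> t; exact: cst_continuous. Qed.

Lemma contD f g : continuous f -> continuous g -> continuous (fun t => f t + g t).
Proof. by move=> cf cg t; apply: continuousD; [exact: cf|exact: cg]. Qed.

Lemma contB f g : continuous f -> continuous g -> continuous (fun t => f t - g t).
Proof. by move=> cf cg t; apply: continuousB; [exact: cf|exact: cg]. Qed.

Lemma contM f g : continuous f -> continuous g -> continuous (fun t => f t * g t).
Proof. by move=> cf cg t; apply: continuousM; [exact: cf|exact: cg]. Qed.

Lemma contZ k f : continuous f -> continuous (fun t => k * f t).
Proof. by move=> cf; apply: contM => //; exact: cont_cst. Qed.

Lemma contX2 f : continuous f -> continuous (fun t => f t ^+ 2).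
Proof. by move=> cf; exact: contM. Qed.

Lemma cont_norm f : continuous f -> continuous (fun t => `|f t|).
Proof. by move=> cf t; apply: continuous_comp; [exact: cf|exact: norm_continuous]. Qed.

Lemma cont_sum (I : Type) (r : seq I) (F : I -> T -> R) :
  (forall i, continuous (F i)) -> continuous (fun t => \sum_(i <- r) F i t).
Proof.
move=> cF; elim: r => [|i r IH]; first by under eq_fun do rewrite big_nil; exact: cont_cst.
by under eq_fun do rewrite big_cons; exact: contD.
Qed.

Lemma cont_pair (U V : topologicalType) (u : T -> U) (v : T -> V) :
  continuous u -> continuous v -> continuous (fun t => (u t, v t)).
Proof.
move=> cu cv t A [[B C] /= [B0 C0] BC].
have : \forall s \near t, B (u s) /\ C (v s) by apply: filterI; [exact: cu|exact: cv].
apply: filterS => s [? ?].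
exact: (BC (u s, v s)).
Qed.

Lemma cont_comp (U V : topologicalType) (u : T -> U) (v : U -> V) :
  continuous u -> continuous v -> continuous (fun t => v (u t)).
Proof. by move=> cu cv t; apply: continuous_comp; [exact: cu|exact: cv]. Qed.

Lemma cont_id : continuous (fun t : T => t).
Proof. by move=> t; exact: cvg_id. Qed.

End Continuity.

Lemma is_derive_cont {R : realType} (f g : R -> R) :
  (forall t : R, is_derive t (1 : R) f (g t)) -> continuous f.
Proof.
by move=> df t; apply/differentiable_continuous/derivable1_diffP; case: (df t).
Qed.

Section Int.
Context {R : realType}.
Implicit Types (f g : R -> R) (a b c k : R).

Lemma Int_integrable a b g : continuous g ->
  (@lebesgue_measure R).-integrable `[a, b] (EFin \o g).
Proof.
move=> cg; apply: continuous_compact_integrable; first exact: segment_compact.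
exact: continuous_subspaceT.
Qed.

Lemma IntD a b f g : continuous f -> continuous g ->
  Int a b (fun t => f t + g t) = Int a b f + Int a b g.
Proof. by move=> cf cg; apply: RintegralD => //; exact: Int_integrable. Qed.

Lemma IntB a b f g : continuous f -> continuous g ->
  Int a b (fun t => f t - g t) = Int a b f - Int a b g.
Proof. by move=> cf cg; apply: RintegralB => //; exact: Int_integrable. Qed.

Lemma IntZ a b k g : continuous g -> Int a b (fun t => k * g t) = k * Int a b g.
Proof. by move=> cg; apply: RintegralZl => //; exact: Int_integrable. Qed.

Lemma le_Int a b f g : continuous f -> continuous g ->
  (forall t, a <= t <= b -> f t <= g t) -> Int a b f <= Int a b g.
Proof.
move=> cf cg fg; apply: le_Rintegral => //; first exact: Int_integrable.
exact: Int_integrable.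
Qed.

Lemma Int_ge0 a b g : (forall t, 0 <= g t) -> 0 <= Int a b g.
Proof. by move=> g0; exact: Rintegral_ge0. Qed.

Lemma Int_cst a b k : a <= b -> Int a b (fun=> k) = k * (b - a).
Proof.
move=> ab; rewrite Rintegral_cst//= lebesgue_measure_itv/= lte_fin.
by case: ltP => //= ba; rewrite (le_anti (x:=a) (y:=b)) ?ab// subrr.
Qed.

Lemma eq_Int a b f g : (forall t, a <= t <= b -> f t = g t) -> Int a b f = Int a b g.
Proof. by move=> fg; apply: eq_Rintegral => t; rewrite inE/= in_itv/=; exact: fg. Qed.

Lemma Int_eq0 a b f : (forall t, a <= t <= b -> f t = 0) -> Int a b f = 0.
Proof.
move=> f0; rewrite (@eq_Int a b f (fun=> 0))//.
by rewrite Rintegral_cst//= mul0r.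
Qed.

Lemma Int_split a c b g : continuous g -> a <= c <= b ->
  Int a b g = Int a c g + Int c b g.
Proof.
move=> cg /andP[ac cb].
have := Rintegral_itvB (x := c) (Int_integrable a b cg).
rewrite !bnd_simp => /(_ ac cb); rewrite Rintegral_itv_obnd_cbnd.
  by move=> <-; rewrite addrC subrK.
by apply: integrableS (Int_integrable c b cg) => //; exact: subset_itv_oc_cc.
Qed.

Lemma norm_Int_le a b M g : continuous g -> a <= b ->
  (forall t, a <= t <= b -> `|g t| <= M) -> `|Int a b g| <= M * (b - a).
Proof.
move=> cg ab gM; apply: le_trans (le_normr_Rintegral _ _) _ => //.
  exact: Int_integrable.
rewrite -Int_cst//; apply: le_Int => //; last exact: cont_cst.
exact: cont_norm.
Qed.

Lemma Int_FTC a b f g : a <= b -> continuous g ->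
  (forall t : R, is_derive t (1 : R) f (g t)) -> Int a b g = f b - f a.
Proof.
move=> ab cg df; have [ba|ab'] := leP b a.
  have -> : b = a by apply/le_anti; rewrite ab ba.
  by rewrite set_itv1 Rintegral_set1 subrr.
have cf := is_derive_cont df.
rewrite /Rintegral (@continuous_FTC2 _ g f)//.
- exact: continuous_subspaceT.
- split.
  + by move=> t _; case: (df t).
  + by apply: cvg_at_right_filter; exact: cf.
  + by apply: cvg_at_left_filter; exact: cf.
- by move=> t _; rewrite derive1E; apply: derive_val.
Qed.

Lemma Int_CS a b g : continuous g -> a <= b ->
  Int a b g ^+ 2 <= (b - a) * Int a b (fun t => g t ^+ 2).
Proof.
move=> cg; rewrite le_eqVlt => /predU1P[<-|ab].
  by rewrite set_itv1 !Rintegral_set1 expr0n mulr0.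
have cg2 := contX2 cg.
set I := Int a b g; pose c := I / (b - a).
have cc : continuous (fun t => g t ^+ 2 - 2 * c * g t).
  by apply: contB => //; exact: contZ.
have : 0 <= Int a b (fun t => g t ^+ 2 - 2 * c * g t + c ^+ 2).
  apply: Int_ge0 => t; have -> : g t ^+ 2 - 2 * c * g t + c ^+ 2 = (g t - c) ^+ 2 by ring.
  exact: sqr_ge0.
rewrite (IntD _ _ cc (@cont_cst _ _ _)) (IntB _ _ cg2 (contZ cg)) IntZ// (Int_cst _ (ltW ab)).
rewrite -/I /c; have ba : 0 < b - a by rewrite subr_gt0.
have -> : 2 * (I / (b - a)) * I = 2 * I ^+ 2 / (b - a) by field; exact: lt0r_neq0.
have -> : (I / (b - a)) ^+ 2 * (b - a) = I ^+ 2 / (b - a) by field; exact: lt0r_neq0.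
move=> h; rewrite mulrC -ler_pdivrMr//; lra.
Qed.

(** With [h = b - a], the function [h * f x - Int a b f] is the integral over
    [y] of [f x - f y], and [f x - f y] is an integral of [g]; two applications
    of Cauchy-Schwarz bound its square by [h ^+ 3] times the integral of [g ^+ 2].
    Expanding the square and integrating over [x] gives the claim. *)
Lemma Int_friedrichs a b f g : a < b -> continuous g ->
  (forall t : R, is_derive t (1 : R) f (g t)) ->
  Int a b (fun t => f t ^+ 2) <=
    Int a b f ^+ 2 / (b - a) + (b - a) ^+ 2 * Int a b (fun t => g t ^+ 2).
Proof.
move=> ab cg df; have h0 : 0 < b - a by rewrite subr_gt0.
have cf := is_derive_cont df.
have cg2 := contX2 cg; have cf2 := contX2 cf.
set G := Int a b (fun t => g t ^+ 2).
have G0 : 0 <= G by apply: Int_ge0 => t; exact: sqr_ge0.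
have osc x y : a <= x <= b -> a <= y <= b -> (f x - f y) ^+ 2 <= (b - a) * G.
  wlog xy : x y / x <= y.
    move=> W hx hy; have [/W|/ltW/W] := leP x y; first exact.
    by move=> /(_ hy hx); rewrite -sqrrN opprB.
  move=> /andP[ax xb] /andP[ay yb].
  rewrite -sqrrN opprB -(@Int_FTC x y f g)//.
  apply: (le_trans (Int_CS cg xy)); apply: ler_pM; rewrite ?subr_ge0//.
  - by apply: Int_ge0 => t; exact: sqr_ge0.
  - by rewrite lerB.
  - rewrite /G (@Int_split a x b)//; last by rewrite ax xb.
    rewrite (@Int_split x y b)//; last by rewrite xy yb.
    rewrite addrCA lerDl addr_ge0//; apply: Int_ge0 => t; exact: sqr_ge0.
set I := Int a b f; set h := b - a in h0 osc *.
have pt x : a <= x <= b -> (h * f x - I) ^+ 2 <= h ^+ 3 * G.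
  move=> hx; have -> : h * f x - I = Int a b (fun y => f x - f y).
    by rewrite (IntB _ _ (@cont_cst _ _ (f x)) cf) (Int_cst _ (ltW ab)) mulrC.
  apply: (le_trans (Int_CS _ (ltW ab))); first by apply: contB => //; exact: cont_cst.
  rewrite -/h exprS -mulrA ler_pM2l// exprS expr1.
  have -> : h * h * G = (h * G) * (b - a) by rewrite /h; ring.
  rewrite -(Int_cst _ (ltW ab)); apply: le_Int; [|exact: cont_cst|].
    by apply/contX2/contB => //; exact: cont_cst.
  by move=> t ht; exact: osc.
have : Int a b (fun x => (h * f x - I) ^+ 2) <= h ^+ 3 * G * (b - a).
  rewrite -(Int_cst _ (ltW ab)); apply: le_Int; [|exact: cont_cst|exact: pt].
  by apply/contX2/contB; [exact: contZ|exact: cont_cst].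
have -> : (fun x => (h * f x - I) ^+ 2) =
    (fun x => h ^+ 2 * f x ^+ 2 - 2 * h * I * f x + I ^+ 2).
  by apply/funext => x; ring.
rewrite IntD; [|by apply: contB; exact: contZ|exact: cont_cst].
rewrite IntB; [|exact: contZ|exact: contZ].
rewrite (Int_cst _ (ltW ab)) !IntZ// -/I -/h.
set F2 := Int a b _ => H.
have h20 : 0 < h ^+ 2 by rewrite exprn_gt0.
rewrite -(ler_pM2l h20); have -> : h ^+ 2 * (I ^+ 2 / h + h ^+ 2 * G) =
  h * I ^+ 2 + h ^+ 4 * G by field; exact: lt0r_neq0.
have -> : h ^+ 4 * G = h ^+ 3 * G * h by ring.
by move: H; set A := _ * _ * h; lra.
Qed.

Lemma Int_cells a b g (N : nat) : a <= b -> continuous g -> (0 < N)%N ->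
  Int a b g = \sum_(k < N) Int (a + k%:R * ((b - a) / N%:R))
                              (a + k.+1%:R * ((b - a) / N%:R)) g.
Proof.
move=> ab cg N0; set h := (b - a) / N%:R.
have h0 : 0 <= h by rewrite divr_ge0// subr_ge0.
have H n : Int a (a + n%:R * h) g =
    \sum_(k < n) Int (a + k%:R * h) (a + k.+1%:R * h) g.
  elim: n => [|n IH]; first by rewrite big_ord0 mul0r addr0 set_itv1 Rintegral_set1.
  rewrite big_ord_recr/= -IH; apply: Int_split => //.
  by rewrite lerDl mulr_ge0//= lerD2l ler_wpM2r// ler_nat.
rewrite -H; suff -> : a + N%:R * h = b by [].
by rewrite /h mulrC divfK ?pnatr_eq0 -?lt0n// addrC subrK.
Qed.

(** On cells of length [h] the derivative enters with the small factor
    [h ^+ 2]; this smallness is the source of compactness in [rellich]. *)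
Lemma Int_friedrichs_cells a b f g h (N : nat) : a < b -> (0 < N)%N ->
  h = (b - a) / N%:R -> continuous g ->
  (forall t : R, is_derive t (1 : R) f (g t)) ->
  Int a b (fun t => f t ^+ 2) <=
    \sum_(k < N) h^-1 * Int (a + k%:R * h) (a + k.+1%:R * h) f ^+ 2 +
    h ^+ 2 * Int a b (fun t => g t ^+ 2).
Proof.
move=> ab N0 hE cg df.
have h0 : 0 < h by rewrite hE divr_gt0 ?subr_gt0// ltr0n.
have cf := is_derive_cont df.
rewrite (Int_cells (ltW ab) (contX2 cf) N0) (Int_cells (ltW ab) (contX2 cg) N0) -hE.
rewrite mulr_sumr -big_split/=; apply: ler_sum => k _.
have E : a + k.+1%:R * h - (a + k%:R * h) = h by rewrite -natr1; ring.
have := @Int_friedrichs (a + k%:R * h) (a + k.+1%:R * h) f g _ cg df.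
rewrite E [_ / h]mulrC; apply.
by rewrite -subr_gt0 E.
Qed.

End Int.

Section IntParam.
Context {R : realType} {T : topologicalType}.

(** Tube lemma: by compactness of the segment, one neighbourhood of [x] serves
    all values of [s]. *)
Lemma near_segment (F : T * R -> R) (x : T) (a b e : R) : continuous F -> 0 < e ->
  \forall y \near x, forall s, a <= s <= b -> `|F (x, s) - F (y, s)| < e.
Proof.
move=> cF e0.
have : \forall y \near x, `[a, b]%classic `<=` (fun s => `|F (x, s) - F (y, s)| < e).
  have /compact_near_coveringP := @segment_compact R a b; apply=> s _.
  have e20 : 0 < e / 2 by rewrite divr_gt0.
  have /cvgrPdist_lt/(_ _ e20)[[A B] /= [A0 B0] AB] := cF (x, s).
  exists (B, A) => //= -[s' y] /= [Bs' Ay].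
  have h1 := AB (x, s') (conj (nbhs_singleton A0) Bs').
  have h2 := AB (y, s') (conj Ay Bs').
  rewrite (_ : _ - _ = (F (x, s) - F (y, s')) - (F (x, s) - F (x, s'))); last by ring.
  by apply: le_lt_trans (ler_normB _ _) _; rewrite [e]splitr ltrD.
apply: filterS => y h s hs; apply: h; by rewrite /= in_itv.
Qed.

Lemma cont_Int (F : T * R -> R) (a b : R) : continuous F ->
  continuous (fun x => Int a b (fun s => F (x, s))).
Proof.
move=> cF x; have cs y : continuous (fun s => F (y, s)).
  by apply: cont_comp cF; apply: cont_pair; [exact: cont_cst|exact: cont_id].
have [ba|ab] := ltP b a.
  rewrite (_ : (fun _ => _) = (fun=> 0)); first exact: cst_continuous.
  apply/funext => y; apply: Int_eq0 => t /andP[h1 h2].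
  by move: (lt_le_trans ba h1); rewrite ltNge h2.
apply/cvgrPdist_lt => e e0.
have c0 : 0 < b - a + 1 by rewrite ltr_wpDl// subr_ge0.
have := near_segment x a b cF (divr_gt0 e0 c0); apply: filterS => y h.
rewrite -IntB//; apply: (@le_lt_trans _ _ (e / (b - a + 1) * (b - a))).
  apply: norm_Int_le => //; first exact: contB.
  by move=> t ht; apply/ltW/h.
by rewrite mulrAC ltr_pdivrMr// ltr_pM2l//; lra.
Qed.

End IntParam.

(** If [u - v] is not 0 at 0, it keeps its sign on a short segment [0, h] and
    its integral there is not 0. *)
Lemma eq_of_Int {R : realType} (u v : R -> R) : continuous u -> continuous v ->
  (forall h, 0 <= h -> Int 0 h u = Int 0 h v) -> u 0 = v 0.
Proof.
move=> cu cv E; pose g s := u s - v s.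
have cg : continuous g := contB cu cv.
have G0 h : 0 <= h -> Int 0 h g = 0.
  by move=> h0; rewrite /g (IntB _ _ cu cv) E// subrr.
apply/eqP; rewrite -subr_eq0 -/(g 0); apply/negP => /negP g00.
pose c := `|g 0| / 2; have c0 : 0 < c by rewrite divr_gt0// normr_gt0.
have cg1 : continuous (fun p : R * R => g p.1).
  by apply: (@cont_comp _ _ _ (@fst R R) g) => // ?; exact: cvg_fst.
have [d /= d0 Hd] := near_segment 0 0 1 cg1 c0.
pose h := d / 2; have h0 : 0 < h by rewrite divr_gt0.
have B : `|Int 0 h (fun s => g 0 - g s)| <= c * (h - 0).
  apply: norm_Int_le; [by apply: contB => //; exact: cont_cst|exact: ltW|].
  move=> t /andP[t0 th]; apply/ltW; apply: (Hd t _ 0) => //; rewrite ?lexx ?ler01//.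
  rewrite /ball_/= sub0r normrN ger0_norm//; apply: le_lt_trans th _.
  by rewrite /h; lra.
move: B; rewrite (IntB _ _ (@cont_cst _ _ (g 0)) cg) (Int_cst _ (ltW h0)) (G0 h (ltW h0)) !subr0 normrM.
rewrite (gtr0_norm h0) ler_pM2r// /c; have : 0 < `|g 0| by rewrite normr_gt0.
lra.
Qed.

(** * Partial derivatives and smooth functions *)

Section Lines.
Context {R : realType}.
Implicit Types (f g : space R -> R) (x : space R) (i j : 'I_3) (s t h : R).

Definition coord i x : R := tnth [tuple x.1.1; x.1.2; x.2] i.

Lemma coordD i x t j : coord i (x + t *: unit_vec R j) = coord i x + t * (i == j)%:R.
Proof.
move: i j; do 2 (case; case=> [|[|[|//]]] ?); rewrite /coord /unit_vec !(tnth_nth 0) /=;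
  rewrite ?mulr0 ?mulr1 ?addr0 //; by rewrite /GRing.scale/= ?mulr0 ?mulr1 ?addr0.
Qed.

Lemma coord_inj x y : (forall i, coord i x = coord i y) -> x = y.
Proof.
move: x y => [[a b] c] [[a' b'] c'] H.
have := H ord0; have := H (Ordinal (isT : 1 < 3)%N); have := H (Ordinal (isT : 2 < 3)%N).
by rewrite /coord !(tnth_nth 0)/= => -> -> ->.
Qed.

Lemma cont_coord i : continuous (coord i).
Proof.
have c1 : continuous (fun x : space R => x.1.1).
  by apply: (cont_comp (u := fst) (v := fst)) => ?; exact: cvg_fst.
have c2 : continuous (fun x : space R => x.1.2).
  by apply: (cont_comp (u := fst) (v := snd)) => ?; [exact: cvg_fst|exact: cvg_snd].
have c3 : continuous (fun x : space R => x.2) by move=> ?; exact: cvg_snd.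
by case: i; case=> [|[|[|//]]] ?.
Qed.

Lemma cont_lineP (T : topologicalType) (u : T -> space R) (v : T -> R) (e : space R) :
  continuous u -> continuous v -> continuous (fun p => u p + v p *: e).
Proof.
move=> cu cv p; apply: (@cvgD _ _ _ (nbhs p)); first exact: cu.
by apply: (@cvgZ _ _ _ (nbhs p)); [exact: cv|exact: cvg_cst].
Qed.

Lemma is_derive_line i f x s : derivable f (x + s *: unit_vec R i) (unit_vec R i) ->
  is_derive s (1 : R) (fun t => f (x + t *: unit_vec R i))
    (pderiv i f (x + s *: unit_vec R i)).
Proof.
move=> df; rewrite /pderiv.
have E : (fun h : R => h^-1 *: (f (x + (h *: (1 : R) + s) *: unit_vec R i) -
      f (x + s *: unit_vec R i))) =
    (fun h : R => h^-1 *: ((f \o shift (x + s *: unit_vec R i)) (h *: unit_vec R i) -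
      f (x + s *: unit_vec R i))).
  apply/funext => h /=; congr (_ *: (f _ - _)).
  by rewrite /GRing.scale/= mulr1 -/(GRing.scale _ _) scalerDl addrCA addrC.
split; first by rewrite /derivable/= E.
by rewrite /derive/= E.
Qed.

Lemma is_derive_of_line i f x d :
  is_derive (0 : R) (1 : R) (fun t => f (x + t *: unit_vec R i)) d ->
  derivable f x (unit_vec R i) /\ pderiv i f x = d.
Proof.
move=> [df dd].
have E : (fun h : R => h^-1 *: (f (x + (h *: (1 : R) + 0) *: unit_vec R i) -
      f (x + 0 *: unit_vec R i))) =
    (fun h : R => h^-1 *: ((f \o shift x) (h *: unit_vec R i) - f x)).
  apply/funext => h /=; rewrite scale0r !addr0; congr (_ *: (f _ - _)).
  by rewrite /GRing.scale/= mulr1 -/(GRing.scale _ _) addrC.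
split; first by move: df; rewrite /derivable/= E.
by move: dd; rewrite /derive/= E.
Qed.

Lemma smooth_cont f : smooth f -> continuous f.
Proof. by move=> /(_ [::])[]. Qed.

Lemma smooth_derivable f i x : smooth f -> derivable f x (unit_vec R i).
Proof. by move=> /(_ [::])[_]; exact. Qed.

Lemma smooth_pderiv f i : smooth f -> smooth (pderiv i f).
Proof.
move=> sf s; have := sf (rcons s i).
by rewrite /pderivs foldr_rcons.
Qed.

Lemma smooth_line f i x s : smooth f ->
  is_derive s (1 : R) (fun t => f (x + t *: unit_vec R i))
    (pderiv i f (x + s *: unit_vec R i)).
Proof. by move=> sf; exact/is_derive_line/smooth_derivable. Qed.

(** Smoothness without formulas for the higher derivatives: a class of
    continuous functions that is closed under partial differentiation consists of
    smooth functions. *)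
Lemma smooth_coind (C : set (space R -> R)) :
  (forall f, C f -> continuous f /\
     forall i, (forall x, derivable f x (unit_vec R i)) /\ C (pderiv i f)) ->
  C `<=` @smooth R.
Proof.
move=> H f Cf s; have Cs : C (pderivs s f).
  by elim: s => //= i s IH; have [_ /(_ i)[]] := H _ IH.
by have [cs ds] := H _ Cs; split=> // i; have [] := ds i.
Qed.

Lemma pderivD f g i : smooth f -> smooth g ->
  pderiv i (fun x => f x + g x) = (fun x => pderiv i f x + pderiv i g x).
Proof. by move=> sf sg; apply/funext => x; exact: (deriveD (smooth_derivable sf) (smooth_derivable sg)). Qed.

Lemma pderivM f g i : smooth f -> smooth g ->
  pderiv i (fun x => f x * g x) = (fun x => f x * pderiv i g x + g x * pderiv i f x).
Proof. by move=> sf sg; apply/funext => x; exact: (deriveM (smooth_derivable sf) (smooth_derivable sg)). Qed.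

Lemma pderiv_cst i (k : R) : pderiv i (fun=> k) = fun=> 0.
Proof. by apply/funext => x; exact: derive_cst. Qed.

Lemma smooth_cst (k : R) : smooth (fun _ : space R => k).
Proof.
apply: (smooth_coind (C := [set f | exists k, f = fun=> k])); last by exists k.
move=> _ [c ->]; split; first exact: cont_cst.
move=> i; split; first by move=> x; exact: derivable_cst.
by rewrite pderiv_cst; exists 0.
Qed.

(** The derivative of a product is a sum of products, so that only sums and
    products taken together are closed under differentiation. *)
Inductive smooth_alg : (space R -> R) -> Prop :=
| alg_smooth f : smooth f -> smooth_alg f
| alg_add f g : smooth_alg f -> smooth_alg g -> smooth_alg (fun x => f x + g x)
| alg_mul f g : smooth_alg f -> smooth_alg g -> smooth_alg (fun x => f x * g x).

Lemma smooth_algP : smooth_alg `<=` @smooth R.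
Proof.
apply: smooth_coind => f; elim=> {f}[f sf|f g af [cf df] ag [cg dg]|f g af [cf df] ag [cg dg]].
- split; first exact: smooth_cont.
  by move=> i; split=> [x|]; [exact: smooth_derivable|exact/alg_smooth/smooth_pderiv].
- split; first exact: contD.
  move=> i; have [dfi ai] := df i; have [dgi bi] := dg i.
  split=> [x|]; first exact: derivableD.
  rewrite (_ : pderiv _ _ = fun x => pderiv i f x + pderiv i g x); first exact: alg_add.
  by apply/funext => x; exact: deriveD.
- split; first exact: contM.
  move=> i; have [dfi ai] := df i; have [dgi bi] := dg i.
  split=> [x|]; first exact: derivableM.
  rewrite (_ : pderiv _ _ = fun x => f x * pderiv i g x + g x * pderiv i f x).
    by apply: alg_add; exact: alg_mul.
  by apply/funext => x; exact: deriveM.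
Qed.

Lemma smoothD f g : smooth f -> smooth g -> smooth (fun x => f x + g x).
Proof. by move=> sf sg; apply/smooth_algP/alg_add; exact: alg_smooth. Qed.

Lemma smoothM f g : smooth f -> smooth g -> smooth (fun x => f x * g x).
Proof. by move=> sf sg; apply/smooth_algP/alg_mul; exact: alg_smooth. Qed.

Lemma smoothZ k f : smooth f -> smooth (fun x => k * f x).
Proof. by move=> sf; exact: (smoothM (smooth_cst k) sf). Qed.

Lemma smoothN f : smooth f -> smooth (fun x => - f x).
Proof. by move=> sf; under eq_fun do rewrite -mulN1r; exact: smoothZ. Qed.

Lemma smoothB f g : smooth f -> smooth g -> smooth (fun x => f x - g x).
Proof. by move=> sf sg; exact: (smoothD sf (smoothN sg)). Qed.

Lemma pderivZ f k i : smooth f ->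
  pderiv i (fun x => k * f x) = (fun x => k * pderiv i f x).
Proof.
move=> sf; rewrite (pderivM i (smooth_cst k) sf).
by rewrite pderiv_cst; apply/funext => x; rewrite mulr0 addr0.
Qed.

Lemma pderivB f g i : smooth f -> smooth g ->
  pderiv i (fun x => f x - g x) = (fun x => pderiv i f x - pderiv i g x).
Proof. by move=> sf sg; apply/funext => x; exact: (deriveB (smooth_derivable sf) (smooth_derivable sg)). Qed.

Lemma pderivN f i : smooth f -> pderiv i (fun x => - f x) = (fun x => - pderiv i f x).
Proof. by move=> sf; apply/funext => x; exact: (deriveN (smooth_derivable sf)). Qed.

Lemma near_pderiv f g i x : (\forall y \near x, f y = g y) -> pderiv i f x = pderiv i g x.
Proof.
move=> fg; apply: near_eq_derive => //.
Qed.

Lemma is_derive_coord (g g' : R -> R) i j x : (forall t, is_derive t (1 : R) g (g' t)) ->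
  is_derive (0 : R) (1 : R) (fun t => g (coord j (x + t *: unit_vec R i)))
    (g' (coord j x) * (j == i)%:R).
Proof.
move=> dg; under eq_fun do rewrite coordD.
set d : R := (j == i)%:R; set c := coord j x.
have Ha : is_derive (0 : R) (1 : R) (fun t : R => c + t * d) d.
  have := @is_deriveD _ _ _ (cst c) (id * cst d) (0 : R) (1 : R) 0 d _ _.
  rewrite add0r; apply.
  have := @is_deriveM _ _ id (cst d) (0 : R) (1 : R) 1 0 _ _.
  by rewrite scaler0 add0r /GRing.scale/= mulr1; exact.
have := @is_derive1_comp _ g (fun t => c + t * d) 0 (g' c) d.
by rewrite (_ : c + 0 * d = c) ?mul0r ?addr0//; apply.
Qed.

Lemma pderiv_coord (g g' : R -> R) i j : (forall t, is_derive t (1 : R) g (g' t)) ->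
  pderiv i (fun x => g (coord j x)) = fun x => g' (coord j x) * (j == i)%:R.
Proof.
move=> dg; apply/funext => x.
by have [_ ->] := @is_derive_of_line i (fun x => g (coord j x)) x _ (is_derive_coord i j x dg).
Qed.

(** The sequence [phi] lists the successive derivatives.  The class used for
    [smooth_coind] contains the multiples [k * phi m], since differentiating in
    the direction [i] multiplies by [j == i]. *)
Lemma smooth_coord (phi : nat -> R -> R) n j :
  (forall m t, is_derive t (1 : R) (phi m) (phi m.+1 t)) ->
  smooth (fun x => phi n (coord j x)).
Proof.
move=> dphi.
pose C : set (space R -> R) := [set f | exists k m, f = fun x => k * phi m (coord j x)].
have dk k m t : is_derive t (1 : R) (fun t => k * phi m t) (k * phi m.+1 t).
  have := @is_deriveM _ _ (cst k) (phi m) t (1 : R) _ _ _ (dphi m t).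
  by move=> H; apply: is_derive_eq (H _ _) _; rewrite scaler0 addr0.
have D k m i x := is_derive_coord i j x (dk k m).
suff sC : C `<=` @smooth R by apply: sC; exists 1, n; apply/funext => x; rewrite mul1r.
apply: smooth_coind => _ [k [m ->]]; split.
  apply: contZ; apply: cont_comp; first exact: cont_coord.
  exact: is_derive_cont (dphi m).
move=> i; split=> [x|]; first by have [] := @is_derive_of_line i (fun x => k * phi m (coord j x)) x _ (D k m i x).
exists (k * (j == i)%:R), m.+1; apply/funext => x; rewrite mulrAC.
by have [_ ->] := @is_derive_of_line i (fun x => k * phi m (coord j x)) x _ (D k m i x).
Qed.

End Lines.

(** * Differentiation under the integral sign *)

Section ParamIntegral.
Context {R : realType}.
Implicit Types (f g : space R -> R) (x : space R) (i j : 'I_3) (s t h a b : R).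

Lemma Int_pderiv_line i f x a b : a <= b -> smooth f ->
  Int a b (fun s => pderiv i f (x + s *: unit_vec R i)) =
  f (x + b *: unit_vec R i) - f (x + a *: unit_vec R i).
Proof.
move=> ab sf; apply: (Int_FTC (f := fun s => f (x + s *: unit_vec R i)) ab).
  apply: cont_comp; last exact/smooth_cont/smooth_pderiv.
  by apply: cont_lineP; [exact: cont_cst|exact: cont_id].
by move=> t; exact: smooth_line.
Qed.

Section OneDirection.
(* [L s] stands for the translation along an axis by [s] or for the replacement
   of one coordinate by [s]. *)
Variables (L : R -> space R -> space R) (j : 'I_3) (a b : R) (f : space R -> R).
Hypothesis cL : continuous (fun p : space R * R => L p.2 p.1).
Hypothesis Lj : forall s x t, L s (x + t *: unit_vec R j) = L s x + t *: unit_vec R j.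
Hypothesis sf : smooth f.

Let cLx x : continuous (fun s => L s x).
Proof.
apply: (cont_comp (u := fun s : R => (x, s)) (v := fun p : space R * R => L p.2 p.1)) => //.
by apply: cont_pair; [exact: cont_cst|exact: cont_id].
Qed.

(** [F t s] is the integrand at the point [x + t e_j].  Near [t = 0] its
    derivative in [t] stays within distance 1 of its value at [t = 0], uniformly in
    [s]; this provides the dominating function [G]. *)
Lemma is_derive_Int x : is_derive (0 : R) (1 : R)
  (fun t => Int a b (fun s => f (L s (x + t *: unit_vec R j))))
  (Int a b (fun s => pderiv j f (L s x))).
Proof.
pose F t s := f (L s x + t *: unit_vec R j).
have -> : (fun t => Int a b (fun s => f (L s (x + t *: unit_vec R j)))) =
    (fun t => Int a b (F t)).
  by apply/funext => t; apply: eq_Int => s _; rewrite Lj.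
have dF t s : is_derive t (1 : R) (F ^~ s) (pderiv j f (L s x + t *: unit_vec R j)).
  exact: smooth_line.
have cF t : continuous (F t).
  apply: cont_comp; last exact: smooth_cont.
  by apply: cont_lineP => //; exact: cont_cst.
have cdf := smooth_cont (smooth_pderiv j sf).
have [e e0 He] : exists2 e : R, 0 < e & forall t, `|t| < e -> forall s, a <= s <= b ->
    `|pderiv j f (L s x) - pderiv j f (L s x + t *: unit_vec R j)| < 1.
  have := @near_segment R _ (fun p : R * R => pderiv j f (L p.2 x + p.1 *: unit_vec R j))
     0 a b 1 _ ltr01.
  case.
    apply: (cont_comp (u := fun p : R * R => L p.2 x + p.1 *: unit_vec R j)) cdf.
    apply: cont_lineP; last by move=> ?; exact: cvg_fst.
    apply: (@cont_comp _ _ _ (@snd R R) (fun s => L s x)); last exact: cLx.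
    by move=> ?; exact: cvg_snd.
  move=> e /= e0 He; exists e => // t te s hs.
  have := He t _ s hs; rewrite /= scale0r addr0; apply.
  by rewrite /ball_/= sub0r normrN.
pose G s := `|pderiv j f (L s x)| + 1.
have cG : continuous G.
  by apply: contD; [apply/cont_norm/cont_comp; [exact: cLx|]|exact: cont_cst].
have d1 t s : partial1of2 F t s = pderiv j f (L s x + t *: unit_vec R j).
  by rewrite partial1of2E; apply: derive_val.
have I0 : `](- e), e[%classic (0 : R) by rewrite /= in_itv/= oppr_lt0 e0.
have iF t : `](- e), e[%classic t -> lebesgue_measure.-integrable `[a, b] (EFin \o F t).
  by move=> _; exact: Int_integrable.
have dF' t s : `](- e), e[%classic t -> `[a, b]%classic s -> derivable (F ^~ s) t 1.
  by move=> _ _; case: (dF t s).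
have G0 s : 0 <= G s by rewrite addr_ge0.
have Gub t s : `](- e), e[%classic t -> `[a, b]%classic s -> `|partial1of2 F t s| <= G s.
  rewrite /= !in_itv/= -ltr_norml => te hs; rewrite d1 /G.
  have := He t te s hs; set u := pderiv j f (L s x); set v := pderiv j f _ => uv.
  rewrite -[v in X in X <= _](subKr u); apply: le_trans (ler_normB _ _) _.
  by rewrite lerD2l ltW.
have iG := Int_integrable a b cG.
have mab := @measurable_itv R `[a, b].
have D := @derivable_under_integral R _ (measurableTypeR R) lebesgue_measure F _ mab 0 (- e) e I0 iF dF' G G0 iG Gub.
have E := @differentiation_under_integral R _ (measurableTypeR R) lebesgue_measure F _ mab 0 (- e) e I0 iF dF' G G0 iG Gub.
split; first exact: D.
rewrite -derive1E E; apply: eq_Int => s _.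
by rewrite d1 scale0r addr0.
Qed.

End OneDirection.

Section AllDirections.
(* In the directions of [J] the map [L s] commutes with translations; in the
   other directions it forgets them, and the integral is constant. *)
Variables (L : R -> space R -> space R) (a b : R) (J : {pred 'I_3}).
Hypothesis cL : continuous (fun p : space R * R => L p.2 p.1).

Lemma cont_param_Int f : continuous f -> continuous (fun x => Int a b (fun s => f (L s x))).
Proof.
move=> cf; apply: (cont_Int (F := fun p => f (L p.2 p.1))).
exact: cont_comp cL cf.
Qed.

Hypothesis Lj : forall j, j \in J -> forall s x t,
  L s (x + t *: unit_vec R j) = L s x + t *: unit_vec R j.
Hypothesis Lk : forall j, j \notin J -> forall s x t, L s (x + t *: unit_vec R j) = L s x.

Lemma pderiv_Int_in j f : j \in J -> smooth f ->
  pderiv j (fun x => Int a b (fun s => f (L s x))) =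
  fun x => Int a b (fun s => pderiv j f (L s x)).
Proof.
move=> jJ sf; apply/funext => x.
by have [_ ->] := @is_derive_of_line _ j (fun x => Int a b (fun s => f (L s x))) x _
  (is_derive_Int a b cL (Lj jJ) sf x).
Qed.

Lemma smooth_Int f : smooth f -> smooth (fun x => Int a b (fun s => f (L s x))).
Proof.
move=> sf; pose C : set (space R -> R) :=
  [set F | exists2 g, smooth g & F = fun x => Int a b (fun s => g (L s x))].
apply: (smooth_coind (C := C)); last by exists f.
move=> _ [g sg ->]; split; first exact/cont_param_Int/smooth_cont.
move=> j; have [jJ|jJ] := boolP (j \in J).
  split=> [x|]; last by exists (pderiv j g); [exact: smooth_pderiv|exact: pderiv_Int_in].
  by have [] := @is_derive_of_line _ j (fun x => Int a b (fun s => g (L s x))) x _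
    (is_derive_Int a b cL (Lj jJ) sg x).
have D x : is_derive (0 : R) (1 : R)
    (fun t => Int a b (fun s => g (L s (x + t *: unit_vec R j)))) 0.
  rewrite (_ : (fun t => _) = cst (Int a b (fun s => g (L s x)))).
    exact: is_derive_cst.
  by apply/funext => t; apply: eq_Int => s _; rewrite Lk.
split=> [x|].
  by have [] := @is_derive_of_line _ j (fun x => Int a b (fun s => g (L s x))) x _ (D x).
exists (fun=> 0); first exact: smooth_cst.
apply/funext => x.
have [_ ->] := @is_derive_of_line _ j (fun x => Int a b (fun s => g (L s x))) x _ (D x).
by rewrite Int_eq0.
Qed.

End AllDirections.

(** The segment starts at the point itself, so that this integral commutes with
    all partial derivatives. *)
Definition axis_Int i a b f : space R -> R := fun x => Int a b (fun s => f (x + s *: unit_vec R i)).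

Let cont_shift i : continuous (fun p : space R * R => p.1 + p.2 *: unit_vec R i).
Proof. by apply: cont_lineP => p; [exact: cvg_fst|exact: cvg_snd]. Qed.

Let shift_in i j : j \in @predT 'I_3 -> forall s x t,
  x + t *: unit_vec R j + s *: unit_vec R i = x + s *: unit_vec R i + t *: unit_vec R j.
Proof. by move=> _ s x t; rewrite addrAC. Qed.

Let shift_out i j : j \notin @predT 'I_3 -> forall s x t,
  x + t *: unit_vec R j + s *: unit_vec R i = x + s *: unit_vec R i.
Proof. by []. Qed.

Lemma smooth_axis_Int i a b f : smooth f -> smooth (axis_Int i a b f).
Proof.
exact: (@smooth_Int (fun s x => x + s *: unit_vec R i) a b predT (@cont_shift i)
  (@shift_in i) (@shift_out i) f).
Qed.

Lemma pderiv_axis_Int i j a b f : smooth f ->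
  pderiv j (axis_Int i a b f) = axis_Int i a b (pderiv j f).
Proof.
exact: (@pderiv_Int_in (fun s x => x + s *: unit_vec R i) a b predT (@cont_shift i)
  (@shift_in i) j f).
Qed.

Lemma axis_Int_pderiv i a b f x : a <= b -> smooth f ->
  axis_Int i a b (pderiv i f) x = f (x + b *: unit_vec R i) - f (x + a *: unit_vec R i).
Proof. exact: Int_pderiv_line. Qed.

(** Schwarz' theorem.  On a segment parallel to the axis [j], the integral of
    either mixed derivative is the increment of [pderiv i f] between the two
    endpoints: for [pderiv j (pderiv i f)] by the fundamental theorem, for the
    other one after [pderiv i] has been taken out of the integral.  Continuous
    functions with the same integrals over all such segments coincide. *)
Lemma pderivC i j f : smooth f -> pderiv i (pderiv j f) = pderiv j (pderiv i f).
Proof.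
move=> sf; have sfi := smooth_pderiv i sf; have sfj := smooth_pderiv j sf.
have sij := smooth_pderiv i sfj; have sji := smooth_pderiv j sfi.
have E x h : 0 <= h -> Int 0 h (fun s => pderiv i (pderiv j f) (x + s *: unit_vec R j)) =
    Int 0 h (fun s => pderiv j (pderiv i f) (x + s *: unit_vec R j)).
  move=> h0; change (axis_Int j 0 h (pderiv i (pderiv j f)) x = axis_Int j 0 h (pderiv j (pderiv i f)) x).
  apply: (etrans (congr1 (fun u => u x) (esym (pderiv_axis_Int j i 0 h sfj)))).
  apply: (etrans _ (esym (axis_Int_pderiv j x h0 sfi))).
  have -> : axis_Int j 0 h (pderiv j f) =
      (fun x => f (x + h *: unit_vec R j) - f (x + 0 *: unit_vec R j)).
    by apply/funext => y; exact: (axis_Int_pderiv j y h0 sf).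
  have L1 k y : is_derive (0 : R) (1 : R)
      (fun t => f (y + t *: unit_vec R i + k *: unit_vec R j))
      (pderiv i f (y + k *: unit_vec R j)).
    have := smooth_line i (y + k *: unit_vec R j) 0 sf.
    rewrite scale0r addr0; under eq_fun do rewrite addrAC.
    exact.
  exact: (@is_derive_of_line _ i (fun x => f (x + h *: unit_vec R j) -
    f (x + 0 *: unit_vec R j)) x _ (is_deriveB (L1 h x) (L1 0 x))).2.
apply/funext => x.
have cl : continuous (fun s : R => x + s *: unit_vec R j).
  by apply: cont_lineP; [exact: cont_cst|exact: cont_id].
have c1 := cont_comp cl (smooth_cont sij); have c2 := cont_comp cl (smooth_cont sji).
by have := eq_of_Int c1 c2 (E x); rewrite scale0r addr0.
Qed.

End ParamIntegral.

(** * Partial integrals on the cube *)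

Section PartialIntegrals.
Context {R : realType}.
Implicit Types (f g : space R -> R) (x : space R) (i j : 'I_3) (s : seq 'I_3) (t a b : R).

Lemma Int_sum (I : eqType) (r : seq I) (F : I -> R -> R) a b :
  (forall c, continuous (F c)) ->
  Int a b (fun t => \sum_(c <- r) F c t) = \sum_(c <- r) Int a b (F c).
Proof.
move=> cF; elim: r => [|c r IH].
  by rewrite big_nil; apply: Int_eq0 => t _; rewrite big_nil.
rewrite big_cons -IH -IntD//; last exact: cont_sum.
by apply: eq_Int => t _; rewrite big_cons.
Qed.

Definition set_coord i t x : space R := x + (t - coord i x) *: unit_vec R i.

Lemma coord_set i j t x : coord j (set_coord i t x) = if j == i then t else coord j x.
Proof.
by rewrite /set_coord coordD; case: eqP => [->|_]; rewrite ?mulr1 ?mulr0 ?addr0// addrC subrK.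
Qed.

Lemma set_coordE i t x : set_coord i t x = (x - coord i x *: unit_vec R i) + t *: unit_vec R i.
Proof. by rewrite /set_coord scalerBl addrCA addrC. Qed.

Lemma cont_set_coord2 i : continuous (fun p : space R * R => set_coord i p.2 p.1).
Proof.
apply: cont_lineP; first by move=> ?; exact: cvg_fst.
apply: contB; first by move=> ?; exact: cvg_snd.
by apply: (@cont_comp _ _ _ (@fst (space R) R) (coord i)); [move=> ?; exact: cvg_fst|exact: cont_coord].
Qed.

Lemma cont_set_coord i x : continuous (fun t => set_coord i t x).
Proof.
apply: (@cont_comp _ _ _ (fun t : R => (x, t)) (fun p : space R * R => set_coord i p.2 p.1)).
  by apply: cont_pair; [exact: cont_cst|exact: cont_id].
exact: cont_set_coord2.
Qed.

Lemma cont_along i x f : continuous f -> continuous (fun t => f (set_coord i t x)).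
Proof.
by move=> cf; apply: (@cont_comp _ _ _ (fun t => set_coord i t x) f) => //; exact: cont_set_coord.
Qed.

(** The result is again a function on the whole space, constant in the
    coordinate [i]: partial integrals can be iterated in any order. *)
Definition coord_Int i a b f : space R -> R := fun x => Int a b (fun t => f (set_coord i t x)).

Lemma cont_coord_Int i a b f : continuous f -> continuous (coord_Int i a b f).
Proof. by move=> cf; exact: (@cont_param_Int _ (set_coord i) a b (@cont_set_coord2 i) f cf). Qed.

Let set_coord_other i j : j \in predC1 i -> forall (s : R) x t,
  set_coord i s (x + t *: unit_vec R j) = set_coord i s x + t *: unit_vec R j.
Proof.
rewrite inE => ji s x t; rewrite /set_coord coordD eq_sym (negbTE ji) mulr0 addr0.
by rewrite addrAC.
Qed.

Let set_coord_same i j : j \notin predC1 i -> forall (s : R) x t, set_coord i s (x + t *: unit_vec R j) = set_coord i s x.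
Proof.
rewrite inE negbK => /eqP -> s x t; rewrite /set_coord coordD eqxx mulr1 -addrA -scalerDl.
by congr (_ + _ *: _); ring.
Qed.

Lemma smooth_coord_Int i a b f : smooth f -> smooth (coord_Int i a b f).
Proof. exact: (@smooth_Int _ (set_coord i) a b _ (@cont_set_coord2 i) (@set_coord_other i) (@set_coord_same i) f). Qed.

Lemma pderiv_coord_Int i j a b f : j != i -> smooth f -> pderiv j (coord_Int i a b f) = coord_Int i a b (pderiv j f).
Proof. by move=> ji; exact: (@pderiv_Int_in _ (set_coord i) a b _ (@cont_set_coord2 i) (@set_coord_other i) j f). Qed.

Lemma is_derive_set_coord i f x t : smooth f ->
  is_derive t (1 : R) (fun t => f (set_coord i t x)) (pderiv i f (set_coord i t x)).
Proof.
move=> sf; have := smooth_line i (x - coord i x *: unit_vec R i) t sf.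
by rewrite -set_coordE; under eq_fun do rewrite -set_coordE; exact.
Qed.

Lemma coord_Int_pderiv i a b f x : a <= b -> smooth f ->
  coord_Int i a b (pderiv i f) x = f (set_coord i b x) - f (set_coord i a x).
Proof.
move=> ab sf; apply: (Int_FTC (f := fun t => f (set_coord i t x)) ab).
  exact/cont_along/smooth_cont/smooth_pderiv.
by move=> t; exact: is_derive_set_coord.
Qed.

Lemma coord_IntD i a b f g : continuous f -> continuous g ->
  coord_Int i a b (fun x => f x + g x) = fun x => coord_Int i a b f x + coord_Int i a b g x.
Proof. by move=> cf cg; apply/funext => x; apply: IntD; exact: cont_along. Qed.

Lemma coord_IntZ i a b k f : continuous f ->
  coord_Int i a b (fun x => k * f x) = fun x => k * coord_Int i a b f x.
Proof. by move=> cf; apply/funext => x; apply: IntZ; exact: cont_along. Qed.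

Lemma coord_Int_sum (I : eqType) (r : seq I) (F : I -> space R -> R) i a b :
  (forall c, continuous (F c)) ->
  coord_Int i a b (fun x => \sum_(c <- r) F c x) = fun x => \sum_(c <- r) coord_Int i a b (F c) x.
Proof. by move=> cF; apply/funext => x; apply: Int_sum => c; exact: cont_along. Qed.

Lemma le_coord_Int i a b f g x : continuous f -> continuous g -> (forall x, f x <= g x) ->
  coord_Int i a b f x <= coord_Int i a b g x.
Proof. by move=> cf cg fg; apply: le_Int => //; exact: cont_along. Qed.

Lemma coord_Int_ge0 i a b f x : (forall x, 0 <= f x) -> 0 <= coord_Int i a b f x.
Proof. by move=> f0; exact: Int_ge0. Qed.

Lemma coord_Int_CS i a b f x : a <= b -> continuous f ->
  coord_Int i a b f x ^+ 2 <= (b - a) * coord_Int i a b (fun y => f y ^+ 2) x.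
Proof. by move=> ab cf; apply: Int_CS => //; exact: cont_along. Qed.

(** * Friedrichs' inequality on small cells *)

Section Cells.
Variable N : nat.
Hypothesis N0 : (0 < N)%N.
Definition mesh : R := 2 / N%:R.
Definition node (k : nat) : R := -1 + k%:R * mesh.
Local Notation h := mesh.
Local Notation lo := node.

Lemma mesh_gt0 : 0 < h. Proof. by rewrite divr_gt0// ltr0n. Qed.
Let h0 : 0 < h := mesh_gt0.

Let lo_le k : lo k <= lo k.+1.
Proof. by rewrite lerD2l ler_wpM2r ?ler_nat// ltW// mesh_gt0. Qed.

Let loB k : lo k.+1 - lo k = h.
Proof. by rewrite /node -natr1; ring. Qed.

Let hE : h = (1 - (-1)) / N%:R.
Proof. by rewrite /mesh; congr (_ / _); ring. Qed.

Let m11 : (-1 : R) < 1. Proof. by lra. Qed.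

Definition iter_Int (s : seq 'I_3) f := foldr (fun i g => coord_Int i (-1) 1 g) f s.

(** A cell is a list of pairs of an axis [i] and an index [k], meaning that the
    coordinate [i] runs from [node k] to [node k.+1]. *)
Definition cell_Int (c : seq ('I_3 * nat)) f :=
  foldr (fun p g => coord_Int p.1 (lo p.2) (lo p.2.+1) g) f c.

Fixpoint cells (s : seq 'I_3) : seq (seq ('I_3 * nat)) :=
  if s is i :: s' then [seq (i, k) :: c | k <- iota 0 N, c <- cells s'] else [:: [::]].

Lemma cont_iter_Int s f : continuous f -> continuous (iter_Int s f).
Proof. by move=> cf; elim: s => //= i s IH; exact: cont_coord_Int. Qed.

Lemma cont_cell c f : continuous f -> continuous (cell_Int c f).
Proof. by move=> cf; elim: c => //= p c IH; exact: cont_coord_Int. Qed.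

Lemma smooth_cell c f : smooth f -> smooth (cell_Int c f).
Proof. by move=> sf; elim: c => [|p c IH] /=; [exact: sf|exact: smooth_coord_Int]. Qed.

Lemma pderiv_cell j c f : all (fun p => j != p.1) c -> smooth f ->
  pderiv j (cell_Int c f) = cell_Int c (pderiv j f).
Proof.
move=> + sf; elim: c => //= p c IH /andP[jp jc].
by rewrite (pderiv_coord_Int _ _ jp (smooth_cell c sf)) IH.
Qed.

Lemma cell_CS c f x : continuous f ->
  cell_Int c f x ^+ 2 <= h ^+ size c * cell_Int c (fun y => f y ^+ 2) x.
Proof.
move=> cf; elim: c x => [|p c IH] x /=; first by rewrite expr0 mul1r.
have cc := @cont_cell c _ cf; have cc2 := @cont_cell c _ (contX2 cf).
apply: le_trans (coord_Int_CS _ _ (lo_le _) cc) _; rewrite loB exprS -mulrA ler_pM2l//.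
have := @coord_IntZ p.1 (lo p.2) (lo p.2.+1) (h ^+ size c) _ cc2.
move=> /(congr1 (fun u => u x)) /= <-.
by apply: le_coord_Int => //; [exact: contX2|exact: contZ].
Qed.

Lemma cells_sum s f x : continuous f -> \sum_(c <- cells s) cell_Int c f x = iter_Int s f x.
Proof.
move=> cf; elim: s x => [|i s IH] x /=; first by rewrite big_seq1.
rewrite big_allpairs_dep/=.
have -> : iter_Int s f = fun y => \sum_(c <- cells s) cell_Int c f y.
  by apply/funext => y; rewrite IH.
rewrite coord_Int_sum; last by move=> c; exact: cont_cell.
rewrite exchange_big/=; apply: eq_bigr => c _.
rewrite [RHS](Int_cells (ltW m11) (@cont_along i x _ (@cont_cell c _ cf)) N0) -hE.
by rewrite -[in LHS](subn0 N) big_mkord.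
Qed.

Lemma size_cells s c : c \in cells s -> size c = size s.
Proof.
elim: s c => [|i s IH] c /=; first by rewrite inE => /eqP ->.
by move=> /allpairsPdep[k [c' [_ /IH <- ->]]].
Qed.

Lemma all_cells (j : 'I_3) s c : j \notin s -> c \in cells s -> all (fun p => j != p.1) c.
Proof.
elim: s c => [|i s IH] c /=; first by rewrite inE => _ /eqP ->.
rewrite inE negb_or => /andP[ji js] /allpairsPdep[k [c' [_ /(IH _ js) H ->]]] /=.
by rewrite ji H.
Qed.

(** Friedrichs' inequality on every cell at once, by induction on the list of
    axes.  For a new axis [i], the one-dimensional inequality is applied to the
    integrals of [f] over the cells in the other directions; the derivative of such
    an integral is the integral of [pderiv i f], and Cauchy-Schwarz on the cell
    replaces its square by [h ^+ size s] times the integral of the square, which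
    cancels the weight [h^-1 ^+ size s]. *)
Lemma cells_friedrichs s f x : uniq s -> smooth f ->
  iter_Int s (fun y => f y ^+ 2) x <=
    \sum_(c <- cells s) h^-1 ^+ size s * cell_Int c f x ^+ 2 +
    h ^+ 2 * \sum_(j <- s) iter_Int s (fun y => pderiv j f y ^+ 2) x.
Proof.
move=> + sf; elim: s x => [|i s IH] x /=.
  by rewrite big_seq1 big_nil expr0 mul1r mulr0 addr0.
move=> /andP[iS us].
have cf := smooth_cont sf; have cfj j := smooth_cont (smooth_pderiv j sf).
pose A y := \sum_(c <- cells s) h^-1 ^+ size s * cell_Int c f y ^+ 2.
pose B y := h ^+ 2 * \sum_(j <- s) iter_Int s (fun y => pderiv j f y ^+ 2) y.
have cA c : continuous (fun y => h^-1 ^+ size s * cell_Int c f y ^+ 2).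
  by apply/contZ/contX2/cont_cell.
have cB j : continuous (iter_Int s (fun y => pderiv j f y ^+ 2)).
  by apply/cont_iter_Int/contX2.
apply: (@le_trans _ _ (coord_Int i (-1) 1 (fun y => A y + B y) x)).
  apply: le_coord_Int; first exact/cont_iter_Int/contX2.
    by apply: contD; [exact: cont_sum|exact/contZ/cont_sum].
  by move=> y; exact: IH.
rewrite coord_IntD; [|exact: cont_sum|exact/contZ/cont_sum].
rewrite coord_IntZ; last exact: cont_sum.
rewrite coord_Int_sum// coord_Int_sum// big_cons mulrDr addrA lerD2r.
apply: (@le_trans _ _ (\sum_(c <- cells s) (h^-1 ^+ size s *
   (\sum_(k < N) h^-1 * coord_Int i (lo k) (lo k.+1) (cell_Int c f) x ^+ 2 +
    h ^+ 2 * (h ^+ size s * coord_Int i (-1) 1 (cell_Int c (fun y => pderiv i f y ^+ 2)) x))))).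
  rewrite big_seq_cond [leRHS]big_seq_cond; apply: ler_sum => c; rewrite andbT => cs.
  rewrite coord_IntZ; last exact/contX2/cont_cell.
  apply: ler_wpM2l; first by rewrite exprn_ge0// invr_ge0 ltW.
  have scf := smooth_cell c sf.
  have H : coord_Int i (-1) 1 (fun y => cell_Int c f y ^+ 2) x <=
      \sum_(k < N) h^-1 * coord_Int i (lo k) (lo k.+1) (cell_Int c f) x ^+ 2 +
      h ^+ 2 * coord_Int i (-1) 1 (fun y => pderiv i (cell_Int c f) y ^+ 2) x :=
    Int_friedrichs_cells m11 N0 hE
    (@cont_along i x _ (smooth_cont (smooth_pderiv i scf)))
    (fun t => is_derive_set_coord i x t scf).
  apply: (le_trans H); rewrite lerD2l ler_pM2l ?exprn_gt0//.
  have cc2 := @cont_cell c _ (contX2 (cfj i)).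
  have := @coord_IntZ i (-1) 1 (h ^+ size s) _ cc2.
  move=> /(congr1 (fun u => u x)) /= <-.
  apply: le_coord_Int; [exact/contX2/smooth_cont/smooth_pderiv|exact: contZ|].
  move=> y; rewrite (pderiv_cell (all_cells iS cs) sf) -(size_cells cs).
  exact: cell_CS.
rewrite le_eqVlt; apply/orP; left; apply/eqP.
under [LHS]eq_bigr => c _ do rewrite mulrDr.
rewrite big_split/=; congr (_ + _).
  rewrite big_allpairs_dep/= exchange_big/=; apply: eq_bigr => c _.
  rewrite -[in RHS](subn0 N) big_mkord mulr_sumr; apply: eq_bigr => k _.
  by rewrite mulrA [h^-1 ^+ (size s).+1]exprSr.
have -> : iter_Int s (fun y => pderiv i f y ^+ 2) =
    fun y => \sum_(c <- cells s) cell_Int c (fun y => pderiv i f y ^+ 2) y.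
  by apply/funext => y; rewrite cells_sum//; exact: contX2.
rewrite coord_Int_sum; last by move=> c; exact/cont_cell/contX2.
rewrite mulr_sumr; apply: eq_bigr => c _.
rewrite mulrCA; congr (_ * _); rewrite mulrA -exprMn mulVf ?expr1n ?mul1r//.
exact: lt0r_neq0.
Qed.

End Cells.

End PartialIntegrals.

(** * Square-integrable fields *)

Section L2form.
Context {R : realType} {Omega : set (space R)}.
Hypothesis mO : measurable (Omega : set (mspace R)).
Local Notation mu := (leb3 R).
Implicit Types (f g : mspace R -> R) (u v w : field R).

Local Notation sq f := (mu.-integrable Omega (fun x => (f x ^+ 2)%:E)).

(** [`|f * g| <= f ^+ 2 + g ^+ 2] *)
Lemma integrable_mul2 f g : measurable_fun Omega f -> measurable_fun Omega g ->
  sq f -> sq g -> mu.-integrable Omega (EFin \o (fun x => f x * g x)).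
Proof.
move=> mf mg if2 ig2.
have H : mu.-integrable Omega (EFin \o (fun x => f x ^+ 2 + g x ^+ 2)).
  by rewrite (_ : _ \o _ = (fun x => (f x ^+ 2)%:E) \+ (fun x => (g x ^+ 2)%:E))%E//; exact: integrableD.
apply: le_integrable H => //; first exact/measurable_EFinP/measurable_funM.
move=> x _ /=; rewrite lee_fin normrM [leRHS]ger0_norm ?addr_ge0 ?sqr_ge0//.
rewrite -(real_normK (num_real (f x))) -(real_normK (num_real (g x))).
have := sqr_ge0 (`|f x| - `|g x|); have := sqr_ge0 (`|f x| + `|g x|); lra.
Qed.

Lemma sq_lin f g k : measurable_fun Omega f -> measurable_fun Omega g ->
  sq f -> sq g -> sq (fun x => k * f x + g x).
Proof.
move=> mf mg if2 ig2.
have H : mu.-integrable Omega (EFin \o (fun x => (2 * k ^+ 2) * f x ^+ 2 + 2 * g x ^+ 2)).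
  rewrite (_ : _ \o _ = (fun x => (2 * k ^+ 2)%:E * (f x ^+ 2)%:E) \+
    (fun x => 2%:E * (g x ^+ 2)%:E))%E//.
  by apply: integrableD => //; exact: integrableZl.
apply: le_integrable H => //.
  apply/measurable_EFinP; apply: measurable_funX; apply: measurable_funD => //.
  by apply: measurable_funM => //; exact: measurable_cst.
move=> x _ /=; rewrite lee_fin !ger0_norm ?sqr_ge0//; last first.
  by have := mulr_ge0 (sqr_ge0 k) (sqr_ge0 (f x)); have := sqr_ge0 (g x); lra.
by have := sqr_ge0 (k * f x - g x); lra.
Qed.

Lemma L2_lin : lin_closed (L2 Omega).
Proof.
move=> k u v Lu Lv i; have [mu_ iu] := Lu i; have [mv iv] := Lv i; split.
  rewrite (_ : (k *: u + v) i = fun x => k * u i x + v i x)//.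
  apply: measurable_funD => //.
  by apply: measurable_funM => //; exact: measurable_cst.
exact: sq_lin.
Qed.

Lemma ip_integrable u v : L2 Omega u -> L2 Omega v ->
  mu.-integrable Omega (EFin \o (fun x => \sum_(i < 3) u i x * v i x)).
Proof.
move=> Lu Lv.
rewrite (_ : _ \o _ = fun x => \sum_(i < 3) (u i x * v i x)%:E)%E; last first.
  by apply/funext => x /=; rewrite sumEFin.
apply: integrable_sum => // i _.
by have [? ?] := Lu i; have [? ?] := Lv i; exact: integrable_mul2.
Qed.

Lemma ip_psd : psd_form (L2 Omega) (ip Omega).
Proof.
split=> [k u v w Lu Lv Lw|u v Lu Lv|u Lu].
- rewrite /ip -RintegralZl//; last exact: ip_integrable.
  rewrite -RintegralD//; last first.
  - exact: ip_integrable.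
  - rewrite (_ : _ \o _ = fun x => k%:E * (\sum_(i < 3) u i x * w i x)%:E)%E//.
    by apply: integrableZl => //; exact: ip_integrable.
  apply: eq_Rintegral => x _; rewrite mulr_sumr -big_split/=; apply: eq_bigr => i _.
  rewrite (_ : (k *: u + v) i x = k * u i x + v i x)//; ring.
- by apply: eq_Rintegral => x _; apply: eq_bigr => i _; rewrite mulrC.
- by apply: Rintegral_ge0 => x _; apply: sumr_ge0 => i _; rewrite -expr2 sqr_ge0.
Qed.

End L2form.

(** * Completeness *)

Section FastLimit.
Context {R : realType}.
Implicit Types a : nat -> R.

Let dsum a n j := \sum_(i < j) 2 ^+ i.+1 * (a (n + i).+1 - a (n + i)%N) ^+ 2.

(* The weights come from iterating [(x + y) ^+ 2 <= 2 * x ^+ 2 + 2 * y ^+ 2]. *)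
Let dsum_bound a n j : (a (n + j)%N - a n) ^+ 2 <= dsum a n j.
Proof.
rewrite /dsum; elim: j n => [|j IH] n; first by rewrite addn0 subrr expr0n/= big_ord0.
rewrite big_ord_recl/= addn0 expr1.
have := IH n.+1; rewrite addSnnS.
rewrite (eq_bigr (fun i : 'I_j => 2 ^+ i.+1 * (a (n + i.+1).+1 - a (n + i.+1)%N) ^+ 2));
  last by move=> i _; rewrite addSnnS.
set A := a _ => H; set d := a n.+1 - a n.
have -> : A - a n = (A - a n.+1) + d by rewrite /d; ring.
have H2 : (A - a n.+1 + d) ^+ 2 <= 2 * d ^+ 2 + 2 * (A - a n.+1) ^+ 2.
  by have := sqr_ge0 (A - a n.+1 - d); lra.
apply: (le_trans H2); rewrite lerD2l.
apply: (@le_trans _ _ (2 * \sum_(i < j) 2 ^+ i.+1 *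
   (a (n + i.+1).+1 - a (n + i.+1)%N) ^+ 2)); first by rewrite ler_pM2l.
by rewrite mulr_sumr; apply: ler_sum => k _; rewrite mulrA -exprS.
Qed.

Definition fast_tail a n : \bar R :=
  (\sum_(0 <= i <oo) (2 ^+ i.+1 * (a (n + i).+1 - a (n + i)%N) ^+ 2)%:E)%E.

(** Where the weighted series of squared increments is finite, it dominates the
    squared increment between any two later terms, so that [a] is Cauchy and the
    upper limit is a limit; where it is infinite, the bound is void.  The
    inequality therefore holds at every point, without exceptional null set. *)
Lemma fast_limit a n :
  (((fine (limn_esup (fun k => (a k)%:E)) - a n) ^+ 2)%:E <= fast_tail a n)%E.
Proof.
have t0 k : 0 <= (2 ^+ k.+1 * (a (n + k).+1 - a (n + k)%N) ^+ 2 : R).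
  by apply: mulr_ge0; [exact: exprn_ge0|exact: sqr_ge0].
have part j : ((dsum a n j)%:E <= fast_tail a n)%E.
  rewrite /dsum -sumEFin -(big_mkord predT (fun i => (2 ^+ i.+1 * (a (n + i).+1 - a (n + i)%N) ^+ 2)%:E)).
  by apply: nneseries_lim_ge => k _ _; rewrite lee_fin.
have hs0 : (0 <= fast_tail a n)%E by apply: nneseries_ge0 => k _ _; rewrite lee_fin.
have [->|/eqP hoo] := eqVneq (fast_tail a n) +oo%E; first exact: leey.
have [S SE] : exists S, fast_tail a n = S%:E.
  by move: hs0 hoo; case: (fast_tail a n) => [r _ _|//|//]; exists r.
rewrite SE in part *; have {}part j : dsum a n j <= S by rewrite -lee_fin.
have S0 : 0 <= S by rewrite -lee_fin -SE.
have tail j i : (a (n + j + i)%N - a (n + j)%N) ^+ 2 <= S / 2 ^+ j.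
  apply: (le_trans (dsum_bound a (n + j) i)).
  rewrite ler_pdivlMr ?exprn_gt0//; apply: (le_trans _ (part (j + i)%N)).
  rewrite /dsum big_split_ord/= mulr_suml.
  rewrite -[leLHS]add0r lerD//; first by apply: sumr_ge0.
  apply: ler_sum => k _; rewrite -addnA.
  rewrite mulrAC -exprD; apply: ler_wpM2r; first exact: sqr_ge0.
  by rewrite addSn addnC.
have ca : cvgn a.
  apply/cauchy_cvgP/cauchy_exP => e e0.
  have e2 : 0 < e ^+ 2 / (S + 1) by rewrite divr_gt0 ?exprn_gt0//; lra.
  have [j _ /(_ j (leqnn j)) /= hj] : \forall j \near \oo, (2^-1 : R) ^+ j < e ^+ 2 / (S + 1).
    have h1 : `|2^-1 : R| < 1 by rewrite ger0_norm ?invr_ge0// invf_lt1//; lra.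
    have /cvgrPdist_lt/(_ _ e2) := cvg_expr h1; apply: filterS => k.
    by rewrite sub0r normrN ger0_norm// exprn_ge0// invr_ge0.
  exists (a (n + j)%N); exists (n + j)%N => // k /= nk.
  rewrite -(subnKC nk) /ball/=.
  rewrite -(ltr_pXn2r (n:=2))// ?nnegrE ?(ltW e0)// real_normK ?num_real//.
  rewrite -sqrrN opprB; apply: le_lt_trans (tail j _) _.
  have : S / 2 ^+ j <= (S + 1) * 2^-1 ^+ j.
    by rewrite exprVn ler_wpM2r ?invr_ge0 ?exprn_ge0//; lra.
  move=> /le_lt_trans; apply; rewrite mulrC -ltr_pdivlMr//; lra.
have -> : limn_esup (fun k => (a k)%:E) = (limn a)%:E.
  rewrite -(EFin_lim ca); apply: is_cvg_limn_esupE.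
  apply/cvg_ex; exists (limn a)%:E; apply: cvg_EFin; last exact: ca.
  exact: nearW.
rewrite lee_fin/=.
have c : (a k - a n) ^+ 2 @[k --> \oo] --> (limn a - a n) ^+ 2.
  by apply: cvgM; apply: cvgB => //; exact: cvg_cst.
apply: (ler_cvg_to c (cvg_cst S)); exists n => // k /= nk.
rewrite -(subnKC nk); apply: (le_trans (dsum_bound a n _)); exact: part.
Qed.

End FastLimit.

Section FastCompleteness.
Context {R : realType} d (X : measurableType d) (mu : {measure set X -> \bar R}).
Variables (D : set X) (f : nat -> X -> R).
Hypotheses (mD : measurable D) (mf : forall n, measurable_fun D (f n)).
Hypothesis fast : forall n,
  (\int[mu]_(x in D) ((f n.+1 x - f n x) ^+ 2)%:E <= (2 * 4 ^+ n)^-1%:E)%E.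

Definition fast_lim : X -> R := fun x => fine (limn_esup (fun k => (f k x)%:E)).

Lemma measurable_fast_lim : measurable_fun D fast_lim.
Proof.
apply: (measurable_comp (F := setT)) => //.
apply: measurable_fun_limn_esup => n; exact/measurable_EFinP.
Qed.

(** [fast_limit], integrated term by term: the bounds [(2 * 4 ^ n)^-1] outweigh
    the weights [2 ^ i.+1], leaving the geometric series of the
    [2 ^- i / 4 ^+ n]. *)
Lemma fast_limP n :
  (\int[mu]_(x in D) ((fast_lim x - f n x) ^+ 2)%:E <= (2 / 4 ^+ n)%:E)%E.
Proof.
pose h i x : \bar R := (2 ^+ i.+1 * (f (n + i).+1 x - f (n + i)%N x) ^+ 2)%:E.
have h0 i x : (0 <= h i x)%E.
  by rewrite lee_fin; apply: mulr_ge0; [exact: exprn_ge0|exact: sqr_ge0].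
have md' i : measurable_fun D (fun x => (f i.+1 x - f i x) ^+ 2).
  by apply: measurable_funX; exact: measurable_funB.
have md i : measurable_fun D (fun x => ((f i.+1 x - f i x) ^+ 2)%:E).
  by apply/measurable_EFinP; exact: md'.
have mh i : measurable_fun D (h i).
  by apply/measurable_EFinP; apply: measurable_funM => //; exact: md'.
apply: (@le_trans _ _ (\int[mu]_(x in D) (\sum_(0 <= i <oo) h i x))%E).
  apply: ge0_le_integral => //.
  - by move=> x _; rewrite lee_fin sqr_ge0.
  - apply/measurable_EFinP; apply: measurable_funX; apply: measurable_funB => //.
    exact: measurable_fast_lim.
  - exact: ge0_emeasurable_sum.
  - by move=> x _; exact: (fast_limit (fun k => f k x)).
rewrite integral_nneseries//.
apply: lime_le; first by apply: is_cvg_nneseries => i _ _; exact: integral_ge0.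
apply: nearW => j.
apply: (@le_trans _ _ (\sum_(0 <= i < j) ((2^-1 ^+ i) / 4 ^+ n)%:E)%E).
  apply: lee_sum => i _; rewrite /h.
  under eq_integral do rewrite EFinM.
  rewrite ge0_integralZl//; last by move=> x _; rewrite lee_fin sqr_ge0.
  apply: (le_trans (lee_wpmul2l _ (fast _))); first by rewrite lee_fin exprn_ge0.
  rewrite -EFinM lee_fin exprD le_eqVlt; apply/orP; left; apply/eqP.
  have -> : (4 : R) ^+ i = 2 ^+ i * 2 ^+ i by rewrite -exprMn; congr (_ ^+ _); ring.
  have p1 : (2 : R) ^+ i != 0 by rewrite expf_neq0.
  have p2 : (4 : R) ^+ n != 0 by rewrite expf_neq0.
  by rewrite exprVn exprS; field; rewrite p1 p2.
rewrite sumEFin lee_fin -mulr_suml; apply: ler_wpM2r; first by rewrite invr_ge0 exprn_ge0.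
rewrite big_mkord; have -> : \sum_(i < j) (2^-1 : R) ^+ i = 2 - 2 * 2^-1 ^+ j.
  elim: (j) => [|k IH]; first by rewrite big_ord0 expr0; ring.
  by rewrite big_ord_recr/= IH exprS; field.
by rewrite gerBl mulr_ge0// exprn_ge0// invr_ge0.
Qed.

End FastCompleteness.

Section L2Complete.
Context {R : realType} {Omega : set (space R)}.
Hypothesis mO : measurable (Omega : set (mspace R)).
Local Notation mu := (leb3 R).

Lemma ip_EFin w : L2 Omega w ->
  ((ip Omega w w)%:E = \sum_(i < 3) \int[mu]_(x in Omega) ((w i x) ^+ 2)%:E)%E.
Proof.
move=> Lw; rewrite /ip /Rintegral fineK; last first.
  by apply: integrable_fin_num => //; exact: (ip_integrable mO).
under eq_integral do rewrite -sumEFin.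
rewrite ge0_integral_sum//.
- move=> i; have [mw _] := Lw i; apply/measurable_EFinP.
  exact: measurable_funM.
- by move=> i x _; rewrite lee_fin -expr2 sqr_ge0.
Qed.

(** Along a subsequence with squared increments below [(2 * 4 ^ n)^-1] the
    components converge to their [fast_lim]; a Cauchy sequence converges to the
    limit of any of its subsequences. *)
Lemma L2_complete (v : nat -> field R) : (forall n, L2 Omega (v n)) ->
  form_cauchy (ip Omega) v ->
  exists2 u, L2 Omega u & ip Omega (v n - u) (v n - u) @[n --> \oo] --> (0 : R).
Proof.
move=> Lv cv.
have lin := L2_lin mO; have psd := ip_psd mO.
have e4 n : 0 < (2 * 4 ^+ n : R)^-1 by rewrite invr_gt0 mulr_gt0// exprn_gt0.
have [N NP] := choice (fun n => cv _ (e4 n)).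
(* [phi n] is at least [N k] for all [k <= n]; hence both [phi n] and
   [phi n.+1] are past [N n]. *)
pose phi n := (\sum_(i < n.+1) N i + n)%N.
have phi_ge n : (n <= phi n)%N by rewrite leq_addl.
have phiN n : (N n <= phi n)%N by rewrite /phi big_ord_recr/= addnAC leq_addl.
have phiS n : (N n <= phi n.+1)%N.
  by apply: leq_trans (phiN n) _; rewrite /phi [in leqRHS]big_ord_recr/= leq_add ?leq_addr.
have sub_int w i : L2 Omega w ->
    (\int[mu]_(x in Omega) ((w i x) ^+ 2)%:E <= (ip Omega w w)%:E)%E.
  move=> Lw; rewrite ip_EFin// (bigD1 i)//= leeDl// sume_ge0// => j _.
  by apply: integral_ge0 => x _; rewrite lee_fin sqr_ge0.
pose f i n : mspace R -> R := v (phi n) i.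
have mf i n : measurable_fun (Omega : set (mspace R)) (f i n) by case: (Lv (phi n) i).
have fast i n : (\int[mu]_(x in Omega) ((f i n.+1 x - f i n x) ^+ 2)%:E <= (2 * 4 ^+ n)^-1%:E)%E.
  have Lw : L2 Omega (v (phi n.+1) - v (phi n)) by exact: (lin_closedB lin).
  apply: (le_trans (sub_int _ i Lw)); rewrite lee_fin; apply/ltW.
  by apply: NP => //.
pose u : field R := fun i => fast_lim (f i).
have mu_ i : measurable_fun (Omega : set (mspace R)) (u i).
  exact: (measurable_fast_lim (mf i)).
have uP i n := fast_limP mO (mf i) (fast i) n.
have md i n : measurable_fun (Omega : set (mspace R)) (fun x => u i x - f i n x).
  by apply: measurable_funB => //.
have Lu : L2 Omega u.
  move=> i; split; first exact: mu_.
  have -> : (fun x => (u i x ^+ 2)%:E) =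
      (fun x => ((1 * (u i x - f i 0%N x) + f i 0%N x) ^+ 2)%:E).
    by apply/funext => x; rewrite mul1r subrK.
  apply: (sq_lin mO 1 (md i 0%N) (mf i 0%N)); last by case: (Lv (phi 0%N) i).
  apply/integrableP; split; first by apply/measurable_EFinP/measurable_funX.
  under eq_integral do rewrite /= ger0_norm ?sqr_ge0//.
  by apply: le_lt_trans (uP i 0%N) _; rewrite ltry.
exists u => //.
have Lvu n : L2 Omega (v n - u) by exact: (lin_closedB lin).
have close n : ip Omega (v (phi n) - u) (v (phi n) - u) <= 6 / 4 ^+ n.
  rewrite -lee_fin ip_EFin//.
  apply: (@le_trans _ _ (\sum_(i < 3) (2 / 4 ^+ n)%:E)%E).
    apply: lee_sum => i _; apply: le_trans (uP i n).
    rewrite le_eqVlt; apply/orP; left; apply/eqP; apply: eq_integral => x _.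
    by congr (_%:E); rewrite -sqrrN opprB.
  rewrite sumEFin lee_fin !big_ord_recr big_ord0/=; lra.
apply/cvgrPdist_lt => e e0.
have e8 : 0 < e / 16 by rewrite divr_gt0.
have h1 : `|4^-1 : R| < 1 by rewrite ger0_norm ?invr_ge0// invf_lt1//; lra.
have /cvgrPdist_lt/(_ _ e8)[n0 _ Hn0] := cvg_expr h1.
have [n1 Hn1] := cv _ e8.
pose n := maxn n0 n1.
have := Hn0 n (leq_maxl _ _); rewrite /= sub0r normrN ger0_norm; last by rewrite exprn_ge0// invr_ge0.
move=> Hn; exists n => // m /= nm.
have nphi : (n1 <= phi n)%N by apply: leq_trans (phi_ge n); exact: leq_maxr.
have Lw1 : L2 Omega (v m - v (phi n)) by exact: (lin_closedB lin).
have Lw2 := Lvu (phi n).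
rewrite sub0r normrN ger0_norm; last exact: (psd_ge0 psd).
have -> : v m - u = (v m - v (phi n)) + (v (phi n) - u) by rewrite addrA subrK.
have h := psd_ge0 psd (lin_closedB lin Lw1 Lw2).
rewrite (psd_sqrB lin psd)// in h; rewrite (psd_sqrD lin psd)//.
have := Hn1 m (phi n) (leq_trans (leq_maxr _ _) nm) nphi.
have := close n; move: Hn; rewrite -exprVn => Hn Hc Hd.
lra.
Qed.

End L2Complete.

(** * Measurability and Fubini's theorem *)

Section Leb2.
Context {R : realType}.

(** The first factor of [leb3]; its sigma-finiteness allows the last coordinate
    to be integrated separately. *)
Definition leb2 : set (measurableTypeR R * measurableTypeR R)%type -> \bar R :=
  (@lebesgue_measure R \x @lebesgue_measure R)%E.

HB.instance Definition _ := Measure.copy leb2 (@lebesgue_measure R \x @lebesgue_measure R)%E.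

Let leb2_sigma_finite : sigma_finite setT leb2.
Proof.
have /sigma_finiteP [F [TF ndF Foo]] := sigma_finiteT (@lebesgue_measure R).
exists (fun n => F n `*` F n).
 rewrite -setXTT TF predeqE => -[x y]; split.
    move=> [/= [n _ Fnx] [k _ Gky]]; exists (maxn n k) => //; split.
    - by move: x Fnx; exact/subsetPset/ndF/leq_maxl.
    - by move: y Gky; exact/subsetPset/ndF/leq_maxr.
  by move=> [n _ []/= ? ?]; split; exists n.
move=> k; have [? ?] := Foo k.
split; first exact: measurableX.
by rewrite /leb2 product_measure1E// lte_mul_pinfty// ge0_fin_numE.
Qed.

HB.instance Definition _ := Measure_isSigmaFinite.Build _ _ _ leb2 leb2_sigma_finite.

End Leb2.


Section ContMeasurable.
Context {R : realType}.

Let box (q : rat * rat * rat * nat) : set (space R) :=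
  let r : R := q.2.+1%:R^-1 in
  (`]ratr q.1.1.1 - r, ratr q.1.1.1 + r[ `*` `]ratr q.1.1.2 - r, ratr q.1.1.2 + r[) `*`
  `]ratr q.1.2 - r, ratr q.1.2 + r[.

(** The measurable sets are those of the product structure, so an open set has to
    be exhibited as a countable union of boxes, here with rational centres and
    sizes [n.+1^-1]. *)
Lemma cont_measurable3 (f : space R -> R) : continuous f ->
  measurable_fun setT (f : mspace R -> R).
Proof.
move=> cf; apply: (measurability _ (measurable_realfun.RGenOpens.measurableE R)).
move=> _ [_ [a [b ->] <-]]; rewrite setTI.
set U : set (space R) := f @^-1` _.
have oU : open U by move/continuousP : cf; apply; exact: interval_open.
have -> : U = \bigcup_(q in setT) (if `[< box q `<=` U >] then box q else set0).
  apply/seteqP; split=> [[[x1 x2] x3] Ux|x [q _]]; last by case: asboolP => // + bx; exact.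
  have /nbhs_ballP[e /= e0 eU] : nbhs (x1, x2, x3) U by exact: open_nbhs_nbhs.
  have [n _ /(_ n (leqnn n)) /= n2] := near_infty_natSinv_lt (PosNum (divr_gt0 e0 (ltr0n R 2))).
  set r : R := n.+1%:R^-1 in n2; have r0 : 0 < r by rewrite /r.
  have pick (y : R) : exists q : rat, `|ratr q - y| < r.
    have [q /=] := @rat_in_itvoo R (y - r) (y + r) ltac:(lra).
    by rewrite in_itv/= => /andP[h1 h2]; exists q; rewrite ltr_norml; apply/andP; split; lra.
  have [q1 h1] := pick x1; have [q2 h2] := pick x2; have [q3 h3] := pick x3.
  have near_q (x y : R) q : `|ratr q - x| < r -> y \in `]ratr q - r, ratr q + r[ -> ball x e y.
    rewrite in_itv/= /ball/= => hq /andP[ya yb].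
    rewrite (_ : x - y = (ratr q - y) - (ratr q - x)); last by ring.
    apply: le_lt_trans (ler_normB _ _) _.
    have hy : `|ratr q - y| < r by rewrite ltr_norml; apply/andP; split; lra.
    lra.
  have self (x : R) q : `|ratr q - x| < r -> x \in `]ratr q - r, ratr q + r[.
    by rewrite in_itv/= ltr_norml => /andP[? ?]; apply/andP; split; lra.
  exists (q1, q2, q3, n) => //; case: asboolP => [_|].
    by split; [split|]; exact: self.
  case=> -[[y1 y2] y3] [[/= b1 b2] b3]; apply: eU.
  by split; [split|]; apply: near_q; eassumption.
apply: countable_bigcupT_measurable; first exact: countableP.
move=> q; case: asboolP => // _.
by apply: measurableX; [apply: measurableX|]; exact: measurable_itv.
Qed.

End ContMeasurable.

Section Fubini1.
Context {R : realType} d (X : measurableType d) (m : {sigma_finite_measure set X -> \bar R}).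
Variables (f : X * measurableTypeR R -> R) (A : set X) (M : R).
Hypotheses (mf : measurable_fun setT f) (mA : measurable A) (Aoo : (m A < +oo)%E).
Hypothesis fM : forall p, `|f p| <= M.
Hypothesis f0 : forall x z, ~ (A x /\ -1 <= z <= 1) -> f (x, z) = 0.
Hypothesis cf : forall x, continuous (fun z : R => f (x, z)).

Let B : set (X * measurableTypeR R) := A `*` `[-1, 1].

Let B0 p : ~ B p -> f p = 0.
Proof. by case: p => x z h; apply: f0 => -[Ax hz]; apply: h; split=> //=; rewrite in_itv. Qed.

Let mB : measurable B.
Proof. by apply: measurableX => //; exact: measurable_itv. Qed.

Lemma supp_integrable : (m \x lebesgue_measure)%E.-integrable setT (EFin \o f).
Proof.
have Boo : ((m \x lebesgue_measure)%E B < +oo)%E.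
  have i2 : (@lebesgue_measure R `[(-1)%R, 1%R]%classic < +oo)%E.
    by rewrite lebesgue_measure_itv/= lte_fin; case: ifP => _; rewrite ltry.
  rewrite /B product_measure1E//.
  apply: lte_mul_pinfty => //; by rewrite ge0_fin_numE.
have iB : (m \x lebesgue_measure)%E.-integrable B (EFin \o f).
  apply: measurable_bounded_integrable => //.
  - exact: measurable_funS mf.
  - by exists M; split; [exact: num_real|move=> y My x _; exact: le_trans (fM _) (ltW My)].
move/(integrable_mkcond _ mB) : iB; congr (_.-integrable _ _); apply/funext => p.
by rewrite patchE; case: ifPn => //; rewrite notin_setE => /B0 /= ->.
Qed.

(** Integrates out one real variable; two applications turn the integral over
    the whole space into iterated integrals over [-1, 1]. *)
Lemma supp_integral : (\int[m \x lebesgue_measure]_p (f p)%:E =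
  \int[m]_x (Int (-1) 1 (fun z => f (x, z)))%:E)%E.
Proof.
rewrite -(integral12_prod_meas1 supp_integrable); apply: eq_integral => x _.
rewrite /fubini_F /Rintegral fineK; last first.
  by apply: integrable_fin_num; [exact: measurable_itv|exact: Int_integrable].
rewrite [RHS]integral_mkcond; apply: eq_integral => z _.
rewrite patchE; case: ifPn => //; rewrite notin_setE /= in_itv/= => h.
by rewrite f0// => -[].
Qed.

End Fubini1.

(** * Iterated integrals and Lebesgue measure *)

Section TripleIntegral.
Context {R : realType}.
Implicit Types (f g : space R -> R) (x : space R).

Definition axis0 : 'I_3 := ord0.
Definition axis1 : 'I_3 := Ordinal (isT : (1 < 3)%N).
Definition axis2 : 'I_3 := Ordinal (isT : (2 < 3)%N).
Definition axes : seq 'I_3 := [:: axis0; axis1; axis2].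

Lemma sum_axes (F : 'I_3 -> R) : \sum_(j < 3) F j = \sum_(j <- axes) F j.
Proof.
rewrite !big_ord_recl big_ord0 !big_cons big_nil.
by congr (F _ + (F _ + (F _ + 0))); apply/val_inj.
Qed.

Lemma axesP (P : 'I_3 -> Prop) : P axis0 -> P axis1 -> P axis2 -> forall i, P i.
Proof.
move=> P0 P1 P2; case; case=> [|[|[|//]]] lt.
- by rewrite (_ : Ordinal lt = axis0)//; apply/val_inj.
- by rewrite (_ : Ordinal lt = axis1)//; apply/val_inj.
- by rewrite (_ : Ordinal lt = axis2)//; apply/val_inj.
Qed.

Lemma coordE a b c : (coord axis0 (a, b, c) = a :> R) * (coord axis1 (a, b, c) = b :> R) * (coord axis2 (a, b, c) = c :> R).
Proof. by []. Qed.

Definition triple_Int f : R := iter_Int axes f 0.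

Lemma set_coord3 (a b c : R) x : set_coord axis2 c (set_coord axis1 b (set_coord axis0 a x)) = (a, b, c).
Proof. by apply: coord_inj; apply: axesP; rewrite !coord_set/= coordE. Qed.

Lemma triple_IntE f : triple_Int f =
  Int (-1) 1 (fun a => Int (-1) 1 (fun b => Int (-1) 1 (fun c => f (a, b, c)))).
Proof.
by apply: eq_Int => a _; apply: eq_Int => b _; apply: eq_Int => c _; rewrite set_coord3.
Qed.

Definition cube : set (space R) := [set x | forall i, -1 <= coord i x <= 1].

Lemma cubeE : cube = (`[-1, 1] `*` `[-1, 1]) `*` `[-1, 1].
Proof.
apply/seteqP; split=> -[[a b] c] /=; rewrite !in_itv/=.
  by move=> h; have := h axis0; have := h axis1; have := h axis2; rewrite !coordE.
by move=> [[ha hb] hc]; apply: axesP; rewrite coordE.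
Qed.

Lemma compact_cube : compact cube.
Proof.
by rewrite cubeE; apply: compact_setX; [apply: compact_setX|]; exact: segment_compact.
Qed.

Lemma cube_bounded f : continuous f -> exists2 M, 0 <= M & forall x, cube x -> `|f x| <= M.
Proof.
move=> cf; have : compact (f @` cube).
  by apply: continuous_compact compact_cube; exact: continuous_subspaceT.
move=> /compact_bounded[M [_ mrt]]; exists `|M + 1| => // x cx.
apply: le_trans (ler_norm _); apply: mrt; first by lra.
by exists x.
Qed.

Section Supported.
Variable f : space R -> R.
Hypotheses (cf : continuous f) (f0 : forall x, ~ cube x -> f x = 0).

Let leb := @lebesgue_measure R.

Let sub3 (a b : R) : continuous (fun c => f (a, b, c)).
Proof.
apply: (@cont_comp _ _ _ (fun c : R => (a, b, c)) f) => //.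
by apply: cont_pair; [exact: cont_cst|exact: cont_id].
Qed.

Let g (p : R * R) := Int (-1) 1 (fun c => f (p, c)).

Let cg : continuous g.
Proof. exact: (cont_Int (F := fun p : R * R * R => f p)). Qed.

Let cg1 a : continuous (fun b => g (a, b)).
Proof.
apply: (@cont_comp _ _ _ (fun b : R => (a, b)) g) => //.
by apply: cont_pair; [exact: cont_cst|exact: cont_id].
Qed.

Let h a := Int (-1) 1 (fun b => g (a, b)).

Let mitv : measurable (`[-1, 1]%classic : set (measurableTypeR R)).
Proof. exact: measurable_itv. Qed.

Let itvoo : (leb `[(-1)%R, 1%R]%classic < +oo)%E.
Proof. by rewrite /leb lebesgue_measure_itv/= lte_fin; case: ifP => _; rewrite ltry. Qed.

Let bound : exists M, forall p, `|f p| <= M.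
Proof.
have [M M0 HM] := cube_bounded cf; exists M => p.
by have [/HM//|/f0 ->] := pselect (cube p); rewrite normr0.
Qed.

Let A2 : set (measurableTypeR R * measurableTypeR R) := `[-1, 1] `*` `[-1, 1].

Let mA2 : measurable A2. Proof. exact: measurableX. Qed.

Let A2oo : (@leb2 R A2 < +oo)%E.
Proof.
by rewrite /A2 /leb2 product_measure1E//; apply: lte_mul_pinfty => //; rewrite ge0_fin_numE.
Qed.

Let mf : measurable_fun setT (f : mspace R -> R) := cont_measurable3 cf.

Let f0' (p : measurableTypeR R * measurableTypeR R) (c : R) : ~ (A2 p /\ -1 <= c <= 1) -> f (p, c) = 0.
Proof.
case: p => a b np; apply: f0; rewrite cubeE => -[[/= ha hb] hc]; by apply: np; split=> //.
Qed.

Lemma leb3_integrable : (leb3 R).-integrable setT (EFin \o f : mspace R -> \bar R).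
Proof.
have [M HM] := bound.
by apply: (supp_integrable (m := @leb2 R) mf mA2 A2oo HM f0') => -[a b]; exact: sub3.
Qed.

Lemma integral_leb3 : (\int[leb3 R]_(x in setT) (f x)%:E)%E = (triple_Int f)%:E.
Proof.
have [M HM] := bound.
have E1 : (\int[leb3 R]_x (f x)%:E = \int[@leb2 R]_p (g p)%:E)%E.
  by apply: (supp_integral (m := @leb2 R) mf mA2 A2oo HM f0') => -[a b]; exact: sub3.
have M0 : 0 <= M by apply: le_trans (HM 0).
have gM p : `|g p| <= M * 2.
  have -> : (2 : R) = 1 - (-1) by ring.
  case: p => a b; exact: norm_Int_le.
have mg : measurable_fun setT (g : measurableTypeR R * measurableTypeR R -> R).
  have mG : measurable_fun setT ((fun x : space R => g x.1) : mspace R -> R).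
    apply: cont_measurable3; apply: (@cont_comp _ _ _ fst g) => // ?; exact: cvg_fst.
  pose pr (p : measurableTypeR R * measurableTypeR R) : mspace R := (p, (0 : R)).
  have mpr : measurable_fun setT pr.
    by apply: measurable_fun_pair; [exact: measurable_id|exact: measurable_cst].
  exact: (measurableT_comp mG mpr).
have g0 (a : measurableTypeR R) (b : R) : ~ (`[-1, 1]%classic a /\ -1 <= b <= 1) -> g (a, b) = 0.
  move=> nab; apply: Int_eq0 => c _; apply: f0'; rewrite /A2 => -[[/= ha hb] _].
  by apply: nab; split=> //.
have E2 : (\int[@leb2 R]_p (g p)%:E = \int[leb]_a (h a)%:E)%E.
  exact: (supp_integral (m := leb) mg mitv itvoo gM g0).
have ch : continuous h by exact: (cont_Int (F := g)).
rewrite E1 E2 triple_IntE -/(g _).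
have -> : Int (-1) 1 (fun a => Int (-1) 1 (fun b => Int (-1) 1 (fun c => f (a, b, c)))) =
  Int (-1) 1 h by [].
rewrite /Rintegral fineK; last first.
  by apply: integrable_fin_num; [exact: measurable_itv|exact: Int_integrable].
rewrite [RHS]integral_mkcond; apply: eq_integral => a _.
rewrite patchE; case: ifPn => //; rewrite notin_setE => na.
by congr (_%:E); apply: Int_eq0 => b _; apply: g0 => -[].
Qed.

Lemma Rintegral_leb3 (Omega : set (space R)) : (forall x, ~ Omega x -> f x = 0) ->
  (\int[leb3 R]_(x in (Omega : set (mspace R))) f x)%R = triple_Int f.
Proof.
move=> fO; rewrite /Rintegral integral_mkcond.
rewrite (_ : (fun x => (f x)%:E) \_ Omega = fun x => (f x)%:E)%E ?integral_leb3//.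
apply/funext => x; rewrite patchE; case: ifPn => //; rewrite notin_setE => /fO ->//.
Qed.

End Supported.

Lemma triple_IntD f g : continuous f -> continuous g -> triple_Int (fun x => f x + g x) = triple_Int f + triple_Int g.
Proof. by move=> cf cg; rewrite /triple_Int /= !coord_IntD//; do ?[apply: cont_coord_Int]. Qed.

Lemma triple_IntZ k f : continuous f -> triple_Int (fun x => k * f x) = k * triple_Int f.
Proof. by move=> cf; rewrite /triple_Int /= !coord_IntZ//; do ?[apply: cont_coord_Int]. Qed.

Lemma triple_Int_sum (I : eqType) (r : seq I) (F : I -> space R -> R) :
  (forall c, continuous (F c)) -> triple_Int (fun x => \sum_(c <- r) F c x) = \sum_(c <- r) triple_Int (F c).
Proof. by move=> cF; rewrite /triple_Int /= !coord_Int_sum// => c; do ?[apply: cont_coord_Int]. Qed.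

Lemma triple_Int_ge0 f : (forall x, 0 <= f x) -> 0 <= triple_Int f.
Proof. by move=> f0; rewrite /triple_Int/=; do 3 (apply: coord_Int_ge0 => ?). Qed.

(** The derivative [pderiv i] commutes with the integrals in the other two
    coordinates, and the fundamental theorem in the coordinate [i] leaves values
    of [f] on two faces of the cube. *)
Lemma triple_Int_pderiv i f : smooth f -> (forall x, (exists j, 1 <= `|coord j x|) -> f x = 0) ->
  triple_Int (pderiv i f) = 0.
Proof.
move=> sf f0; have m11 : (-1 : R) <= 1 by lra.
have B j (t : R) x : 1 <= `|t| -> coord j x = t -> f x = 0.
  by move=> t1 E; apply: f0; exists j; rewrite E.
have n1 : 1 <= `|1 : R| by rewrite normr1.
have nm1 : 1 <= `|-1 : R| by rewrite normrN normr1.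
have sf2 := smooth_coord_Int axis2 (-1) 1 sf; have sf12 := smooth_coord_Int axis1 (-1) 1 sf2.
move: i; apply: axesP; rewrite /triple_Int/=.
- rewrite -(@pderiv_coord_Int _ axis2 axis0)// -(@pderiv_coord_Int _ axis1 axis0)// coord_Int_pderiv//.
  rewrite [X in X - _](_ : _ = 0) ?[X in _ - X](_ : _ = 0) ?subrr//.
  + apply: Int_eq0 => b _; apply: Int_eq0 => c _.
    by apply: (B axis0 (-1)) => //; rewrite !coord_set.
  + apply: Int_eq0 => b _; apply: Int_eq0 => c _.
    by apply: (B axis0 1) => //; rewrite !coord_set.
- apply: Int_eq0 => a _; rewrite -(@pderiv_coord_Int _ axis2 axis1)// coord_Int_pderiv//.
  rewrite [X in X - _](_ : _ = 0) ?[X in _ - X](_ : _ = 0) ?subrr//.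
  + by apply: Int_eq0 => c _; apply: (B axis1 (-1)) => //; rewrite !coord_set.
  + by apply: Int_eq0 => c _; apply: (B axis1 1) => //; rewrite !coord_set.
- apply: Int_eq0 => a _; apply: Int_eq0 => b _; rewrite coord_Int_pderiv//.
  by rewrite (B axis2 1) ?coord_set// (B axis2 (-1)) ?coord_set// subrr.
Qed.

End TripleIntegral.

(** * Test fields and the Dirichlet form *)

Section TestFields.
Context {R : realType}.
Implicit Types (f g : space R -> R) (x : space R) (u v w : field R) (i j : 'I_3).

Lemma coord_enorm i x : `|coord i x| <= enorm x.
Proof.
rewrite -sqrtr_sqr ler_sqrt; last first.
  by rewrite !addr_ge0 ?sqr_ge0.
have h0 := sqr_ge0 x.1.1; have h1 := sqr_ge0 x.1.2; have h2 := sqr_ge0 x.2.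
move: i; apply: axesP; rewrite /coord (tnth_nth 0)/=; lra.
Qed.

Lemma supp_closed f : closed (supp f).
Proof. exact: closed_closure. Qed.

Lemma supp_vanish f x : ~ supp f x -> f x = 0.
Proof.
by move=> nx; apply/eqP/negP => /negP fx; apply: nx; exact: subset_closure.
Qed.

Lemma supp_min f (A : set (space R)) : closed A -> (forall x, ~ A x -> f x = 0) -> supp f `<=` A.
Proof.
move=> cA f0; rewrite /supp closureE; apply: smallest_sub => // x /= /eqP fx.
by apply: contrapT => /f0.
Qed.

Lemma pderiv_supp i f x : ~ supp f x -> pderiv i f x = 0.
Proof.
move=> nx; rewrite (@near_pderiv _ f (fun=> 0)) ?pderiv_cst//.
have : open (~` supp f) by exact/closed_openC/supp_closed.
move=> oS; have : nbhs x (~` supp f) by exact: open_nbhs_nbhs.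
by apply: filterS => y; exact: supp_vanish.
Qed.

Context {Omega : set (space R)}.

Lemma test_pderiv i f : test_function Omega f -> test_function Omega (pderiv i f).
Proof.
move=> [sf cf sO]; have sub : supp (pderiv i f) `<=` supp f.
  by apply: supp_min; [exact: supp_closed|move=> x; exact: pderiv_supp].
split; [exact: smooth_pderiv| |exact: subset_trans sub sO].
exact: subclosed_compact (supp_closed (f := pderiv i f)) cf sub.
Qed.

Lemma test_lin k f g : test_function Omega f -> test_function Omega g ->
  test_function Omega (fun x => k * f x + g x).
Proof.
move=> [sf cf fO] [sg cg gO].
have sub : supp (fun x => k * f x + g x) `<=` supp f `|` supp g.
  apply: supp_min; first by apply: closedU; exact: supp_closed.
  move=> x /not_orP[nf ng]; by rewrite (supp_vanish nf) (supp_vanish ng) mulr0 addr0.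
split; first exact: (smoothD (smoothZ k sf) sg).
  apply: subclosed_compact sub; first exact: supp_closed.
  exact: compactU.
by move=> x /sub[/fO|/gO].
Qed.

Lemma test_cont f : test_function Omega f -> continuous f.
Proof. by case=> sf _ _; exact: smooth_cont. Qed.

Lemma test_smooth f : test_function Omega f -> smooth f.
Proof. by case. Qed.

Lemma test_vanish f x : test_function Omega f -> ~ Omega x -> f x = 0.
Proof. by case=> _ _ fO nx; apply: supp_vanish => /fO. Qed.

Lemma laplacian_lin k u v : (forall i, smooth (u i)) -> (forall i, smooth (v i)) ->
  laplacian (k *: u + v) = k *: laplacian u + laplacian v.
Proof.
move=> su sv; apply/funext => i; apply/funext => x.
have -> : (k *: laplacian u + laplacian v) i x = k * laplacian u i x + laplacian v i x by [].
rewrite /laplacian mulr_sumr -big_split/=; apply: eq_bigr => j _.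
have -> : (k *: u + v) i = fun x => k * u i x + v i x by [].
have suj := smooth_pderiv j (su i); have svj := smooth_pderiv j (sv i).
rewrite (pderivD j (smoothZ k (su i)) (sv i)) (pderivZ k j (su i)).
by rewrite (pderivD j (smoothZ k suj) svj) (pderivZ k j suj).
Qed.

Lemma solenoidal_test_lin : lin_closed (solenoidal_test Omega).
Proof.
move=> k u v [tu du] [tv dv]; split=> [i|x].
  by rewrite (_ : (k *: u + v) i = fun x => k * u i x + v i x)//; exact: test_lin.
rewrite /divergence.
have E i : pderiv i ((k *: u + v) i) x = k * pderiv i (u i) x + pderiv i (v i) x.
  have -> : (k *: u + v) i = fun x => k * u i x + v i x by [].
  rewrite (pderivD i (smoothZ k (test_smooth (tu i))) (test_smooth (tv i))).
  by rewrite (pderivZ k i (test_smooth (tu i))).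
rewrite (eq_bigr _ (fun i _ => E i)) big_split/= -mulr_sumr.
by rewrite -/(divergence u x) -/(divergence v x) du dv mulr0 addr0.
Qed.

Hypothesis mO : measurable (Omega : set (mspace R)).
Hypothesis OB : Omega `<=` @unit_ball R.

Lemma sub_cube : Omega `<=` @cube R.
Proof.
move=> x /OB /= x1 i; rewrite -ler_norml; exact: le_trans (coord_enorm i x) (ltW x1).
Qed.

(** Test functions, their derivatives and the products of these are all of this
    kind, and for such fields [ip] is a sum of iterated integrals. *)
Definition vanishing_cont f := continuous f /\ forall x, ~ Omega x -> f x = 0.

Lemma test_C0 f : test_function Omega f -> vanishing_cont f.
Proof. by move=> tf; split=> [|x]; [exact: test_cont|exact: test_vanish]. Qed.

Lemma C0_cube f x : vanishing_cont f -> ~ cube x -> f x = 0.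
Proof. by move=> [_ f0] nx; apply: f0 => /sub_cube. Qed.

Lemma C0M f g : vanishing_cont f -> vanishing_cont g -> vanishing_cont (fun x => f x * g x).
Proof. by move=> [cf f0] [cg _]; split=> [|x nx]; [exact: contM|rewrite f0// mul0r]. Qed.

Lemma C0_L2 u : (forall i, vanishing_cont (u i)) -> L2 Omega u.
Proof.
move=> cu i; split.
  apply: measurable_funS (cont_measurable3 (cu i).1) => //.
have c2 := C0M (cu i) (cu i).
have : (leb3 R).-integrable setT (EFin \o (fun x => u i x * u i x)).
  by apply: leb3_integrable; [exact: c2.1|move=> x; exact: (C0_cube c2)].
by apply: integrableS.
Qed.

Lemma C0_ip u v : (forall i, vanishing_cont (u i)) -> (forall i, vanishing_cont (v i)) ->
  ip Omega u v = \sum_(i < 3) triple_Int (fun x => u i x * v i x).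
Proof.
move=> cu cv; have cm i := C0M (cu i) (cv i).
rewrite /ip Rintegral_leb3.
- by rewrite triple_Int_sum// => i; case: (cm i).
- by apply: cont_sum => i; case: (cm i).
- by move=> x nx; rewrite big1// => i _; exact: (C0_cube (cm i)).
- by move=> x nx; rewrite big1// => i _; exact: (cm i).2.
Qed.

Lemma solenoidal_C0 v i : solenoidal_test Omega v -> vanishing_cont (v i).
Proof. by move=> [tv _]; exact: test_C0. Qed.

Lemma solenoidal_L2_sub : solenoidal_test Omega `<=` L2 Omega.
Proof. by move=> v Dv; apply: C0_L2 => i; exact: solenoidal_C0. Qed.

Definition stokes_op (v : field R) : field R := - laplacian v.

Lemma stokes_op_C0 v i : solenoidal_test Omega v -> vanishing_cont (stokes_op v i).
Proof.
move=> [tv _]; rewrite (_ : stokes_op v i = fun x => - \sum_(j < 3) pderivs [:: j; j] (v i) x)//.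
have tj j : vanishing_cont (pderivs [:: j; j] (v i)) by exact/test_C0/test_pderiv/test_pderiv.
split=> [|x nx]; last by rewrite big1 ?oppr0// => j _; exact: (tj j).2.
under eq_fun do rewrite -sub0r; apply: contB; first exact: cont_cst.
by apply: cont_sum => j; case: (tj j).
Qed.

Lemma stokes_op_L2 v : solenoidal_test Omega v -> L2 Omega (stokes_op v).
Proof. by move=> Dv; apply: C0_L2 => i; exact: stokes_op_C0. Qed.

Lemma test_outside f x : test_function Omega f -> (exists j, 1 <= `|coord j x|) -> f x = 0.
Proof.
move=> tf [j j1]; apply: (test_vanish tf) => /OB /= x1.
by have := le_lt_trans (le_trans j1 (coord_enorm j x)) x1; rewrite ltxx.
Qed.

(** Integration by parts: the integral of
    [pderiv j (pderiv j (v i) * w i)] vanishes. *)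
Lemma dirichlet_form v w : solenoidal_test Omega v -> solenoidal_test Omega w ->
  ip Omega (stokes_op v) w =
  \sum_(i < 3) \sum_(j < 3) triple_Int (fun x => pderiv j (v i) x * pderiv j (w i) x).
Proof.
move=> Dv Dw; rewrite C0_ip; last 2 first.
- by move=> i; exact: stokes_op_C0.
- by move=> i; exact: solenoidal_C0.
apply: eq_bigr => i _; have tv := Dv.1 i; have tw := Dw.1 i.
have tj j := test_pderiv j tv; have tjj j := test_pderiv j (tj j); have twj j := test_pderiv j tw.
have -> : (fun x => stokes_op v i x * w i x) =
    (fun x => \sum_(j < 3) (-1) * (pderiv j (pderiv j (v i)) x * w i x)).
  apply/funext => x; rewrite (_ : stokes_op v i x = - \sum_(j < 3) pderiv j (pderiv j (v i)) x)//.
  by rewrite mulNr mulr_suml -sumrN; apply: eq_bigr => j _; rewrite mulN1r.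
rewrite triple_Int_sum; last by move=> j; apply: contZ; apply: contM; exact: test_cont.
apply: eq_bigr => j _.
have c1 : continuous (fun x => pderiv j (pderiv j (v i)) x * w i x).
  exact: contM (test_cont (tjj j)) (test_cont tw).
have c2 : continuous (fun x => pderiv j (v i) x * pderiv j (w i) x).
  exact: contM (test_cont (tj j)) (test_cont (twj j)).
rewrite triple_IntZ//.
have sm := smoothM (test_smooth (tj j)) (test_smooth tw).
have H : triple_Int (pderiv j (fun x => pderiv j (v i) x * w i x)) = 0.
  by apply: triple_Int_pderiv sm _ => x hx; rewrite (test_outside tw hx) mulr0.
rewrite (pderivM j (test_smooth (tj j)) (test_smooth tw)) in H.
have c3 : continuous (fun x => w i x * pderiv j (pderiv j (v i)) x).
  exact: contM (test_cont tw) (test_cont (tjj j)).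
rewrite (triple_IntD c2 c3) in H.
rewrite (_ : (fun x => pderiv j (pderiv j (v i)) x * w i x) =
  fun x => w i x * pderiv j (pderiv j (v i)) x); last by apply/funext => x; rewrite mulrC.
by apply/eqP; rewrite mulN1r eq_sym -addr_eq0 H.
Qed.

Lemma dirichlet_psd : psd_form (solenoidal_test Omega) (fun v w => ip Omega (stokes_op v) w).
Proof.
have psd := ip_psd mO.
split=> [k u v w Du Dv Dw|u v Du Dv|u Du].
- have -> : stokes_op (k *: u + v) = k *: stokes_op u + stokes_op v.
    rewrite /stokes_op laplacian_lin; last 2 first.
    + by move=> i; exact: test_smooth (Du.1 i).
    + by move=> i; exact: test_smooth (Dv.1 i).
    by rewrite opprD scalerN.
  apply: (psd_lin psd); [exact: stokes_op_L2..|exact: solenoidal_L2_sub].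
- apply: (etrans (dirichlet_form Du Dv)); apply: (etrans _ (esym (dirichlet_form Dv Du))).
  apply: eq_bigr => i _; apply: eq_bigr => j _.
  by congr triple_Int; apply/funext => x; rewrite mulrC.
- rewrite (dirichlet_form Du Du); apply: sumr_ge0 => i _; apply: sumr_ge0 => j _.
  by apply: triple_Int_ge0 => x; rewrite -expr2 sqr_ge0.
Qed.

End TestFields.

(** * Rellich's compactness theorem *)

Section Subsequences.
Context {R : realType}.

(** Bolzano-Weierstrass along an ultrafilter: a cluster point is a limit. *)
Lemma ultra_bounded_cvg (U : set_system nat) (s : nat -> R) (M : R) : UltraFilter U ->
  (forall n, `|s n| <= M) -> exists l : R, s @ U --> l.
Proof.
move=> UU sM; have FU : Filter U by exact: filter_filter.
have sU : (s @ U) `[- M, M]%classic.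
  apply: (@filterS _ U FU setT); last exact: filterT.
  by move=> n _ /=; rewrite in_itv/= -ler_norml.
have [l [_ cl]] := segment_compact (fmap_proper_filter s _) sU.
exists l => B Bl.
have [//|nB] := in_ultra_setVsetC (s @^-1` B) UU.
by have [y []] := cl (~` B) B nB Bl.
Qed.

(** A sequence that is controlled, up to any [e > 0], by finitely many bounded
    numerical sequences has a Cauchy subsequence.  All bounded sequences converge
    along one ultrafilter finer than the filter of late indices; hence for every [e] some member
    of the ultrafilter consists of indices that are mutually [e]-close, and the
    subsequence picks a late index in finite intersections of such members. *)
Lemma extract_cauchy (d : nat -> nat -> R) :
  (forall e : R, 0 < e -> exists (I : eqType) (r : seq I) (s : I -> nat -> R) (M delta : R),
    [/\ 0 < delta, forall c, c \in r -> forall n, `|s c n| <= M &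
     forall m n, (forall c, c \in r -> `|s c m - s c n| < delta) -> d m n < e]) ->
  exists2 f : nat -> nat, (forall n, (n <= f n)%N) &
    forall e : R, 0 < e -> exists N : nat, forall m n,
      (N <= m)%N -> (N <= n)%N -> d (f m) (f n) < e.
Proof.
move=> H.
have [U [UU sU]] := ultraFilterLemma (eventually_filter : ProperFilter \oo).
have FU : Filter U by exact: filter_filter.
have small e : 0 < e -> exists2 A : set nat, U A & forall m n, A m -> A n -> d m n < e.
  move=> e0; have [I [r [s [M [delta [d0 sM dP]]]]]] := H e e0.
  have d20 : 0 < delta / 2 by rewrite divr_gt0.
  have /choice[l lP] : forall c, exists l : R, c \in r -> s c @ U --> l.
    move=> c; have [cr|cr] := boolP (c \in r); last by exists 0.
    by have [l hl] := ultra_bounded_cvg UU (sM c cr); exists l.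
  exists [set n | forall c, c \in r -> `|l c - s c n| < delta / 2].
    elim: r {sM dP} lP => [|c r IH] lP; first by apply: (@filterS _ U FU setT); [move=> n _ c|exact: filterT].
    have Uc : U [set n | `|l c - s c n| < delta / 2].
      by have /cvgrPdist_lt/(_ _ d20) := lP c (mem_head _ _).
    have Ur := IH (fun c' h => lP c' (mem_behead (s := c :: r) h)).
    apply: (filterS _ (filterI Uc Ur)) => n [h1 h2] c'.
    by rewrite inE => /predU1P[->|/h2].
  move=> m n Am An; apply: dP => c cr.
  rewrite (_ : _ - _ = (l c - s c n) - (l c - s c m)); last by ring.
  by apply: le_lt_trans (ler_normB _ _) _; rewrite [delta]splitr ltrD ?Am ?An.
have /choice[A AP] : forall k : nat, exists A : set nat, U A /\
    forall m n, A m -> A n -> d m n < k.+1%:R^-1.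
  by move=> k; have [|A UA hA] := small k.+1%:R^-1; [by []|exists A].
have Ucap k : U [set n | (k <= n)%N /\ forall j, (j <= k)%N -> A j n].
  apply: (filterI (A := [set n | (k <= n)%N])); first by apply: sU; exact: nbhs_infty_ge.
  elim: k => [|k IH].
    by apply: (filterS _ (AP 0%N).1) => n An j; rewrite leqn0 => /eqP ->.
  apply: (filterS _ (filterI IH (AP k.+1).1)) => n [h1 h2] j.
  by rewrite leq_eqVlt => /predU1P[->|/h1].
have /choice[f fP] : forall k, exists n, (k <= n)%N /\ forall j, (j <= k)%N -> A j n.
  by move=> k; have [n] := filter_ex (Ucap k); exists n.
exists f => [n|e e0]; first by case: (fP n).
have [N _ HN] := near_infty_natSinv_lt (PosNum e0).
exists N => m n Nm Nn; apply: (lt_trans _ (HN N (leqnn N))).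
by apply: (AP N).2; [apply: (fP m).2|apply: (fP n).2].
Qed.

End Subsequences.

Section Rellich.
Context {R : realType} {Omega : set (space R)}.
Hypothesis mO : measurable (Omega : set (mspace R)).
Hypothesis OB : Omega `<=` @unit_ball R.
Implicit Types (f g : space R -> R) (v w : field R).

Lemma cell_Int_ge0 N c f x : (forall y, 0 <= f y) -> 0 <= cell_Int N c f x.
Proof.
move=> f0; elim: c x => [|p c IH] x /=; first exact: f0.
exact: coord_Int_ge0.
Qed.

Lemma cell_IntB N c f g x : continuous f -> continuous g ->
  cell_Int N c (fun y => f y - g y) x = cell_Int N c f x - cell_Int N c g x.
Proof.
move=> cf cg; elim: c x => [|p c IH] x //=.
rewrite /coord_Int -IntB; [|exact/cont_along/cont_cell|exact/cont_along/cont_cell].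
by apply: eq_Int => t _; rewrite IH.
Qed.

Lemma cell_bound N c f : (0 < N)%N -> continuous f -> c \in cells N axes ->
  cell_Int N c f 0 ^+ 2 <= mesh N ^+ 3 * triple_Int (fun x => f x ^+ 2).
Proof.
move=> N0 cf cs; apply: (le_trans (cell_CS N0 c 0 cf)).
rewrite (size_cells cs); apply: ler_wpM2l; first by rewrite exprn_ge0// ltW// mesh_gt0.
rewrite /triple_Int -(cells_sum N0 axes 0 (contX2 cf)) (big_rem c cs)/= lerDl.
by apply: sumr_ge0 => c' _; apply: cell_Int_ge0 => y; exact: sqr_ge0.
Qed.

Lemma ip_sqr w : solenoidal_test Omega w ->
  ip Omega w w = \sum_(i < 3) triple_Int (fun x => w i x ^+ 2).
Proof. by move=> Dw; rewrite (C0_ip OB)// => i; exact: solenoidal_C0. Qed.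

Lemma solenoidal_friedrichs N w : (0 < N)%N -> solenoidal_test Omega w ->
  ip Omega w w <=
    \sum_(i < 3) \sum_(c <- cells N axes) (mesh N)^-1 ^+ 3 * cell_Int N c (w i) 0 ^+ 2 +
    mesh N ^+ 2 * ip Omega (stokes_op w) w.
Proof.
move=> N0 Dw; rewrite ip_sqr// (dirichlet_form OB Dw Dw) mulr_sumr -big_split/=.
apply: ler_sum => i _; rewrite sum_axes.
by apply: (cells_friedrichs N0 (s := axes)) => //; exact: test_smooth (Dw.1 i).
Qed.

(** In [solenoidal_friedrichs], applied to [v m - v n], the bound on the Dirichlet
    forms makes the second term at most [e / 2] once the mesh is small, and the
    first one involves only finitely many cell integrals, which [cell_bound]
    keeps bounded: the situation of [extract_cauchy]. *)
Lemma rellich (v : nat -> field R) (C : R) : (forall n, solenoidal_test Omega (v n)) ->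
  (forall n, ip Omega (v n) (v n) + ip Omega (stokes_op (v n)) (v n) <= C) ->
  exists2 f : nat -> nat, (forall n, (n <= f n)%N) & form_cauchy (ip Omega) (v \o f).
Proof.
move=> Dv vC; apply: (extract_cauchy (d := fun m n => ip Omega (v m - v n) (v m - v n))).
have psd := ip_psd mO; have dpsd := dirichlet_psd mO OB.
have lin := solenoidal_test_lin (Omega := Omega).
have b0 n : 0 <= ip Omega (v n) (v n) by apply: (psd_ge0 psd); exact: (solenoidal_L2_sub mO OB).
have a0 n : 0 <= ip Omega (stokes_op (v n)) (v n) by exact: (psd_ge0 dpsd (Dv n)).
have C0 : 0 <= C by apply: le_trans (vC 0%N); exact: addr_ge0.
move=> e e0.
have [N N0 hN] : exists2 N : nat, (0 < N)%N & mesh N ^+ 2 * (4 * C) <= e / 2.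
  have d0 : 0 < e / (32 * (C + 1)) by rewrite divr_gt0//; lra.
  have [n _ /(_ n (leqnn n)) /= hn] := near_infty_natSinv_lt (PosNum d0).
  exists n.+1 => //; rewrite /mesh.
  have q0 : (0 : R) < n.+1%:R^-1 by [].
  have q1 : n.+1%:R^-1 <= (1 : R) by rewrite invf_le1// ler1n.
  move: hn q0 q1; set q := n.+1%:R^-1; rewrite ltr_pdivlMr; last by lra.
  by move=> hn q0 q1; nra.
pose h : R := mesh N; have h0 : 0 < h := mesh_gt0 N0.
have h30 : 0 < h ^+ 3 by rewrite exprn_gt0.
pose K : R := (size (cells N axes))%:R; have K0 : 0 <= K by rewrite /K.
have K1 : 0 < K + 1 by lra.
(* If every cell integral varies by less than [sqrt delta2], then each of the
   [3 * K] weighted squares is at most [e / (12 * (K + 1))], and together they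
   stay below [e / 2]. *)
pose delta2 := e * h ^+ 3 / (12 * (K + 1)).
have d20 : 0 < delta2 by apply: divr_gt0; apply: mulr_gt0.
pose r := [seq (i, c) | i <- axes, c <- cells N axes].
have cont_v n i : continuous (v n i) by exact: (test_cont ((Dv n).1 i)).
exists _, r, (fun p n => cell_Int N p.2 (v n p.1) 0), (h ^+ 3 * C + 1), (Num.sqrt delta2).
split.
- by rewrite sqrtr_gt0.
- move=> [i c] /allpairsP[[i' c'] /= [_ cs [-> ->]]] n.
  have M1 : 1 <= h ^+ 3 * C + 1 by rewrite lerDr mulr_ge0// ltW.
  rewrite -(ler_pXn2r (n:=2))// ?nnegrE ?(le_trans _ M1)// real_normK ?num_real//.
  apply: (le_trans (cell_bound N0 (cont_v n i') cs)).
  apply: (@le_trans _ _ (h ^+ 3 * C)).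
    rewrite ler_pM2l//; apply: le_trans (vC n); apply: (@le_trans _ _ (ip Omega (v n) (v n))).
      rewrite ip_sqr// (bigD1 i')//= lerDl sumr_ge0// => j _.
      by apply: triple_Int_ge0 => x; exact: sqr_ge0.
    by rewrite lerDl.
  by move: M1; set X := h ^+ 3 * C; nra.
move=> m n close; have Dw := lin_closedB lin (Dv m) (Dv n).
apply: (le_lt_trans (solenoidal_friedrichs N0 Dw)).
have A : mesh N ^+ 2 * ip Omega (stokes_op (v m - v n)) (v m - v n) <= e / 2.
  apply: le_trans hN; apply: ler_wpM2l; first exact: sqr_ge0.
  pose aq v w := ip Omega (stokes_op v) w.
  have E1 : aq (v m - v n) (v m - v n) = aq (v m) (v m) - 2 * aq (v m) (v n) + aq (v n) (v n).
    exact: (psd_sqrB lin dpsd (Dv m) (Dv n)).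
  have E2 : aq (v m + v n) (v m + v n) = aq (v m) (v m) + 2 * aq (v m) (v n) + aq (v n) (v n).
    exact: (psd_sqrD lin dpsd (Dv m) (Dv n)).
  have E3 : 0 <= aq (v m + v n) (v m + v n).
    exact: (psd_ge0 dpsd (lin_closedD lin (Dv m) (Dv n))).
  have h1 : aq (v m) (v m) <= C by apply: le_trans (vC m); rewrite lerDr.
  have h2 : aq (v n) (v n) <= C by apply: le_trans (vC n); rewrite lerDr.
  suff : aq (v m - v n) (v m - v n) <= 4 * C by [].
  rewrite E1; rewrite E2 in E3; move: E3 h1 h2; clear.
  move: (aq (v m) (v m)) (aq (v m) (v n)) (aq (v n) (v n)) => a x b; lra.
have B : \sum_(i < 3) \sum_(c <- cells N axes) (mesh N)^-1 ^+ 3 *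
    cell_Int N c ((v m - v n) i) 0 ^+ 2 <= \sum_(i < 3) \sum_(c <- cells N axes) e / (12 * (K + 1)).
  apply: ler_sum => i _; rewrite big_seq_cond [leRHS]big_seq_cond; apply: ler_sum => c; rewrite andbT => cs.
  have -> : (v m - v n) i = fun x => v m i x - v n i x by [].
  rewrite cell_IntB; [|exact: cont_v..].
  have ir : (i, c) \in r.
    apply/allpairsP; exists (i, c); split=> //=; rewrite /axes !inE.
    by move: i; apply: axesP; rewrite eqxx ?orbT.
  have := close _ ir => /=; rewrite -(ltr_pXn2r (n:=2))// ?nnegrE ?sqrtr_ge0//.
  rewrite real_normK ?num_real// (sqr_sqrtr (ltW d20)) => hd.
  rewrite exprVn mulrC ler_pdivrMr//; apply: ltW; apply: (lt_le_trans hd).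
  by rewrite /delta2 -/h le_eqVlt mulrAC eqxx.
apply: (le_lt_trans (lerD B A)).
have S : \sum_(c <- cells N axes) e / (12 * (K + 1)) = K * (e / (12 * (K + 1))).
  by rewrite big_const_seq count_predT iter_addr_0 [RHS]mulr_natl.
rewrite !big_ord_recl big_ord0 addr0 S.
have : K * (e / (12 * (K + 1))) <= e / 12.
  rewrite mulrA ler_pdivrMr ?mulr_gt0//; have -> : e / 12 * (12 * (K + 1)) = e * (K + 1) by field.
  by rewrite mulrC ler_pM2l//; lra.
lra.
Qed.

End Rellich.

(** * A smooth cut-off function on the line *)

Section Cutoff1.
Context {R : realType}.
Implicit Types (f g : R -> R) (t a b : R).

(** The derivatives of [exp (- 1 / x)], extended by zero to [x <= 0], are linear
    combinations of these functions. *)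
Definition flat n t : R := if 0 < t then t^-1 ^+ n * expR (- t^-1) else 0.

(** The term of order [n.+2] of the exponential series bounds [expR (t^-1)] from
    below; the factor [t ^+ 2] yields a zero derivative at the origin. *)
Lemma flat_le n t : `|flat n t| <= (n.+2)`!%:R * t ^+ 2.
Proof.
have F0 : 0 < (n.+2)`!%:R :> R by rewrite ltr0n fact_gt0.
rewrite /flat; case: ltP => t0; last by rewrite normr0 mulr_ge0 ?sqr_ge0// ltW.
have y0 : 0 < t^-1 by rewrite invr_gt0.
rewrite ger0_norm; last by rewrite mulr_ge0 ?expR_ge0// exprn_ge0// ltW.
rewrite expRN ler_pdivrMr ?expR_gt0//.
have := @expR_ge1Dxn R t^-1 n.+1 (ltW y0) => h.
apply: (@le_trans _ _ ((n.+2)`!%:R * t ^+ 2 * (t^-1 ^+ n.+2 / (n.+2)`!%:R))).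
  rewrite !exprS le_eqVlt; apply/orP; left; apply/eqP; field.
  by rewrite (lt0r_neq0 t0) (lt0r_neq0 F0).
apply: ler_wpM2l; first by rewrite mulr_ge0 ?sqr_ge0// ltW.
by apply: le_trans h; rewrite lerDr.
Qed.

Lemma is_derive_flat n t :
  is_derive t (1 : R) (flat n) (- n%:R * flat n.+1 t + flat n.+2 t).
Proof.
have [t0|t0|->] := ltgtP t 0.
- apply: (@near_eq_is_derive _ _ _ (fun=> 0)).
    have := @lt_nbhsl _ t 0 t0.
    by apply: filterS => y y0; rewrite /flat ltNge ltW.
  rewrite /flat !ltNge (ltW t0)/= mulr0 addr0; exact: is_derive_cst.
- apply: (@near_eq_is_derive R R R (fun y : R => y^-1 ^+ n * expR (- y^-1))).
    have := @lt_nbhsr _ 0 t t0.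
    by apply: filterS => y y0; rewrite /flat y0.
  have tn0 : t != 0 by rewrite lt0r_neq0.
  have dV : is_derive t (1 : R) (fun y : R => y^-1) (- t ^- 2 *: 1).
    exact: (@is_deriveV R id).
  have dX := @is_deriveX _ _ _ n t 1 _ dV.
  have dN := @is_deriveN _ _ _ _ t 1 _ dV.
  have dE := @is_derive1_comp R expR (fun y : R => - y^-1) t _ _ (is_derive_expR _) dN.
  have E0 : (fun y : R => y^-1 ^+ n * expR (- y^-1)) =
      ((fun y : R => y^-1) ^+ n) * (expR \o (fun y : R => - y^-1)).
    by apply/funext => y; rewrite exprfctE.
  rewrite E0; apply: is_derive_eq (@is_deriveM _ _ _ _ t 1 _ _ dX dE) _.
  rewrite /flat t0 exprfctE /GRing.scale/= !mulr1.
  rewrite -exprVn; set y := t^-1; set E := expR _.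
  by case: (n) => [|m] /=; rewrite ?exprS; ring.
- have z k : flat k 0 = 0 by rewrite /flat ltxx.
  rewrite !z mulr0 addr0.
  pose K : R := (n.+2)`!%:R; have K0 : 0 <= K by [].
  suff H : h^-1 *: ((flat n \o shift 0) (h *: 1) - flat n 0) @[h --> 0^'] --> (0 : R).
    by split; [apply/cvg_ex; exists 0|exact: cvg_lim H].
  apply/cvgrPdist_le => e e0.
  have K1 : 0 < K + 1 by lra.
  near=> h.
  have hn0 : h != 0 by near: h; exact: nbhs_dnbhs_neq.
  have he : `|h| <= e / (K + 1).
    near: h; apply: dnbhs0_le; exact: divr_gt0.
  rewrite sub0r normrN z subr0 /= addr0 /GRing.scale/= mulr1 normrM normfV.
  have h0 : 0 < `|h| by rewrite normr_gt0.
  rewrite mulrC ler_pdivrMr//; apply: (le_trans (flat_le n h)); rewrite -/K.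
  rewrite -(real_normK (num_real h)) expr2 mulrA ler_pM2r//.
  rewrite ler_pdivlMr// in he; apply: le_trans he.
  by rewrite mulrC ler_pM2l//; lra.
Unshelve. all: by end_near.
Qed.

(** A class closed under differentiation that contains the cut-off function. *)
Inductive elementary : (R -> R) -> Prop :=
| el_flat n : elementary (flat n)
| el_cst k : elementary (fun=> k)
| el_add f g : elementary f -> elementary g -> elementary (fun t => f t + g t)
| el_mul f g : elementary f -> elementary g -> elementary (fun t => f t * g t)
| el_inv f : elementary f -> (forall t, f t != 0) -> elementary (fun t => (f t)^-1)
| el_aff f a b : elementary f -> elementary (fun t => f (a * t + b)).

Lemma is_derive_aff f (f' t a b : R) : is_derive (a * t + b) (1 : R) f f' ->
  is_derive t (1 : R) (fun t => f (a * t + b)) (f' * a).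
Proof.
move=> df; apply: (@is_derive1_comp R f (fun t => a * t + b)).
have dM := @is_deriveM _ _ (cst a) id t 1 0 1 (is_derive_cst _ _ _) (is_derive_id _ _).
have H := @is_deriveD _ _ _ (cst a * id) (cst b) t 1 _ _ dM (is_derive_cst _ _ _).
by apply: is_derive_eq H _; rewrite /GRing.scale/= mulr0 addr0 mulr1 addr0.
Qed.

Lemma elementary_derive f : elementary f ->
  exists2 g, elementary g & forall t, is_derive t (1 : R) f (g t).
Proof.
elim=> {f}[n|k|f g ef [f' ef' df] eg [g' eg' dg]|f g ef [f' ef' df] eg [g' eg' dg]|
  f ef [f' ef' df] f0|f a b ef [f' ef' df]].
- exists (fun t => - n%:R * flat n.+1 t + flat n.+2 t); last exact: is_derive_flat.
  by apply: el_add; [apply: el_mul; [exact: el_cst|]|]; exact: el_flat.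
- by exists (fun=> 0); [exact: el_cst|move=> t; exact: is_derive_cst].
- exists (fun t => f' t + g' t); first exact: el_add.
  by move=> t; exact: is_deriveD.
- exists (fun t => f t * g' t + g t * f' t).
    by apply: el_add; exact: el_mul.
  by move=> t; exact: is_deriveM.
- exists (fun t => (-1) * ((f t)^-1 * (f t)^-1) * f' t).
    apply: el_mul ef'; apply: el_mul; first exact: el_cst.
    by apply: el_mul; exact: el_inv.
  move=> t; apply: is_derive_eq (is_deriveV (f0 t) (df t)) _.
  by rewrite /GRing.scale/= expr2 invfM mulN1r.
- exists (fun t => f' (a * t + b) * a).
    by apply: el_mul; [exact: el_aff|exact: el_cst].
  by move=> t; exact: is_derive_aff.
Qed.

Lemma elementary_seq f : elementary f -> exists phi : nat -> R -> R, phi 0%N = f /\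
  forall n t, is_derive t (1 : R) (phi n) (phi n.+1 t).
Proof.
move=> ef; exists (fun n => derive1n n f); split; first by [].
have en n : elementary (derive1n n f).
  elim: n => [//|n IH]; rewrite derive1nS.
  have [g eg dg] := elementary_derive IH.
  rewrite (_ : _^`()%classic = g)//; apply/funext => t.
  by rewrite derive1E; apply: derive_val.
move=> n t; rewrite derive1nS; have [g eg dg] := elementary_derive (en n).
rewrite derive1E; have -> : 'D_1 (derive1n n f) t = g t by apply: derive_val.
exact: dg.
Qed.

(** The denominator is positive, since [flat 0 t] vanishes for [t <= 0] only and
    the other term for [1 <= t] only. *)
Definition smooth_step t : R := flat 0 t * (flat 0 t + flat 0 (-1 * t + 1))^-1.

Lemma flat0_gt0 t : 0 < t -> 0 < flat 0 t.
Proof. by move=> t0; rewrite /flat t0 expr0 mul1r expR_gt0. Qed.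

Lemma flat_ge0 n t : 0 <= flat n t.
Proof.
rewrite /flat; case: ltP => // t0.
by rewrite mulr_ge0 ?expR_ge0// exprn_ge0// invr_ge0 ltW.
Qed.

Lemma elementary_step : elementary smooth_step.
Proof.
apply: el_mul; first exact: el_flat.
apply: el_inv.
  by apply: el_add; [exact: el_flat|apply: (el_aff (-1) 1); exact: el_flat].
move=> t; apply: lt0r_neq0; have [t0|t0] := ltP 0 t.
  by rewrite ltr_pwDl ?flat0_gt0 ?flat_ge0.
by rewrite ltr_wpDl ?flat_ge0// flat0_gt0//; lra.
Qed.

Lemma step0 t : t <= 0 -> smooth_step t = 0.
Proof. by move=> t0; rewrite /smooth_step {1}/flat ltNge t0/= mul0r. Qed.

Lemma step1 t : 1 <= t -> smooth_step t = 1.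
Proof.
move=> t1; have t0 : 0 < t by lra.
have h : -1 * t + 1 <= 0 by lra.
have -> : smooth_step t = flat 0 t * (flat 0 t + 0)^-1 by rewrite /smooth_step [flat 0 (_ + 1)]/flat ltNge h.
by rewrite addr0 divff// lt0r_neq0// flat0_gt0.
Qed.

(** The value 1 holds up to [`|t| = 2] and the value 0 from [`|t| = 3] on, so
    that at scale [s] the cut-off function is 1 on a neighbourhood of the ball of
    radius [s] removed from the annulus. *)
Lemma cutoff1 : exists phi : nat -> R -> R,
  [/\ forall n t, is_derive t (1 : R) (phi n) (phi n.+1 t),
      forall t, `|t| <= 2 -> phi 0%N t = 1 & forall t, 3 <= `|t| -> phi 0%N t = 0].
Proof.
have [|phi [phi0 dphi]] := @elementary_seq (fun t => smooth_step (1 * t + 3) * smooth_step (-1 * t + 3)).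
  by apply: el_mul; apply: el_aff; exact: elementary_step.
exists phi; split=> // t; rewrite phi0.
  by rewrite ler_norml => /andP[h1 h2]; rewrite !step1 ?mulr1//; lra.
by rewrite ler_normr => /orP[h|h]; [rewrite [X in _ * X]step0 ?mulr0//|rewrite step0 ?mul0r//]; lra.
Qed.

End Cutoff1.

(** * Vector potentials *)

Section Boxes.
Context {R : realType}.
Implicit Types (f g : space R -> R) (x : space R) (i j : 'I_3) (r s : R).

Definition box r : set (space R) := [set x | forall i, `|coord i x| <= r].

Lemma box1 : box 1 = @cube R.
Proof. by apply/seteqP; split=> x hx i; have := hx i; rewrite ler_norml. Qed.

Lemma sub_box r : r <= 1 -> box r `<=` @cube R.
Proof. by move=> r1; rewrite -box1 => x hx i; exact: le_trans (hx i) r1. Qed.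

Lemma closed_box r : closed (box r).
Proof.
have -> : box r = \bigcap_(i in setT) ((fun x => `|coord i x|) @^-1` [set t | t <= r]).
  by apply/seteqP; split=> x hx i => [_|]; exact: hx.
apply: closed_bigI => i _; apply: closed_comp; last exact: closed_le.
by move=> x _; apply: (cont_norm (f := coord i)); exact: cont_coord.
Qed.

Lemma compact_box r : r <= 1 -> compact (box r).
Proof. by move=> r1; exact: subclosed_compact (@closed_box r) (@compact_cube R) (sub_box r1). Qed.

Lemma coord_Int_small i f M r x : continuous f -> 0 < r -> r <= 1 -> (forall y, `|f y| <= M) ->
  (forall y, r <= `|coord i y| -> f y = 0) -> `|coord_Int i (-1) 1 f x| <= 2 * r * M.
Proof.
move=> cf r0 r1 fM f0; have c := @cont_along _ i x _ cf.
rewrite /coord_Int (@Int_split _ _ (- r))//; last by apply/andP; split; lra.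
rewrite (@Int_split _ (- r) r)//; last by apply/andP; split; lra.
rewrite (@Int_eq0 _ (-1)) ?add0r; last first.
  move=> t /andP[_ tr]; apply: f0; rewrite coord_set eqxx ler_normr; apply/orP; right; lra.
rewrite [X in _ + X]Int_eq0 ?addr0; last first.
  move=> t /andP[tr _]; apply: f0; rewrite coord_set eqxx ler_normr; apply/orP; left; lra.
have -> : 2 * r * M = M * (r - - r) by ring.
by apply: norm_Int_le => //; lra.
Qed.

Lemma triple_Int_small f M r : continuous f -> 0 < r -> r <= 1 -> (forall y, `|f y| <= M) ->
  (forall y, (exists i, r <= `|coord i y|) -> f y = 0) -> `|triple_Int f| <= (2 * r) ^+ 3 * M.
Proof.
move=> cf r0 r1 fM f0; rewrite /triple_Int /=.
have c2 := @cont_coord_Int _ axis2 (-1) 1 _ cf; have c1 := @cont_coord_Int _ axis1 (-1) 1 _ c2.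
have B2 y : `|coord_Int axis2 (-1) 1 f y| <= 2 * r * M.
  by apply: coord_Int_small => // z hz; apply: f0; exists axis2.
have B1 y : `|coord_Int axis1 (-1) 1 (coord_Int axis2 (-1) 1 f) y| <= 2 * r * (2 * r * M).
  apply: coord_Int_small => // z hz; apply: Int_eq0 => t _; apply: f0; exists axis1.
  by rewrite coord_set.
have -> : (2 * r) ^+ 3 * M = 2 * r * (2 * r * (2 * r * M)) by ring.
apply: coord_Int_small => // z hz; apply: Int_eq0 => t _; apply: Int_eq0 => u _; apply: f0; exists axis0.
by rewrite !coord_set.
Qed.

(** The point [x] is reached from the origin by three segments parallel to the
    axes, each of length at most [r]. *)
Lemma lipschitz0 f M r x : smooth f -> r <= 1 -> box r x ->
  (forall i y, cube y -> `|pderiv i f y| <= M) -> `|f x - f 0| <= 3 * M * r.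
Proof.
move=> sf r1 xr fM; have r0 : 0 <= r by apply: le_trans (normr_ge0 _) (xr axis0).
have M0 : 0 <= M.
  by apply: le_trans (fM axis0 x (sub_box r1 xr)).
have step i y : cube y -> coord i y = 0 -> `|f (set_coord i (coord i x) y) - f y| <= M * r.
  move=> cy y0; have Ey : set_coord i 0 y = y.
    by apply: coord_inj => j; rewrite coord_set; case: eqP => // ->; rewrite y0.
  have cd := @cont_along _ i y _ (smooth_cont (smooth_pderiv i sf)).
  have bd t : -1 <= t <= 1 -> `|pderiv i f (set_coord i t y)| <= M.
    by move=> t1; apply: fM => j; rewrite coord_set; case: ifP => // _; exact: cy.
  have := xr i; rewrite ler_norml => /andP[h1 h2].
  rewrite -{2}Ey; have [c0|c0] := leP 0 (coord i x).
    rewrite -coord_Int_pderiv//; apply: (@le_trans _ _ (M * (coord i x - 0))); last by apply: ler_wpM2l => //; lra.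
    by apply: norm_Int_le => // t /andP[t0 tx]; apply: bd; apply/andP; split; lra.
  rewrite distrC -coord_Int_pderiv//; last exact: ltW.
  apply: (@le_trans _ _ (M * (0 - coord i x))); last by apply: ler_wpM2l => //; lra.
  by apply: norm_Int_le => //; [exact: ltW|move=> t /andP[t0 tx]; apply: bd; apply/andP; split; lra].
have cx i : -1 <= coord i x <= 1 by exact: sub_box xr i.
have c00 i : coord i (0 : space R) = 0 by move: i; apply: axesP.
have z11 : -1 <= (0 : R) <= 1 by apply/andP; split; lra.
pose x1 := set_coord axis0 (coord axis0 x) 0; pose x2 := set_coord axis1 (coord axis1 x) x1.
have Ex : x = set_coord axis2 (coord axis2 x) x2.
  by apply: coord_inj; apply: axesP; rewrite !coord_set.
have h1 : `|f x1 - f 0| <= M * r by apply: step => // i; rewrite c00.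
have h2 : `|f x2 - f x1| <= M * r.
  apply: step; last by rewrite coord_set/= c00.
  by apply: axesP; rewrite coord_set/= ?c00.
have h3 : `|f x - f x2| <= M * r.
  rewrite {1}Ex; apply: step; last by rewrite !coord_set/= c00.
  by apply: axesP; rewrite !coord_set/= ?c00.
rewrite (_ : _ - _ = (f x - f x2) + ((f x2 - f x1) + (f x1 - f 0))); last by ring.
apply: le_trans (ler_normD _ _) _; have := ler_normD (f x2 - f x1) (f x1 - f 0); lra.
Qed.

Lemma pderivs_supp l f : supp (pderivs l f) `<=` supp f.
Proof.
elim: l => //= i l IH; apply: subset_trans IH.
by apply: supp_min; [exact: supp_closed|move=> x; exact: pderiv_supp].
Qed.

End Boxes.

Section Curl.
Context {R : realType}.
Implicit Types (a b : space R -> R) (x : space R).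

(** The curl of the field [(a, b, 0)]. *)
Definition curl2 a b : field R := fun i x =>
  if i == axis0 then - pderiv axis2 b x
  else if i == axis1 then pderiv axis2 a x
  else pderiv axis0 b x - pderiv axis1 a x.

Lemma smooth_curl2 a b i : smooth a -> smooth b -> smooth (curl2 a b i).
Proof.
move=> sa sb; have ha j := smooth_pderiv j sa; have hb j := smooth_pderiv j sb.
move: i; apply: axesP; [exact: smoothN (hb axis2)|exact: ha axis2|exact: smoothB (hb axis0) (ha axis1)].
Qed.

Lemma div_curl2 a b x : smooth a -> smooth b -> divergence (curl2 a b) x = 0.
Proof.
move=> sa sb; have ha j := smooth_pderiv j sa; have hb j := smooth_pderiv j sb.
rewrite /divergence sum_axes !big_cons big_nil addr0.
have E0 : pderiv axis0 (curl2 a b axis0) = fun x => - pderiv axis0 (pderiv axis2 b) x.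
  exact: pderivN (hb axis2).
have E2 : pderiv axis2 (curl2 a b axis2) = fun x => pderiv axis2 (pderiv axis0 b) x - pderiv axis2 (pderiv axis1 a) x.
  exact: pderivB (hb axis0) (ha axis1).
have E1 : pderiv axis1 (curl2 a b axis1) = pderiv axis1 (pderiv axis2 a) by [].
rewrite E0 E1 E2 (pderivC axis0 axis2 sb) (pderivC axis1 axis2 sa).
move: (pderiv axis2 (pderiv axis0 b) x) (pderiv axis2 (pderiv axis1 a) x) => p q; ring.
Qed.

Lemma near_curl2 a b a' b' i x : (\forall y \near x, a y = a' y) ->
  (\forall y \near x, b y = b' y) -> curl2 a b i x = curl2 a' b' i x.
Proof. by move=> ha hb; rewrite /curl2 !(near_pderiv _ ha) !(near_pderiv _ hb). Qed.

(** Minus the integral over the vertical segment of length 2 above the point.  From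
    height at least -1 this segment reaches height 1; so, for a function that
    vanishes from that height on, this is the primitive in the third variable
    that vanishes there as well. *)
Definition vprim f : space R -> R := fun x => - axis_Int axis2 0 2 f x.

Lemma smooth_vprim f : smooth f -> smooth (vprim f).
Proof. by move=> sf; exact: smoothN (smooth_axis_Int axis2 0 2 sf). Qed.

Lemma pderiv_vprim f i : smooth f -> pderiv i (vprim f) = vprim (pderiv i f).
Proof.
move=> sf; rewrite /vprim (pderivN i (smooth_axis_Int axis2 0 2 sf)).
by rewrite (pderiv_axis_Int axis2 i 0 2 sf).
Qed.

Lemma vprim_pderiv f x : smooth f -> (forall y, 1 <= coord axis2 y -> f y = 0) -> -1 <= coord axis2 x ->
  vprim (pderiv axis2 f) x = f x.
Proof.
move=> sf f0 x1; have le02 : (0 : R) <= 2 by [].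
rewrite /vprim (axis_Int_pderiv axis2 x le02 sf) scale0r addr0 (f0 (x + _)).
  by rewrite sub0r opprK.
by rewrite coordD eqxx mulr1; lra.
Qed.

(** Above height -1, a solenoidal field that vanishes from height 1 on has an
    explicit vector potential.  The first two components of the identity are the fundamental theorem; in the
    third one, [pderiv axis0 (v axis0) + pderiv axis1 (v axis1)] is replaced by
    [- pderiv axis2 (v axis2)].  The constants [k0] and [k1] permit a potential
    that vanishes at the origin. *)
Lemma curl_vprim (v : field R) i x : (forall i, smooth (v i)) ->
  (forall i y, 1 <= coord axis2 y -> v i y = 0) -> (forall y, divergence v y = 0) ->
  -1 <= coord axis2 x -> forall k0 k1 : R,
  curl2 (fun y => vprim (v axis1) y - k0) (fun y => - vprim (v axis0) y - k1) i x = v i x.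
Proof.
move=> sv v0 dv x1 k0 k1.
have sp j := smooth_vprim (sv j).
have Ea j : pderiv j (fun y => vprim (v axis1) y - k0) = vprim (pderiv j (v axis1)).
  rewrite (pderivB j (sp axis1) (smooth_cst k0)) (pderiv_vprim j (sv axis1)) pderiv_cst.
  by apply/funext => y; rewrite subr0.
have Eb j : pderiv j (fun y => - vprim (v axis0) y - k1) = fun y => - vprim (pderiv j (v axis0)) y.
  rewrite (pderivB j (smoothN (sp axis0)) (smooth_cst k1)) (pderivN j (sp axis0)) (pderiv_vprim j (sv axis0)) pderiv_cst.
  by apply/funext => y; rewrite subr0.
rewrite /curl2 !Ea !Eb; move: i; apply: axesP => /=.
- by rewrite opprK vprim_pderiv// => y; exact: v0.
- by rewrite vprim_pderiv// => y; exact: v0.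
have cl : continuous (fun s : R => x + s *: unit_vec R axis2).
  by apply: cont_lineP; [exact: cont_cst|exact: cont_id].
have cdv j : continuous (fun s : R => pderiv j (v j) (x + s *: unit_vec R axis2)).
  exact: cont_comp cl (smooth_cont (smooth_pderiv j (sv j))).
rewrite -[RHS](vprim_pderiv (sv axis2) (v0 axis2) x1) /vprim /axis_Int.
have -> : Int 0 2 (fun s => pderiv axis2 (v axis2) (x + s *: unit_vec R axis2)) =
    Int 0 2 (fun s => - 1 * (pderiv axis0 (v axis0) (x + s *: unit_vec R axis2) +
      pderiv axis1 (v axis1) (x + s *: unit_vec R axis2))).
  apply: eq_Int => s _; have := dv (x + s *: unit_vec R axis2).
  rewrite /divergence sum_axes !big_cons big_nil addr0.
  set p := pderiv axis0 _ _; set q := pderiv axis1 _ _; set z := pderiv axis2 _ _.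
  move: p q z => p q z; lra.
rewrite IntZ; last exact: contD (cdv axis0) (cdv axis1).
rewrite (IntD _ _ (cdv axis0) (cdv axis1)).
move: (Int _ _ _) (Int _ _ _) => p q; ring.
Qed.

End Curl.

(** * Cutting off near the origin *)

Section Puncture.
Context {R : realType}.
Implicit Types (x : space R) (i j : 'I_3) (s t : R).

Lemma seg_bounded (g : R -> R) (r : R) : continuous g ->
  exists2 M, 0 <= M & forall t, `|t| <= r -> `|g t| <= M.
Proof.
move=> cg; have : compact (g @` `[- r, r]).
  by apply: continuous_compact (@segment_compact R (- r) r); exact: continuous_subspaceT.
move=> /compact_bounded[M [_ mrt]]; exists `|M + 1| => // t tr.
apply: le_trans (ler_norm _); apply: mrt; first by lra.
by exists t => //=; rewrite in_itv/= -ler_norml.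
Qed.

Lemma cube_bounded_fin (I : finType) (F : I -> space R -> R) :
  (forall k, continuous (F k)) ->
  exists2 M, 0 <= M & forall k x, cube x -> `|F k x| <= M.
Proof.
move=> cF; have /choice[M MP] : forall k : I, exists M, 0 <= M /\
    forall x, cube x -> `|F k x| <= M.
  by move=> k; have [M M0 HM] := cube_bounded (cF k); exists M.
exists (\sum_k M k); first by apply: sumr_ge0 => k _; exact: (MP k).1.
move=> k x cx; apply: le_trans ((MP k).2 x cx) _.
by rewrite (bigD1 k)//= lerDl sumr_ge0// => l _; exact: (MP l).1.
Qed.

Lemma cont_enorm : continuous (@enorm R).
Proof.
have c i := contX2 (@cont_coord R i).
have E : @enorm R = fun x => Num.sqrt (coord axis0 x ^+ 2 + coord axis1 x ^+ 2 + coord axis2 x ^+ 2).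
  by apply/funext => -[[a b] d].
rewrite E; apply: (cont_comp (v := Num.sqrt)); last exact: sqrt_continuous.
exact: contD (contD (c axis0) (c axis1)) (c axis2).
Qed.

Variable phi : nat -> R -> R.
Hypothesis dphi : forall n t, is_derive t (1 : R) (phi n) (phi n.+1 t).
Hypothesis phi1 : forall t, `|t| <= 2 -> phi 0%N t = 1.
Hypothesis phi0 : forall t, 3 <= `|t| -> phi 0%N t = 0.

(** The [n]-th derivative of [phi 0 (t / s)]. *)
Definition scaled s n t : R := s^-1 ^+ n * phi n (s^-1 * t).

Lemma is_derive_scaled s n t : is_derive t (1 : R) (scaled s n) (scaled s n.+1 t).
Proof.
have := @is_derive_aff _ (phi n) (phi n.+1 (s^-1 * t + 0)) t s^-1 0 (dphi _ _).
under eq_fun do rewrite addr0.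
move=> d; have := @is_deriveM _ _ (cst (s^-1 ^+ n)) _ t (1 : R) _ _ _ d.
move=> H; apply: is_derive_eq (H _ _) _.
by rewrite /scaled /GRing.scale/= mulr0 !addr0 exprSr; ring.
Qed.

(** The partial derivative of order [(n0, n1, n2)] of the cut-off function at
    scale [s]. *)
Definition bump s (n0 n1 n2 : nat) : space R -> R := fun x =>
  scaled s n0 (coord axis0 x) * (scaled s n1 (coord axis1 x) * scaled s n2 (coord axis2 x)).

Let smooth_sc s n j : smooth (fun x => scaled s n (coord j x)).
Proof. exact: (smooth_coord n j (is_derive_scaled s)). Qed.

Lemma smooth_bump s n0 n1 n2 : smooth (bump s n0 n1 n2).
Proof.
exact: smoothM (smooth_sc s n0 axis0) (smoothM (smooth_sc s n1 axis1) (smooth_sc s n2 axis2)).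
Qed.

Lemma pderiv_bump s n0 n1 n2 i : pderiv i (bump s n0 n1 n2) =
  bump s (n0 + (i == axis0)) (n1 + (i == axis1)) (n2 + (i == axis2)).
Proof.
rewrite /bump (pderivM i (smooth_sc s n0 axis0) (smoothM (smooth_sc s n1 axis1) (smooth_sc s n2 axis2))).
rewrite (pderivM i (smooth_sc s n1 axis1) (smooth_sc s n2 axis2)).
have d n j := pderiv_coord i j (is_derive_scaled s n).
rewrite !d; apply/funext => x; move: i {d}; apply: axesP; rewrite /= ?addn0 ?addn1; ring.
Qed.

Lemma bump_eq1 s x : 0 < s -> box (2 * s) x -> bump s 0 0 0 x = 1.
Proof.
move=> s0 xs; have h i : scaled s 0 (coord i x) = 1.
  rewrite /scaled expr0 mul1r phi1// normrM normfV (gtr0_norm s0).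
  by rewrite mulrC ler_pdivrMr.
by rewrite /bump !h !mulr1.
Qed.

Lemma bump_eq0 s x : 0 < s -> ~ box (3 * s) x -> bump s 0 0 0 x = 0.
Proof.
move=> s0 /existsNP[i /negP]; rewrite -ltNge => xi.
have h : scaled s 0 (coord i x) = 0.
  rewrite /scaled expr0 mul1r phi0// normrM normfV (gtr0_norm s0).
  by rewrite mulrC ler_pdivlMr// ltW.
by move: i {xi} h; apply: axesP => h; rewrite /bump h ?mul0r ?mulr0.
Qed.

Lemma bump_bound : exists2 M, 0 <= M & forall s n0 n1 n2 x,
  0 < s -> box (3 * s) x -> (n0 <= 2)%N -> (n1 <= 2)%N -> (n2 <= 2)%N ->
  `|bump s n0 n1 n2 x| <= M * s^-1 ^+ (n0 + n1 + n2).
Proof.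
have cphi n := is_derive_cont (dphi n).
have [M0 p0 H0] := seg_bounded 3 (cphi 0%N).
have [M1 p1 H1] := seg_bounded 3 (cphi 1%N).
have [M2 p2 H2] := seg_bounded 3 (cphi 2%N).
pose M := M0 + M1 + M2; have pM : 0 <= M by rewrite /M; lra.
exists (M ^+ 3); first exact: exprn_ge0.
move=> s n0 n1 n2 x s0 xs k0 k1 k2.
have si : 0 <= s^-1 by rewrite invr_ge0 ltW.
have B n i : (n <= 2)%N -> `|scaled s n (coord i x)| <= M * s^-1 ^+ n.
  move=> n2'; rewrite /scaled normrM mulrC (ger0_norm (exprn_ge0 n si)).
  apply: ler_wpM2r; first exact: exprn_ge0.
  have t3 : `|s^-1 * coord i x| <= 3.
    by rewrite normrM normfV (gtr0_norm s0) mulrC ler_pdivrMr//; exact: xs.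
  case: n n2' => [|[|[|//]]] _; rewrite /M.
  + by have := H0 _ t3; lra.
  + by have := H1 _ t3; lra.
  + by have := H2 _ t3; lra.
rewrite /bump normrM [X in _ * X]normrM.
have -> : M ^+ 3 * s^-1 ^+ (n0 + n1 + n2) =
    (M * s^-1 ^+ n0) * ((M * s^-1 ^+ n1) * (M * s^-1 ^+ n2)) by rewrite !exprD; ring.
have pos n : 0 <= M * s^-1 ^+ n by rewrite mulr_ge0// exprn_ge0.
apply: ler_pM; [exact: normr_ge0|exact: mulr_ge0|exact: B|].
by apply: ler_pM; [exact: normr_ge0|exact: normr_ge0|exact: B|exact: B].
Qed.

(** Every derivative of the cut-off function costs a factor [s^-1], but [A] is of
    size [s] on its support as [A 0 = 0].  By Leibniz' rule the product loses one
    power of [s^-1] less than the cut-off function alone. *)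
Lemma bump_mul_bound (A : space R -> R) : smooth A -> A 0 = 0 ->
  exists2 K, 0 <= K & forall s x, 0 < s -> s < 1 / 6 -> box (3 * s) x -> forall i j,
    `|pderiv i (fun y => bump s 0 0 0 y * A y) x| <= K /\
    `|pderiv j (pderiv i (fun y => bump s 0 0 0 y * A y)) x| <= K * s^-1.
Proof.
move=> sA A0; have [M M0 HM] := bump_bound.
have [L L0 HL] := cube_bounded_fin (fun i => smooth_cont (smooth_pderiv i sA)).
have [L' L'0 HL'] := cube_bounded_fin
  (fun p : 'I_3 * 'I_3 => smooth_cont (smooth_pderiv p.1 (smooth_pderiv p.2 sA))).
exists (M * (12 * L + L')); first by apply: mulr_ge0 => //; lra.
move=> s x s0 s6 xs i j.
have s31 : 3 * s <= 1 by lra.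
have cx : cube x := sub_box s31 xs.
have sb := smooth_bump s 0 0 0; have sbi := smooth_pderiv i sb.
have sAi := smooth_pderiv i sA.
have hA : `|A x| <= 9 * L * s.
  have := lipschitz0 sA s31 xs HL; rewrite A0 subr0 => /le_trans; apply.
  by rewrite le_eqVlt; apply/orP; left; apply/eqP; ring.
have si : 0 < s^-1 by rewrite invr_gt0.
have ss : s * s^-1 = 1 by rewrite divff// lt0r_neq0.
have s1 : 1 <= s^-1 by rewrite invf_ge1//; lra.
have hb : `|bump s 0 0 0 x| <= M by have := HM s 0%N 0%N 0%N x s0 xs isT isT isT; rewrite expr0 mulr1.
have hbi k : `|pderiv k (bump s 0 0 0) x| <= M * s^-1.
  rewrite pderiv_bump; move: k; apply: axesP => /=.
  - exact: HM s 1%N 0%N 0%N x s0 xs isT isT isT.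
  - exact: HM s 0%N 1%N 0%N x s0 xs isT isT isT.
  - exact: HM s 0%N 0%N 1%N x s0 xs isT isT isT.
have hbij : `|pderiv j (pderiv i (bump s 0 0 0)) x| <= M * s^-1 ^+ 2.
  rewrite !pderiv_bump.
  have E : (0 + (i == axis0) + (j == axis0) + (0 + (i == axis1) + (j == axis1)) +
      (0 + (i == axis2) + (j == axis2)))%N = 2%N.
    by move: i j {sbi sAi}; apply: axesP; apply: axesP.
  have := HM s (0 + (i == axis0) + (j == axis0))%N (0 + (i == axis1) + (j == axis1))%N
    (0 + (i == axis2) + (j == axis2))%N x s0 xs.
  by rewrite E; apply; do 2 case: (_ == _).
have hAi k := HL k x cx; have hAij := HL' (j, i) x cx.
rewrite (pderivM i sb sA).
rewrite (pderivD j (smoothM sb sAi) (smoothM sA sbi)) (pderivM j sb sAi) (pderivM j sA sbi).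
move: hA hb (hbi i) (hbi j) hbij (hAi i) (hAi j) hAij => /=.
move: (A x) (bump s 0 0 0 x) (pderiv i (bump s 0 0 0) x) (pderiv j (bump s 0 0 0) x)
  (pderiv j (pderiv i (bump s 0 0 0)) x) (pderiv i A x) (pderiv j A x) (pderiv j (pderiv i A) x).
move=> a b bi bj bij ai aj aij ha hb' hbi' hbj' hbij' hai haj haij.
have P (u w cu cw : R) : `|u| <= cu -> `|w| <= cw -> `|u * w| <= cu * cw.
  by move=> ? ?; rewrite normrM ler_pM.
have ML : 0 <= M * L by exact: mulr_ge0.
have ML' : 0 <= M * L' by exact: mulr_ge0.
split.
  have h1 := P _ _ _ _ hb' hai; have h2 := P _ _ _ _ ha hbi'.
  apply: (le_trans (ler_normD _ _)).
  have E : 9 * L * s * (M * s^-1) = 9 * (M * L) by rewrite -[RHS]mulr1 -ss; ring.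
  by rewrite E in h2; move: h1 h2; rewrite mulrDr mulrCA; lra.
have h1 := P _ _ _ _ hb' haij; have h2 := P _ _ _ _ hai hbj'.
have h3 := P _ _ _ _ ha hbij'; have h4 := P _ _ _ _ hbi' haj.
have E3 : 9 * L * s * (M * s^-1 ^+ 2) = 9 * ((M * L) * s^-1).
  by rewrite -[RHS]mulr1 -ss expr2; ring.
have E2 : L * (M * s^-1) = (M * L) * s^-1 by ring.
have E4 : M * s^-1 * L = (M * L) * s^-1 by ring.
have E1 : M * L' <= (M * L') * s^-1 by rewrite -[leLHS]mulr1 ler_wpM2l.
rewrite E3 in h3; rewrite E2 in h2; rewrite E4 in h4.
have -> : M * (12 * L + L') * s^-1 = 12 * ((M * L) * s^-1) + (M * L') * s^-1 by ring.
have MLs : 0 <= (M * L) * s^-1 by rewrite mulr_ge0// ltW.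
have n1 := ler_normD (b * aij + ai * bj) (a * bij + bi * aj).
have n2 := ler_normD (b * aij) (ai * bj).
have n3 := ler_normD (a * bij) (bi * aj).
move: h1 h2 h3 h4 E1 MLs n1 n2 n3.
move: `|b * aij| `|ai * bj| `|a * bij| `|bi * aj| => q1 q2 q3 q4.
move: ((M * L) * s^-1) ((M * L') * s^-1) (M * L') => z1 z2 z3.
lra.
Qed.

End Puncture.

(** * Approximation by fields that vanish near the origin *)

Section Approximation.
Context {R : realType}.
Implicit Types (x : space R) (i j : 'I_3) (s : R) (v w : field R).

Lemma measurable_unit_ball : measurable (@unit_ball R : set (mspace R)).
Proof.
rewrite -[X in measurable X]setTI.
have := cont_measurable3 (@cont_enorm R) measurableT (measurable_itv `]-oo, (1 : R)[).
congr (measurable (_ `&` _)); apply/seteqP; split=> x /=; rewrite in_itv//.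
Qed.

Lemma measurable_annulus s : measurable (annulus s : set (mspace R)).
Proof.
rewrite -[X in measurable X]setTI.
have := cont_measurable3 (@cont_enorm R) measurableT (measurable_itv `]s, (1 : R)[).
congr (measurable (_ `&` _)); apply/seteqP; split=> x /=; rewrite in_itv//.
Qed.

Lemma annulus_sub s : annulus s `<=` @unit_ball R.
Proof. by move=> x /= /andP[]. Qed.

(** The corners of [box (3 * s)] have norm [3 * sqrt 3 * s], which is below 1 for
    [s < 1 / 6]. *)
Lemma box_sub_ball s : 0 < s -> s < 1 / 6 -> box (3 * s) `<=` @unit_ball R.
Proof.
move=> s0 s6 x xs; have h i : coord i x ^+ 2 <= (3 * s) ^+ 2.
  rewrite -(real_normK (num_real (coord i x))).
  by have := xs i; have := normr_ge0 (coord i x); move: `|coord i x| => t; nra.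
have -> : unit_ball x = is_true (enorm x < 1) by [].
rewrite -sqrtr1 ltr_sqrt//.
have := h axis0; have := h axis1; have := h axis2; rewrite /coord !(tnth_nth 0)/=.
have : (3 * s) ^+ 2 <= 1 / 4 by nra.
lra.
Qed.

Lemma test_mono (A B : set (space R)) f : A `<=` B -> test_function A f -> test_function B f.
Proof. by move=> AB [sf cf fA]; split=> //; exact: subset_trans AB. Qed.

Lemma solenoidal_mono (A B : set (space R)) : A `<=` B ->
  solenoidal_test A `<=` solenoidal_test B.
Proof. by move=> AB v [tv dv]; split=> // i; exact: test_mono (tv i). Qed.

(** A point has no capacity for solenoidal fields.  Let [A] be a potential of [v]
    with [A 0 = 0], let [eta] be the cut-off function at scale [s], and
    [w = curl (eta A)].  Then [v - w] is solenoidal and vanishes where [eta = 1].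
    Moreover [w] is bounded by [K] and its gradient by [K * s^-1], on a support of
    volume of order [s ^+ 3]; so the squared norm of [w] is of order [s ^+ 3] and
    its Dirichlet form of order [s]. *)
Lemma punctured_approx v : solenoidal_test (@unit_ball R) v ->
  exists2 K, 0 <= K & forall s, 0 < s -> s < 1 / 6 -> exists w : field R,
    [/\ solenoidal_test (@unit_ball R) w, solenoidal_test (annulus s) (v - w),
        ip (@unit_ball R) w w <= K * s & ip (@unit_ball R) (stokes_op w) w <= K * s].
Proof.
move=> [tv dv].
have sv i := test_smooth (tv i).
have OB : @unit_ball R `<=` @unit_ball R by [].
have v0 i y : 1 <= coord axis2 y -> v i y = 0.
  by move=> y1; apply: (test_outside OB (tv i)); exists axis2; apply: le_trans y1 (ler_norm _).
have [phi [dphi phi1 phi0]] := @cutoff1 R.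
pose a y := vprim (v axis1) y - vprim (v axis1) 0.
pose b y := - vprim (v axis0) y - - vprim (v axis0) 0.
have sa : smooth a := smoothB (smooth_vprim (sv axis1)) (smooth_cst _).
have sb : smooth b := smoothB (smoothN (smooth_vprim (sv axis0))) (smooth_cst _).
have a0 : a 0 = 0 by rewrite /a subrr.
have b0 : b 0 = 0 by rewrite /b subrr.
have [Ka Ka0 HKa] := bump_mul_bound dphi sa a0.
have [Kb Kb0 HKb] := bump_mul_bound dphi sb b0.
pose K := Ka + Kb; have K0 : 0 <= K by rewrite /K; lra.
(* 9 counts the pairs of a component and a derivative, and [(8 * s) ^+ 3] is the
   volume of [box (4 * s)]. *)
exists (9 * 8 ^+ 3 * K ^+ 2); first by rewrite mulr_ge0// sqr_ge0.
move=> s s0 s6.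
pose eta := bump phi s 0 0 0.
have seta : smooth eta := smooth_bump dphi s 0 0 0.
pose fa y := eta y * a y; pose fb y := eta y * b y.
have sfa : smooth fa := smoothM seta sa.
have sfb : smooth fb := smoothM seta sb.
pose w := curl2 fa fb; exists w.
have si : 0 < s^-1 by rewrite invr_gt0.
have suppa : supp fa `<=` box (3 * s).
  apply: supp_min; first exact: closed_box.
  by move=> x nx; rewrite /fa /eta bump_eq0 ?mul0r.
have suppb : supp fb `<=` box (3 * s).
  apply: supp_min; first exact: closed_box.
  by move=> x nx; rewrite /fb /eta bump_eq0 ?mul0r.
have out l x : ~ box (3 * s) x -> pderivs l fa x = 0 /\ pderivs l fb x = 0.
  move=> nx; split; apply: supp_vanish => /pderivs_supp.
  - by move/suppa.
  - by move/suppb.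
have sw i : smooth (w i) := smooth_curl2 i sfa sfb.
have w0 i x : ~ box (3 * s) x -> w i x = 0.
  move=> nx; move: i; apply: axesP.
  - by rewrite (_ : w axis0 x = - pderivs [:: axis2] fb x)// (out _ _ nx).2 oppr0.
  - by rewrite (_ : w axis1 x = pderivs [:: axis2] fa x)// (out _ _ nx).1.
  - by rewrite (_ : w axis2 x = pderivs [:: axis0] fb x - pderivs [:: axis1] fa x)// (out _ _ nx).1 (out _ _ nx).2 subrr.
have suppw i : supp (w i) `<=` box (3 * s).
  by apply: supp_min; [exact: closed_box|move=> x; exact: w0].
have s31 : 3 * s <= 1 by lra.
have tw i : test_function (@unit_ball R) (w i).
  split; first exact: sw.
    exact: subclosed_compact (@supp_closed _ (w i)) (compact_box s31) (@suppw i).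
  exact: subset_trans (@suppw i) (box_sub_ball s0 s6).
have dw x : divergence w x = 0 by exact: div_curl2.
have Dw : solenoidal_test (@unit_ball R) w by [].
have fab i x : box (3 * s) x -> `|pderiv i fa x| <= Ka /\ `|pderiv i fb x| <= Kb.
  move=> xs; split.
  - by have [] := HKa s x s0 s6 xs i i.
  - by have [] := HKb s x s0 s6 xs i i.
have fabij i j x : box (3 * s) x -> `|pderiv j (pderiv i fa) x| <= Ka * s^-1 /\
    `|pderiv j (pderiv i fb) x| <= Kb * s^-1.
  move=> xs; split.
  - by have [] := HKa s x s0 s6 xs i j.
  - by have [] := HKb s x s0 s6 xs i j.
have wK i x : `|w i x| <= K.
  have [xs|nx] := pselect (box (3 * s) x); last by rewrite w0// normr0.
  have h k := fab k x xs; rewrite /K; move: i; apply: axesP.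
  - by rewrite (_ : w axis0 x = - pderiv axis2 fb x)// normrN; have [_ h2] := h axis2; lra.
  - by rewrite (_ : w axis1 x = pderiv axis2 fa x)//; have [h2 _] := h axis2; lra.
  - rewrite (_ : w axis2 x = pderiv axis0 fb x - pderiv axis1 fa x)//.
    apply: le_trans (ler_normB _ _) _; have [_ h1] := h axis0; have [h2 _] := h axis1; lra.
have dwK i j x : `|pderiv j (w i) x| <= K * s^-1.
  have [xs|nx] := pselect (box (3 * s) x); last first.
    rewrite pderiv_supp ?normr0 ?mulr_ge0// ?ltW//.
    by move=> /suppw.
  have h k := fabij k j x xs.
  have hKa : 0 <= Ka * s^-1 by rewrite mulr_ge0// ltW.
  have hKb : 0 <= Kb * s^-1 by rewrite mulr_ge0// ltW.
  have -> : K * s^-1 = Ka * s^-1 + Kb * s^-1 by rewrite /K; ring.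
  have pa k := smooth_pderiv k sfa; have pb k := smooth_pderiv k sfb.
  move: i; apply: axesP.
  - have -> : pderiv j (w axis0) x = - pderiv j (pderiv axis2 fb) x.
      by have := pderivN j (pb axis2) => /(congr1 (fun u => u x)).
    rewrite normrN; have [_ h2] := h axis2.
    by apply: (le_trans h2); rewrite lerDr.
  - have -> : pderiv j (w axis1) x = pderiv j (pderiv axis2 fa) x by [].
    by have [h2 _] := h axis2; apply: (le_trans h2); rewrite lerDl.
  - have -> : pderiv j (w axis2) x = pderiv j (pderiv axis0 fb) x - pderiv j (pderiv axis1 fa) x.
      by have := pderivB j (pb axis0) (pa axis1) => /(congr1 (fun u => u x)).
    apply: le_trans (ler_normB _ _) _; have [_ h1] := h axis0; have [h2 _] := h axis1.
    by rewrite addrC lerD.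
have s40 : 0 < 4 * s by lra.
have s41 : 4 * s <= 1 by lra.
(* [w] lives on the closed [box (3 * s)]; [triple_Int_small] asks for vanishing
   already at [`|coord i x| = r], whence the slightly larger [4 * s]. *)
have out4 x : (exists i, 4 * s <= `|coord i x|) -> ~ box (3 * s) x.
  by move=> [i xi] /(_ i) h; lra.
have sqr_le (y c : R) : `|y| <= c -> `|y * y| <= c ^+ 2.
  by move=> yc; rewrite normrM expr2 ler_pM.
have wint i : triple_Int (fun x => w i x * w i x) <= (2 * (4 * s)) ^+ 3 * K ^+ 2.
  apply: le_trans (ler_norm _) _; apply: triple_Int_small => //.
  - exact: (contM (smooth_cont (sw i)) (smooth_cont (sw i))).
  - by move=> y; exact: (sqr_le _ _ (wK i y)).
  - by move=> y /out4 ny; rewrite (w0 i y ny) mul0r.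
have cdw i j := smooth_cont (smooth_pderiv j (sw i)).
have dwint i j : triple_Int (fun x => pderiv j (w i) x * pderiv j (w i) x) <=
    (2 * (4 * s)) ^+ 3 * (K * s^-1) ^+ 2.
  apply: le_trans (ler_norm _) _; apply: triple_Int_small => //.
  - exact: (contM (cdw i j) (cdw i j)).
  - by move=> y; exact: (sqr_le _ _ (dwK i j y)).
  - by move=> y /out4 ny; rewrite pderiv_supp ?mul0r// => /suppw.
have ss : s * s^-1 = 1 by rewrite divff// lt0r_neq0.
have K2 : 0 <= K ^+ 2 by exact: sqr_ge0.
split; [exact: Dw| | |].
- split=> [i|x]; last first.
    have -> : v - w = (-1) *: w + v by rewrite scaleN1r addrC.
    by have [_ ->] := solenoidal_test_lin (-1) Dw (conj tv dv : solenoidal_test _ v).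
  have svw : smooth ((v - w) i) := smoothB (sv i) (sw i).
  have sub1 : supp ((v - w) i) `<=` supp (v i) `|` box (3 * s).
    apply: supp_min; first by apply: closedU; [exact: supp_closed|exact: closed_box].
    move=> x /not_orP[n1 n2]; have -> : (v - w) i x = v i x - w i x by [].
    by rewrite (supp_vanish n1) w0// subrr.
  (* The closed set [2 * s <= enorm x] contains the support and is disjoint from
     the ball of radius [s]. *)
  have sub2 : supp ((v - w) i) `<=` [set x | 2 * s <= enorm x].
    apply: supp_min.
      have := @closed_comp _ _ (@enorm R) [set t | 2 * s <= t] (fun x _ => @cont_enorm R x).
      by apply; exact: closed_ge.
    move=> x /negP; rewrite -ltNge => xs.
    have -> : (v - w) i x = v i x - w i x by [].
    apply/eqP; rewrite subr_eq0; apply/eqP.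
    have near_s : \forall y \near x, enorm y < 2 * s.
      have /cvgr_lt := @cont_enorm R x; exact.
    have near_eta : \forall y \near x, eta y = 1.
      apply: filterS near_s => y ys; apply: bump_eq1 => // j.
      by apply: le_trans (coord_enorm j y) (ltW ys).
    rewrite /w (@near_curl2 _ fa fb a b).
    + apply/esym; apply: curl_vprim => //.
      have := coord_enorm axis2 x; rewrite ler_norml => /andP[h1 _].
      by apply: le_trans h1; rewrite lerN2; apply/ltW/(lt_trans xs); clear -s6; lra.
    + by apply: filterS near_eta => y; rewrite /fa => ->; rewrite mul1r.
    + by apply: filterS near_eta => y; rewrite /fb => ->; rewrite mul1r.
  split=> //.
    apply: subclosed_compact sub1; first exact: supp_closed.
    by apply: compactU; [case: (tv i)|exact: compact_box].
  move=> x xs; apply/andP; split.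
    by have /= := sub2 x xs; lra.
  by have [] := sub1 x xs; [case: (tv i) => _ _; apply|exact: box_sub_ball].
- have c0 i : @vanishing_cont R (@unit_ball R) (w i) := test_C0 (tw i).
  rewrite (C0_ip OB c0 c0).
  apply: le_trans (ler_sum _ (fun i _ => wint i)) _.
  rewrite big_const_ord iter_addr_0.
  have -> : (2 * (4 * s)) ^+ 3 * K ^+ 2 *+ 3 = 3 * 8 ^+ 3 * K ^+ 2 * s ^+ 3 by ring.
  have h3 : s ^+ 3 <= s.
    rewrite exprS -[leRHS]mulr1 ler_wpM2l//; first exact: ltW.
    by rewrite exprn_ile1// ?ltW//; lra.
  apply: (@le_trans _ _ (3 * 8 ^+ 3 * K ^+ 2 * s)).
    by apply: ler_wpM2l => //; rewrite mulr_ge0.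
  by apply: ler_wpM2r; [exact: ltW|apply: ler_wpM2r => //; lra].
- rewrite (dirichlet_form OB Dw Dw).
  apply: le_trans (ler_sum _ (fun i _ => ler_sum _ (fun j _ => dwint i j))) _.
  rewrite !big_const_ord !iter_addr_0.
  have -> : (2 * (4 * s)) ^+ 3 * (K * s^-1) ^+ 2 *+ 3 *+ 3 =
     9 * 8 ^+ 3 * K ^+ 2 * s * (s * s^-1) ^+ 2 by ring.
  by rewrite ss expr1n mulr1.
Qed.

End Approximation.

(** * Comparison of the first eigenvalues *)

Section FirstEigenvalue.
Context {R : realType}.
Implicit Types (v w : field R).

Lemma stokes_eigenvalue_ge (Omega : set (space R)) (m l : R) :
  measurable (Omega : set (mspace R)) -> Omega `<=` @unit_ball R ->
  (forall v, solenoidal_test Omega v -> m * ip Omega v v <= ip Omega (stokes_op v) v) ->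
  stokes_eigenvalue Omega l -> m <= l.
Proof.
move=> mO OB mP [u u0 uE].
exact: (friedrichs_ge (L2_lin mO) (ip_psd mO) solenoidal_test_lin
  (solenoidal_L2_sub mO OB) (stokes_op_L2 mO OB) (dirichlet_psd mO OB) mP u0 uE).
Qed.

(** [friedrichs_min] produces an eigenvalue that bounds the Rayleigh quotient
    from below, and [l] is at most this eigenvalue.  A test field of nonzero norm
    exists because the eigenvector for [l] is a limit of test fields. *)
Lemma first_eigenvalue_le (Omega : set (space R)) (l : R) v :
  measurable (Omega : set (mspace R)) -> Omega `<=` @unit_ball R ->
  first_stokes_eigenvalue Omega l -> solenoidal_test Omega v ->
  l * ip Omega v v <= ip Omega (stokes_op v) v.
Proof.
move=> mO OB [[u u0 uE] lmin] Dv.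
have lin := L2_lin mO; have psd := ip_psd mO; have sub := solenoidal_L2_sub mO OB.
have ne : exists2 w, solenoidal_test Omega w & ip Omega w w != 0.
  apply: contrapT => /forall2NP H.
  have [[[Lu Hu] _] _] := uE.
  have bu : 0 < ip Omega u u by rewrite lt_neqAle eq_sym u0 (psd_ge0 psd).
  have [w Dw h] := Hu _ (divr_gt0 bu (ltr0n R 2)).
  have w0 : ip Omega w w = 0.
    by have [//|/negP] := H w; rewrite negbK => /eqP.
  have Lw := sub w Dw.
  have CS := psd_CS lin psd Lu Lw; rewrite w0 mulr0 in CS.
  have uw : ip Omega u w = 0.
    by apply/eqP; rewrite -sqrf_eq0 eq_le CS sqr_ge0.
  move: h; rewrite (psd_sqrB lin psd Lu Lw) uw w0 mulr0 subr0 addr0; lra.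
have [m [mE mP]] := friedrichs_min lin psd (@solenoidal_test_lin R Omega) sub (stokes_op_L2 mO OB)
  (dirichlet_psd mO OB) (L2_complete mO) (rellich mO OB) ne.
apply: le_trans (mP v Dv); apply: ler_wpM2r; first exact: (psd_ge0 psd (sub v Dv)).
by apply: lmin; exact: mE.
Qed.

Lemma ip_annulus (s : R) v : solenoidal_test (annulus s) v ->
  ip (annulus s) v v = ip (@unit_ball R) v v /\
  ip (annulus s) (stokes_op v) v = ip (@unit_ball R) (stokes_op v) v.
Proof.
move=> Dv; have AB := @annulus_sub R s; have BB : @unit_ball R `<=` @unit_ball R by [].
have Dv' := solenoidal_mono AB Dv.
split; last by rewrite (dirichlet_form AB Dv Dv) (dirichlet_form BB Dv' Dv').
by rewrite (ip_sqr AB Dv) (ip_sqr BB Dv').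
Qed.

(** By Cauchy-Schwarz, [`|q u w| <= eta]. *)
Lemma psd_perturb (E : lmodType R) (V : set E) q (u w : E) (eta delta : R) :
  lin_closed V -> psd_form V q -> V u -> V w -> 0 <= eta ->
  q w w <= delta -> q u u * delta <= eta ^+ 2 ->
  `|q (u - w) (u - w) - q u u| <= 2 * eta + delta.
Proof.
move=> lin psd Vu Vw eta0 wd ud.
have quu := psd_ge0 psd Vu; have qww := psd_ge0 psd Vw.
have CS := psd_CS lin psd Vu Vw.
have : `|q u w| <= eta.
  rewrite -(ler_pXn2r (n:=2))// ?nnegrE// real_normK ?num_real//.
  by apply: (le_trans CS); apply: le_trans ud; apply: ler_wpM2l.
rewrite (psd_sqrB lin psd Vu Vw) !ler_norml => /andP[h1 h2].
move: (q u u) (q u w) (q w w) {CS ud quu} h1 h2 qww wd => x y z h1 h2 qww wd.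
by apply/andP; split; lra.
Qed.

End FirstEigenvalue.

Unset Implicit Arguments.

Theorem mainTheorem5 (R : realType) (lambda : R -> R) (lambda_o : R)
  (hlambda : forall sigma : R, 0 < sigma -> sigma < 1 ->
     first_stokes_eigenvalue (annulus sigma) (lambda sigma))
  (hlambda_o : first_stokes_eigenvalue (@unit_ball R) lambda_o) :
  lambda sigma @[sigma --> 0^'+] --> lambda_o.
Proof.
have mB := @measurable_unit_ball R; have BB : @unit_ball R `<=` @unit_ball R by [].
have lower sigma : 0 < sigma -> sigma < 1 -> lambda_o <= lambda sigma.
  move=> s0 s1; have AB := @annulus_sub R sigma.
  apply: (stokes_eigenvalue_ge (measurable_annulus sigma) AB _ (hlambda sigma s0 s1).1).
  move=> v Dv; have [-> ->] := ip_annulus Dv.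
  exact: (first_eigenvalue_le mB BB hlambda_o (solenoidal_mono AB Dv)).
apply/cvgrPdist_lt => e e0.
pose L := lambda_o + e / 2.
(* A test field of the ball with Rayleigh quotient below [lambda_o + e / 2]. *)
have [v Dv hv] : exists2 v : field R, solenoidal_test (@unit_ball R) v &
    ip (@unit_ball R) (stokes_op v) v < L * ip (@unit_ball R) v v.
  apply: contrapT => /forall2NP H.
  suff : L <= lambda_o by rewrite /L; lra.
  apply: (stokes_eigenvalue_ge mB BB _ hlambda_o.1) => v Dv.
  by have [//|/negP] := H v; rewrite -leNgt.
have lin := @solenoidal_test_lin R (@unit_ball R).
have linL := L2_lin mB; have bpsd := ip_psd mB; have apsd := dirichlet_psd mB BB.
have sub := solenoidal_L2_sub mB BB.
have [K K0 HK] := punctured_approx Dv.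
set a := ip _ (stokes_op v) v in hv; set b := ip _ v v in hv.
have a0 : 0 <= a := psd_ge0 apsd Dv.
have b0 : 0 <= b := psd_ge0 bpsd (sub v Dv).
(* Changing [a] and [b] by at most [3 * eta] changes [L * b - a] by at most
   [3 * eta * M], which is less than [c = 8 * eta * M]. *)
pose c := L * b - a; have c0 : 0 < c by rewrite subr_gt0.
pose M := `|L| + 1; have M0 : 0 < M by rewrite /M ltr_wpDl.
pose eta := c / (8 * M); have eta0 : 0 < eta by rewrite divr_gt0// mulr_gt0.
pose q := K * (1 + a + b) + 1.
have q0 : 0 < q by rewrite /q ltr_wpDl// mulr_ge0//; lra.
pose d := Num.min eta (eta ^+ 2); have d0 : 0 < d by rewrite lt_min eta0 exprn_gt0.
near=> sigma.
have s0 : 0 < sigma by near: sigma; exact: nbhs_right_gt.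
have s6 : sigma < 1 / 6 by near: sigma; apply: nbhs_right_lt; lra.
have sd : sigma < d / q by near: sigma; apply: nbhs_right_lt; exact: divr_gt0.
have s1 : sigma < 1 by lra.
have lo := lower sigma s0 s1.
rewrite distrC ger0_norm ?subr_ge0//.
suff : lambda sigma < L by rewrite /L; lra.
have [w [Dw Dvw bw aw]] := HK sigma s0 s6.
have Ks0 : 0 <= K * sigma by rewrite mulr_ge0// ltW.
have Ksd : K * sigma * (1 + a + b) <= d.
  rewrite ltr_pdivlMr// in sd.
  have : sigma * q = K * sigma * (1 + a + b) + sigma by rewrite /q; ring.
  move: sd; move: (sigma * q) (K * sigma * (1 + a + b)) => y z; lra.
have de1 : d <= eta by rewrite /d ge_min lexx.
have de2 : d <= eta ^+ 2 by rewrite /d ge_min lexx orbT.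
have [k1 k2 k3] : [/\ K * sigma <= eta, b * (K * sigma) <= eta ^+ 2 & a * (K * sigma) <= eta ^+ 2].
  have ta : 0 <= K * sigma * a by rewrite mulr_ge0.
  have tb : 0 <= K * sigma * b by rewrite mulr_ge0.
  have E : K * sigma * (1 + a + b) = K * sigma + K * sigma * a + K * sigma * b by ring.
  rewrite E in Ksd; rewrite (mulrC b) (mulrC a).
  move: Ksd ta tb Ks0 de1 de2.
  move: (K * sigma * a) (K * sigma * b) (K * sigma) (eta ^+ 2) => x y z t h1 h2 h3 h4 h5 h6.
  by clear -h1 h2 h3 h4 h5 h6; split; lra.
pose a' := ip (@unit_ball R) (stokes_op (v - w)) (v - w).
pose b' := ip (@unit_ball R) (v - w) (v - w).
have pb : `|b' - b| <= 2 * eta + K * sigma :=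
  psd_perturb linL bpsd (sub v Dv) (sub w Dw) (ltW eta0) bw k2.
have pa : `|a' - a| <= 2 * eta + K * sigma :=
  psd_perturb lin apsd Dv Dw (ltW eta0) aw k3.
have b'0 : 0 <= b' :=
  psd_ge0 bpsd (sub _ (solenoidal_mono (@annulus_sub R sigma) Dvw)).
have hl : lambda sigma * b' <= a'.
  have := first_eigenvalue_le (measurable_annulus sigma) (@annulus_sub R sigma) (hlambda sigma s0 s1) Dvw.
  by have [-> ->] := ip_annulus Dvw.
move: a' b' pa pb b'0 hl => a' b' pa pb b'0 hl.
have ce : c = 8 * M * eta by rewrite /eta; field; exact: lt0r_neq0.
have a'L : a' < L * b'.
  have hL : `|L * (b' - b)| <= `|L| * (3 * eta).
    by rewrite normrM ler_wpM2l//; apply: le_trans pb _; lra.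
  have ha : a' - a <= 3 * eta.
    by apply: le_trans (ler_norm _) _; apply: le_trans pa _; lra.
  have hL2 : - (`|L| * (3 * eta)) <= L * (b' - b).
    by rewrite ler_norml in hL; case/andP: hL.
  have Le : 0 <= `|L| * eta by rewrite mulr_ge0// ltW.
  have E1 : L * b' = L * (b' - b) + (c + a) by rewrite /c; ring.
  have E2 : c = 8 * (`|L| * eta) + 8 * eta by rewrite ce /M; ring.
  have E3 : `|L| * (3 * eta) = 3 * (`|L| * eta) by ring.
  rewrite E1 E2; rewrite E3 in hL2.
  have e00 := eta0; move: hL2 ha Le e00.
  by move: (L * (b' - b)) (`|L| * eta) (eta : R) => x y z; clear; lra.
have b'p : 0 < b'.
  rewrite lt_neqAle b'0 andbT; apply/eqP => bz.
  by move: hl a'L; rewrite -bz !mulr0 => h1 h2; have := le_lt_trans h1 h2; rewrite ltxx.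
by rewrite -(ltr_pM2r b'p); exact: le_lt_trans hl a'L.
Unshelve. all: by end_near.
Qed.
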